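(* Let $A,B\subset\mathbb{R}^n$ be set-germs at $0$ with $0\in\overline{A}\cap\overline{B}$, and let $h:(\mathbb{R}^n,0)\to(\mathbb{R}^n,0)$ be a bi-Lipschitz homeomorphism (germ). Suppose that $h(A)$ and $h(B)$ are subanalytic. Then the following are equivalent: (1) $D(h(A))\subset D(h(B))$; (2) there are $d>1$, $C>0$ such that $A\subset ST_d(B;C)$ as germs at $0$.
   Context: A bi-Lipschitz homeomorphism germ is a homeomorphism between neighbourhoods of $0$ fixing $0$ with $K_1|x-y|\le|h(x)-h(y)|\le K_2|x-y|$ for some $0<K_1\le K_2$ near $0$. Direction set: $D(A)=\{a\in S^{n-1} : \exists\, \{x_i\}\subset A\setminus\{0\},\ x_i\to 0,\ x_i/\|x_i\|\to a\}$. Sea-tangle neighbourhood: $ST_d(B;C)=\{x\in\mathbb{R}^n : \mathrm{dist}(x,B)\le C|x|^d\}$. ''As germs at $0$'' means the inclusion holds after intersecting with some neighbourhood of $0$. *)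

(* Defs.v *)
From HB Require Import structures.
From mathcomp Require Import all_boot all_order all_algebra.
From mathcomp Require Import all_classical all_reals all_analysis.
Set Implicit Arguments. Unset Strict Implicit. Unset Printing Implicit Defensive.
Import Order.TTheory GRing.Theory Num.Theory.
Import numFieldNormedType.Exports.
Local Open Scope classical_set_scope.
Local Open Scope ring_scope.

Section Defs.
Variable R : realType.

Definition enorm n (x : 'rV[R]_n) : R := Num.sqrt (\sum_(i < n) x ord0 i ^+ 2).

Definition eball0 n (r : R) : set 'rV[R]_n := [set x | enorm x < r].

Definition edist n (x : 'rV[R]_n) (B : set 'rV[R]_n) : R :=
  inf [set enorm (x - b) | b in B].

Definition sea_tangle n (d C : R) (B : set 'rV[R]_n) : set 'rV[R]_n :=
  [set x | edist x B <= C * (enorm x) `^ d].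

Definition germ_subset n (A B : set 'rV[R]_n) : Prop :=
  exists r : R, 0 < r /\ A `&` @eball0 n r `<=` B.

Definition direction_set n (A : set 'rV[R]_n) : set 'rV[R]_n :=
  [set a | enorm a = 1 /\
     exists x : nat -> 'rV[R]_n,
       (forall i, A (x i) /\ x i != 0) /\
       x @ \oo --> (0 : 'rV[R]_n) /\
       (fun i => (enorm (x i))^-1 *: x i) @ \oo --> a].

Definition bilipschitz_homeo_germ n (h : 'rV[R]_n -> 'rV[R]_n)
    (U : set 'rV[R]_n) : Prop :=
  [/\ h 0 = 0, open U, U 0 & open (h @` U)] /\
  (forall x y, U x -> U y -> h x = h y -> x = y) /\
  {within U, continuous h} /\
  (exists g : 'rV[R]_n -> 'rV[R]_n,
      (forall x, U x -> g (h x) = x) /\ {within h @` U, continuous g}) /\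
  (exists K1 K2 r : R, [/\ 0 < K1, K1 <= K2, 0 < r &
      forall x y, enorm x < r -> enorm y < r ->
        K1 * enorm (x - y) <= enorm (h x - h y) /\
        enorm (h x - h y) <= K2 * enorm (x - y)]).

Definition psum k (c : ('I_k -> nat) -> R) (a x : 'rV[R]_k) (N : nat) : R :=
  \sum_(al : {ffun 'I_k -> 'I_N.+1})
     c (fun i => nat_of_ord (al i)) *
     \prod_(i < k) (x ord0 i - a ord0 i) ^+ al i.

Definition pabssum k (c : ('I_k -> nat) -> R) (a x : 'rV[R]_k) (N : nat) : R :=
  \sum_(al : {ffun 'I_k -> 'I_N.+1})
     `|c (fun i => nat_of_ord (al i))| *
     \prod_(i < k) `|x ord0 i - a ord0 i| ^+ al i.

Definition analytic_on k (U : set 'rV[R]_k) (f : 'rV[R]_k -> R) : Prop :=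
  forall a, U a -> exists (r : R) (c : ('I_k -> nat) -> R), 0 < r /\
    forall x, U x -> enorm (x - a) < r ->
      (exists M : R, forall N, pabssum c a x N <= M) /\
      psum c a x N @[N --> \oo] --> f x.

(* Semianalytic subsets of R^k: locally finite unions of sets
   {f = 0, g_1 > 0, ..., g_p > 0} with f, g_l analytic
   (the number p of inequalities is made uniform by padding with g = 1) *)
Definition semianalytic k (X : set 'rV[R]_k) : Prop :=
  forall a : 'rV[R]_k, exists U : set 'rV[R]_k, open U /\ U a /\
    exists (q p : nat) (f : 'I_q -> 'rV[R]_k -> R)
           (g : 'I_q -> 'I_p -> 'rV[R]_k -> R),
      (forall j, analytic_on U (f j)) /\
      (forall j l, analytic_on U (g j l)) /\
      X `&` U = [set x | U x /\ exists j : 'I_q, f j x = 0 /\ forall l, 0 < g j l x].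

Definition subanalytic_germ0 n (S : set 'rV[R]_n) : Prop :=
  exists W : set 'rV[R]_n, open W /\ W 0 /\
    exists (m : nat) (Z : set 'rV[R]_(n + m)),
      semianalytic Z /\ (exists M : R, forall z, Z z -> enorm z <= M) /\
      S `&` W = (@lsubmx R 1 n m) @` Z.

End Defs.

(* Main.v *)
(** Blowing up the origin turns a subanalytic germ [S] into the projection of a
bounded semianalytic set [Y] in the variables (direction, norm [t], hidden
variables). The key fact ([tame_an]) is that every point of [Y] with small [t]
lies on a path in [Y] parametrised by [t], uniformly Hoelder in [t]; compactness of
the space of directions and hidden variables makes this uniform, and paths project,
so no projection theorem for semianalytic sets is needed. Hence the directions of
the points of [S] of norm [t] are at Hausdorff distance [O(t ^ e)] from
[direction_set S]. If the limit directions of [h(A)] are limit directions of [h(B)],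
each point of [h(A)] of norm [t] is therefore within [O(t ^ (1 + e))] of [h(B)], and
the bi-Lipschitz map [h] carries this back to [A] and [B]. The converse only uses
that [o(t)]-close points have close directions.

For the key fact one follows, for a finite family of analytic functions, a path along
which none of them changes sign, by induction on the number of variables. After
dividing by powers of [t] and a linear change of the other variables, the Weierstrass
preparation theorem replaces the functions by monic polynomials [P_i] in the last
variable. Let [P] be their product with [X - B] and [X + B]. By induction there is a
path in the remaining variables along which no minor of the Hankel matrix of the power
sums of the roots of [P] starts or ceases to vanish. Then the number of distinct
complex roots of [P] is constant along this path, so the real roots move continuously,
keeping their order and the factors [P_i] they annihilate, and the last variable is
carried along at a fixed barycentric position between two consecutive roots. A Hoelder
bound follows since a monic polynomial is small only on short intervals. *)
From Pilot Require Import Defs.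
From HB Require Import structures.
From mathcomp Require Import all_boot all_order all_algebra.
From mathcomp Require Import perm complex polyrcf.
From mathcomp Require Import all_classical all_reals all_analysis.
From mathcomp Require Import ring lra zify.
Set Implicit Arguments. Unset Strict Implicit. Unset Printing Implicit Defensive.
Import Order.TTheory GRing.Theory Num.Theory.
Import numFieldNormedType.Exports.
Local Open Scope classical_set_scope.
Local Open Scope ring_scope.

(** * Series *)

(** The difficulty is uniformity: an arc through each point, as curve selection provides, gives no
    common exponent, whereas a tangle neighbourhood asks for one. Parametrising all paths by [t]
    makes their constants comparable. Hoelder control is all one can expect, since roots of a
    polynomial of degree n are only 1/n-Hoelder in its coefficients; each induction step divides the
    exponent by such a degree.

    Following signs of functions rather than points of a set makes the induction close: the minors
    are again finitely many analytic functions, in one variable less. A discriminant would not do,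
    as it vanishes identically when roots stay multiple. The variable [t] has to survive every step:
    powers of [t] are divided out so that no remaining factor vanishes identically on t = 0, and the
    new last axis is taken inside this hyperplane, so the linear change leaves [t] alone.

    Analyticity is handled through real power series with weighted l^1 norms, so that products,
    substitutions and the preparation theorem become estimates of norms. Complex numbers occur only
    as roots. *)

Section Series.
Variable R : realType.
Implicit Types (u v : nat -> R) (l M : R).

Definition sums u l := \sum_(i < n) u i @[n --> \oo] --> l.

Lemma sumsP u l : sums u l <-> forall e, 0 < e ->
  exists N, forall n, (N <= n)%N -> `|\sum_(i < n) u i - l| < e.
Proof.
split=> [ul e e0|ul].
  have /cvgrPdist_lt/(_ e e0)[N _ HN] := ul.
  by exists N => n Nn; rewrite distrC; exact: HN.
apply/cvgrPdist_lt => e /ul[N HN]; exists N => // n /= Nn.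
by rewrite distrC; exact: HN.
Qed.

Lemma sums_uniq u l l' : sums u l -> sums u l' -> l = l'.
Proof. by move=> ul ul'; apply: (cvg_unique _ ul ul'); exact: norm_hausdorff. Qed.

Lemma eq_sums u v l : (forall i, u i = v i) -> sums u l -> sums v l.
Proof. by move=> uv; rewrite (_ : u = v)//; apply/funext. Qed.

Lemma sumsD u v l l' : sums u l -> sums v l' ->
  sums (fun i => u i + v i) (l + l').
Proof.
move=> ul vl; rewrite /sums; under eq_fun do rewrite big_split.
exact: cvgD.
Qed.

Lemma sumsZ c u l : sums u l -> sums (fun i => c * u i) (c * l).
Proof.
move=> ul; rewrite /sums; under eq_fun do rewrite -mulr_sumr.
by apply: cvgM => //; exact: cvg_cst.
Qed.

Lemma sumsB u v l l' : sums u l -> sums v l' ->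
  sums (fun i => u i - v i) (l - l').
Proof.
move=> ul /(@sumsZ (-1) _ _); rewrite mulN1r => vl.
by apply: eq_sums (sumsD ul vl) => i; rewrite mulN1r.
Qed.

Lemma sums_fin u n : (forall i, (n <= i)%N -> u i = 0) ->
  sums u (\sum_(i < n) u i).
Proof.
move=> u0; apply/sumsP => e e0; exists n => m nm.
rewrite -(subnKC nm) big_split_ord /= [X in _ + X - _]big1 ?addr0 ?subrr ?normr0//.
by move=> i _; rewrite u0// leq_addr.
Qed.

Lemma sums_bound u l M : sums u l -> (forall n, `|\sum_(i < n) u i| <= M) ->
  `|l| <= M.
Proof.
move=> ul uM; apply/ler_addgt0Pr => e e0.
have /sumsP/(_ e e0)[N HN] := ul.
have := HN N (leqnn N); have := uM N; set s := \sum_(i < _) _ => h1 h2.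
have : `|l| <= `|s| + `|s - l| by rewrite -lerBlDl (le_trans (lerB_dist _ _))// distrC.
lra.
Qed.

Lemma sums_ge0_le u l M : sums u l -> (forall n, \sum_(i < n) u i <= M) -> l <= M.
Proof.
move=> ul uM; apply/ler_addgt0Pr => e e0.
have /sumsP/(_ e e0)[N HN] := ul.
have := HN N (leqnn N); have := uM N; set s := \sum_(i < _) _.
rewrite ltr_norml; lra.
Qed.

Lemma sum_mono v n n' : (forall i, 0 <= v i) -> (n <= n')%N ->
  \sum_(i < n) v i <= \sum_(i < n') v i.
Proof.
move=> v0 nn'; rewrite -(subnKC nn') big_split_ord /= lerDl sumr_ge0//.
Qed.

Lemma sums_pos v M : (forall i, 0 <= v i) -> (forall n, \sum_(i < n) v i <= M) ->
  exists2 l, sums v l & forall n, \sum_(i < n) v i <= l.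
Proof.
move=> v0 vM.
pose s n := \sum_(i < n) v i.
have nd : {homo s : m n / (m <= n)%N >-> m <= n} by move=> m n mn; exact: (sum_mono v0 mn).
have cs : cvgn s by apply: nondecreasing_is_cvgn => //; exists M; move=> _ [n _ <-]; exact: vM.
exists (limn s); first exact: cs.
by move=> n; apply: (nondecreasing_cvgn_le nd cs).
Qed.

(** Both [v] and [v - u] have nonnegative terms and bounded partial sums, so [u] is the difference
    of two convergent series. *)
Lemma sums_abs u v M : (forall i, `|u i| <= v i) ->
  (forall n, \sum_(i < n) v i <= M) -> exists2 l, sums u l & `|l| <= M.
Proof.
move=> uv vM.
have [l ul] : exists l, sums u l.
  have [v' vv' _] := sums_pos (fun i => le_trans (normr_ge0 _) (uv i)) vM.
  have [w ww _] : exists2 l, sums (fun i => v i - u i) l &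
      forall n, \sum_(i < n) (v i - u i) <= l.
    apply: (@sums_pos _ (2 * M)) => [i|n].
      by rewrite subr_ge0; exact: le_trans (ler_norm _) (uv i).
    apply: (@le_trans _ _ (\sum_(i < n) (v i + v i))).
      by apply: ler_sum => i _; rewrite lerD2l (le_trans (ler_norm _))// normrN.
    by rewrite big_split/=; have := vM n; lra.
  exists (v' - w); apply: eq_sums (sumsB vv' ww) => i; lra.
exists l => //; apply: sums_bound ul _ => n.
by rewrite (le_trans (ler_norm_sum _ _ _))// (le_trans _ (vM n))// ler_sum.
Qed.

Lemma sums_shift u l n : sums u l <->
  sums (fun i => u (n + i)%N) (l - \sum_(i < n) u i).
Proof.
rewrite !sumsP; split=> H e /H[N HN].
  exists N => m Nm; have := HN (n + m)%N (leq_trans Nm (leq_addl _ _)).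
  rewrite big_split_ord /=; set x := \sum_(i < m) _; set y := \sum_(i < n) _.
  by rewrite (_ : y + x - l = x - (l - y)); last by ring.
exists (n + N)%N => m Nm.
have nm : (n <= m)%N by apply: leq_trans Nm; exact: leq_addr.
have := HN (m - n)%N; rewrite leq_subRL// => /(_ Nm).
rewrite -[in X in _ -> X](subnKC nm) big_split_ord /=.
set x := \sum_(i < m - n) _; set y := \sum_(i < n) _.
by rewrite (_ : y + x - l = x - (l - y)); last by ring.
Qed.

(** Fubini for a double series whose rows are dominated by a summable [M]: both iterated sums are
    compared with one finite rectangle of [K] rows and [n] columns. *)
Lemma sums_exchange (a m : nat -> nat -> R) (b M : nat -> R) B F :
  (forall i, sums (a i) (b i)) -> (forall i j, `|a i j| <= m i j) ->
  (forall i n, \sum_(j < n) m i j <= M i) ->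
  (forall n, \sum_(i < n) M i <= B) -> sums b F ->
  exists2 c, forall j, sums (a ^~ j) (c j) & sums c F.
Proof.
move=> ab am mM MB bF.
have m0 i j : 0 <= m i j by exact: le_trans (normr_ge0 _) (am i j).
have M0 i : 0 <= M i by have := mM i 0%N; rewrite big_ord0.
have mMi i j : m i j <= M i.
  apply: le_trans (mM i j.+1); rewrite big_ord_recr/= lerDr sumr_ge0//.
have hc j : exists c, sums (a ^~ j) c.
  have [c ? _] := @sums_abs (a ^~ j) M B (fun i => le_trans (am i j) (mMi i j)) MB.
  by exists c.
have [c cE] := choice hc.
exists c => //; apply/sumsP => e e0.
have [L ML MLle] := sums_pos M0 MB.
have e8 : 0 < e / 8 by rewrite divr_gt0.
have [I HI] := (sumsP _ _).1 ML _ e8.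
have [I2 HI2] := (sumsP _ _).1 bF _ e8.
have hNs i : exists N, forall n, (N <= n)%N ->
    `|\sum_(j < n) a i j - b i| < e / 8 / I.+1%:R.
  by have /sumsP := ab i; apply; rewrite divr_gt0// ltr0n.
have [Ns HNs] := choice hNs.
exists (\max_(i < I) Ns i) => n Nn.
have hJs j : exists N, forall i, (N <= i)%N ->
    `|\sum_(i' < i) a i' j - c j| < e / 8 / n.+1%:R.
  by have /sumsP := cE j; apply; rewrite divr_gt0// ltr0n.
have [Js HJs] := choice hJs.
(* Enough rows to pass [I], where the tail of [M] is small, and to reach convergence of [b] and of
   each of the first [n] columns; [n] is already large enough for the first [I] rows. The errors add
   up to 5 e / 8. *)
pose K := (I + (I2 + \max_(j < n) Js j))%N.
have IK : (I <= K)%N by rewrite leq_addr.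
have small k k' : \sum_(j < k') (e / 8 / k.+1%:R) <= e / 8 * (k'%:R / k.+1%:R).
  by rewrite sumr_const card_ord -[X in X <= _]mulr_natr -(mulrA (e / 8)) [k.+1%:R^-1 * _]mulrC.
have h1 : `|\sum_(j < n) c j - \sum_(j < n) \sum_(i < K) a i j| <= e / 8.
  rewrite -sumrB (le_trans (ler_norm_sum _ _ _))//.
  apply: (le_trans (y := \sum_(j < n) (e / 8 / n.+1%:R))).
    apply: ler_sum => j _; rewrite distrC ltW// HJs// /K.
    have h : (Js j <= \max_(j < n) Js j)%N by exact: (@leq_bigmax _ (fun j : 'I_n => Js j) j).
    by rewrite (leq_trans h)// addnA leq_addl.
  apply: le_trans (small _ _) _; rewrite ger_pMr// ler_pdivrMr ?ltr0n// mul1r ler_nat//.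
have h2 : `|\sum_(i < K) b i - F| < e / 8.
  by apply: HI2; rewrite /K addnCA leq_addr.
have h3 : `|\sum_(i < K) (\sum_(j < n) a i j - b i)| <= 3 * (e / 8).
  rewrite -(subnKC IK) big_split_ord /= (le_trans (ler_normD _ _))//.
  rewrite (_ : 3 * _ = e / 8 + 2 * (e / 8)); last by ring.
  apply: lerD.
    rewrite (le_trans (ler_norm_sum _ _ _))//.
    apply: (le_trans (y := \sum_(j < I) (e / 8 / I.+1%:R))).
      apply: ler_sum => i _; rewrite ltW// HNs//.
      by apply: leq_trans Nn; exact: (@leq_bigmax _ (fun j : 'I_I => Ns j) i).
    by apply: le_trans (small _ _) _; rewrite ger_pMr// ler_pdivrMr ?ltr0n// mul1r ler_nat.
  rewrite (le_trans (ler_norm_sum _ _ _))//.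
  apply: (le_trans (y := \sum_(i < K - I) (2 * M (I + i)%N))).
    apply: ler_sum => i _; rewrite mulr_natl mulr2n (le_trans (ler_normB _ _))//.
    apply: lerD.
      by rewrite (le_trans (ler_norm_sum _ _ _))// (le_trans _ (mM _ n))// ler_sum.
    apply: sums_bound (ab _) _ => k.
    by rewrite (le_trans (ler_norm_sum _ _ _))// (le_trans _ (mM _ k))// ler_sum.
  rewrite -mulr_sumr ler_pM2l//.
  have := HI I (leqnn I); have := MLle K; rewrite -[in X in X -> _](subnKC IK) big_split_ord /= ltr_norml.
  set x := \sum_(i < _) _; set y := \sum_(i < _) _; lra.
have -> : \sum_(j < n) c j - F = (\sum_(j < n) c j - \sum_(j < n) \sum_(i < K) a i j) +
   (\sum_(i < K) (\sum_(j < n) a i j - b i)) + (\sum_(i < K) b i - F).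
  by rewrite exchange_big sumrB/=; ring.
apply: le_lt_trans (ler_normD _ _) _.
have := ler_normD (\sum_(j < n) c j - \sum_(j < n) \sum_(i < K) a i j) (\sum_(i < K) (\sum_(j < n) a i j - b i)).
lra.
Qed.

End Series.

(** * Analytic functions on polydiscs *)

Section AnalyticFunctions.
Variable R : realType.
Implicit Types (r x y : nat -> R) (f g : (nat -> R) -> R) (M : R).

Definition box k r x := forall i, (i < k)%N -> `|x i| <= r i.

(* [an k r M f]: on the polydisc [box k r] the function [f] of the first [k]
   coordinates is the sum of a power series whose l^1-norm with weights [r] is
   at most [M]; the last variable is expanded first. *)
Fixpoint an k r M f : Prop :=
  if k is k'.+1 then
    exists (g : nat -> (nat -> R) -> R) (m : nat -> R),
      [/\ forall j, an k' r (m j) (g j),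
          forall n, \sum_(j < n) m j * r k' ^+ j <= M &
          forall x, box k'.+1 r x -> sums (fun j => g j x * x k' ^+ j) (f x)]
  else exists2 c, `|c| <= M & forall x, f x = c.

Lemma boxW k r x : box k.+1 r x -> box k r x.
Proof. by move=> bx i ik; apply: bx; rewrite ltnS ltnW. Qed.

Lemma an_ge0 k r M f : an k r M f -> 0 <= M.
Proof.
case: k => [[c cM _]|k [g [m [_ mM _]]]]; first exact: le_trans cM.
by have := mM 0%N; rewrite big_ord0.
Qed.

Lemma an_bound k r M f x : an k r M f -> box k r x -> `|f x| <= M.
Proof.
elim: k M f => [|k IH] M f; first by move=> [c cM ->].
move=> [g [m [gm mM fs]]] bx.
apply: sums_bound (fs _ bx) _ => n.
rewrite (le_trans (ler_norm_sum _ _ _))// (le_trans _ (mM n))// ler_sum// => i _.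
rewrite normrM normrX ler_pM//; first by apply: IH (gm i) (boxW bx).
by rewrite lerXn2r ?nnegrE ?(le_trans _ (bx k (ltnSn k)))// bx.
Qed.

Lemma an_ext k r M f f' : (forall x, box k r x -> f x = f' x) ->
  an k r M f -> an k r M f'.
Proof.
case: k => [|k] ff'.
  by move=> [c cM fc]; exists c => // x; rewrite -ff'// => i; rewrite ltn0.
move=> [g [m [gm mM fs]]]; exists g, m; split => // x bx.
by rewrite -ff'//; exact: fs.
Qed.

Lemma an_weak k r M M' f : M <= M' -> an k r M f -> an k r M' f.
Proof.
move=> MM'; case: k => [|k]; first by move=> [c cM fc]; exists c; rewrite ?(le_trans cM).
move=> [g [m [gm mM fs]]]; exists g, m; split => // n.
exact: le_trans MM'.
Qed.

Lemma an0 k r : an k r 0 (fun=> 0).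
Proof.
elim: k => [|k IH]; first by exists 0; rewrite ?normr0.
exists (fun _ _ => 0), (fun=> 0); split=> // [n|x _].
  by rewrite big1// => i _; rewrite mul0r.
have := @sums_fin _ (fun j => 0 * x k ^+ j) 0%N.
by rewrite big_ord0; apply => i _; rewrite mul0r.
Qed.

Lemma an_lift k r M f : an k r M f -> an k.+1 r M f.
Proof.
move=> fM; exists (fun j => if j == 0%N then f else fun=> 0),
  (fun j => if j == 0%N then M else 0); split.
- by case=> [|j] //=; exact: an0.
- case=> [|n]; first by rewrite big_ord0 (an_ge0 fM).
  by rewrite big_ord_recl/= big1 ?addr0 ?mulr1// => i _; rewrite mul0r.
- move=> x _.
  have := @sums_fin _ (fun j => (if j == 0%N then f else fun=> 0) x * x k ^+ j) 1%N.
  rewrite big_ord1 /= mulr1; apply.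
  by case=> // i _; rewrite mul0r.
Qed.

Lemma an_cst k r c : an k r `|c| (fun=> c).
Proof. by elim: k => [|k IH]; [exists c | exact: an_lift]. Qed.

Lemma an_add k r M M' f f' : an k r M f -> an k r M' f' ->
  an k r (M + M') (fun x => f x + f' x).
Proof.
elim: k M M' f f' => [|k IH] M M' f f'.
  move=> [c cM fc] [c' cM' fc']; exists (c + c') => [|x]; last by rewrite fc fc'.
  by rewrite (le_trans (ler_normD _ _))// lerD.
move=> [g [m [gm mM fs]]] [g' [m' [gm' mM' fs']]].
exists (fun j x => g j x + g' j x), (fun j => m j + m' j); split.
- by move=> j; apply: IH; [exact: gm|exact: gm'].
- move=> n; under eq_bigr do rewrite mulrDl.
  by rewrite big_split/=; apply: lerD; [exact: mM|exact: mM'].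
- move=> x bx; apply: eq_sums (sumsD (fs x bx) (fs' x bx)) => i.
  by rewrite mulrDl.
Qed.

(** Normally convergent sums stay analytic: the coefficients in the last variable are summed
    separately and [sums_exchange] regroups the double series. Products, substitutions and
    Weierstrass division all reduce to this. *)
Lemma an_series k r (Ms : nat -> R) M fs F : (forall i, (i < k)%N -> 0 < r i) ->
  (forall i, an k r (Ms i) (fs i)) -> (forall n, \sum_(i < n) Ms i <= M) ->
  (forall x, box k r x -> sums (fs ^~ x) (F x)) -> an k r M F.
Proof.
elim: k Ms M fs F => [|k IH] Ms M fs F r0 fsM MM fsF.
  have b0 x : box 0 r x by move=> i; rewrite ltn0.
  exists (F (fun=> 0)).
    apply: sums_bound (fsF _ (b0 _)) _ => n.
    rewrite (le_trans (ler_norm_sum _ _ _))// (le_trans _ (MM n))// ler_sum// => i _.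
    exact: an_bound (fsM i) (b0 _).
  move=> x; apply: sums_uniq (fsF _ (b0 _)) _.
  apply: eq_sums (fsF _ (b0 _)) => i.
  by have [c _ cE] := fsM i; rewrite !cE.
have [g gE] := choice fsM.
have [m mE] := choice gE.
have gm i j : an k r (m i j) (g i j) by have [H _ _] := mE i; exact: H.
have mM i n : \sum_(j < n) m i j * r k ^+ j <= Ms i by have [_ H _] := mE i; exact: H.
have gs i x : box k.+1 r x -> sums (fun j => g i j x * x k ^+ j) (fs i x).
  by have [_ _ H] := mE i; exact: H.
have m0 i j : 0 <= m i j by exact: an_ge0 (gm i j).
have rk0 : 0 < r k by exact: r0.
have rj0 j : 0 < r k ^+ j by exact: exprn_gt0.
have mr i j : m i j * r k ^+ j <= Ms i.
  apply: le_trans (mM i j.+1); rewrite big_ord_recr /= lerDr.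
  by apply: sumr_ge0 => *; rewrite mulr_ge0// ltW.
have hw j : exists l, sums (fun i => m i j * r k ^+ j) l /\
   forall n, \sum_(i < n) m i j * r k ^+ j <= l.
  have [i|n|l] := @sums_pos _ (fun i => m i j * r k ^+ j) M.
  - by rewrite mulr_ge0// ltW.
  - by apply: le_trans (MM n); apply: ler_sum.
  - by exists l.
have [w wE] := choice hw.
have wm j n : \sum_(i < n) m i j <= w j / r k ^+ j.
  by rewrite ler_pdivlMr// mulr_suml; exact: (wE j).2.
have hG j x : exists l, box k r x -> sums (fun i => g i j x) l.
  have [bx|nbx] := pselect (box k r x); last by exists 0.
  have [l ? _] := @sums_abs _ (fun i => g i j x) (fun i => m i j) (w j / r k ^+ j)
     (fun i => an_bound (gm i j) bx) (wm j).
  by exists l.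
have hG' j : exists G, forall x, box k r x -> sums (fun i => g i j x) (G x).
  by have [G GE] := choice (hG j); exists G.
have [G GE] := choice hG'.
exists G, (fun j => w j / r k ^+ j); split.
- move=> j; apply: (IH (m ^~ j) _ (g ^~ j)) => //; last exact: GE.
  by move=> i ik; rewrite r0// ltnS ltnW.
- move=> n.
  have hs : sums (fun i => \sum_(j < n) m i j * r k ^+ j) (\sum_(j < n) w j).
    elim: n => [|n IHn].
      rewrite big_ord0; apply: (@eq_sums _ (fun=> 0)) => [i|]; first by rewrite big_ord0.
      have := @sums_fin _ (fun=> 0 : R) 0%N.
      by rewrite big_ord0; apply.
    rewrite big_ord_recr/=; apply: eq_sums (sumsD IHn (wE n).1) => i.
    by rewrite big_ord_recr.
  under eq_bigr => j _ do rewrite divfK ?gt_eqF//.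
  apply: sums_ge0_le hs _ => N; apply: le_trans (MM N).
  by apply: ler_sum => i _; exact: mM.
move=> x bx.
have [|||||c cE cF] := @sums_exchange _ (fun i j => g i j x * x k ^+ j)
    (fun i j => m i j * r k ^+ j) (fs ^~ x) Ms M (F x).
- by move=> i; exact: gs.
- move=> i j; rewrite normrM normrX ler_pM// ?(an_bound (gm i j) (boxW bx))//.
  by rewrite lerXn2r ?nnegrE ?(ltW rk0)// bx.
- exact: mM.
- exact: MM.
- exact: fsF.
apply: eq_sums cF => j.
apply: sums_uniq (cE j) _.
rewrite mulrC; apply: eq_sums (sumsZ (c := x k ^+ j) (GE j x (boxW bx))) => i.
by rewrite mulrC.
Qed.

Lemma an_mulXn k r M f j : an k.+1 r M f -> 0 < r k ->
  an k.+1 r (M * r k ^+ j) (fun x => f x * x k ^+ j).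
Proof.
move=> [g [m [gm mM fs]]] rk.
exists (fun i => if (i < j)%N then fun=> 0 else g (i - j)%N),
  (fun i => if (i < j)%N then 0 else m (i - j)%N); split.
- by move=> i /=; case: ifP => _; [exact: an0|exact: gm].
- move=> n; have [nj|jn] := leqP n j.
    rewrite big1 => [|i _]; last by rewrite (leq_trans _ nj)// mul0r.
    by rewrite mulr_ge0 ?exprn_ge0 ?(ltW rk)//; have := mM 0%N; rewrite big_ord0.
  rewrite -(subnKC (ltnW jn)) big_split_ord/= big1 ?add0r => [|i _]; last by rewrite ltn_ord mul0r.
  under eq_bigr => i _ do rewrite ltnNge leq_addr/= addKn addnC exprD mulrA.
  by rewrite -mulr_suml ler_pM2r ?exprn_gt0//; exact: mM.
- move=> x bx; apply/(@sums_shift _ _ _ j).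
  rewrite big1 ?subr0 => [|i _]; last by rewrite ltn_ord mul0r.
  rewrite mulrC; apply: eq_sums (sumsZ (c := x k ^+ j) (fs x bx)) => i.
  by rewrite ltnNge leq_addr/= addKn exprD; ring.
Qed.

(** Only the second factor is expanded in the last variable; summing the first factor times each
    term with [an_series] avoids the Cauchy product. *)
Lemma an_mul k r M M' f f' : (forall i, (i < k)%N -> 0 < r i) ->
  an k r M f -> an k r M' f' -> an k r (M * M') (fun x => f x * f' x).
Proof.
elim: k M M' f f' => [|k IH] M M' f f' r0.
  move=> [c cM fc] [c' cM' fc']; exists (c * c') => [|x]; last by rewrite fc fc'.
  by rewrite normrM ler_pM.
have r0' i : (i < k)%N -> 0 < r i by move=> ik; rewrite r0// ltnS ltnW.
move=> fM f'M; have := f'M => -[h [mh [hm hM hs]]].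
have M0 := an_ge0 fM.
have fh j : an k.+1 r (M * mh j) (fun x => f x * h j x).
  have [g [m [gm mM fs]]] := fM.
  exists (fun i x => g i x * h j x), (fun i => m i * mh j); split.
  - by move=> i; exact: (IH _ _ _ _ r0' (gm i) (hm j)).
  - move=> n; under eq_bigr do rewrite mulrAC.
    by rewrite -mulr_suml; apply: ler_wpM2r; [exact: an_ge0 (hm j)|exact: mM].
  - move=> x bx; rewrite mulrC.
    apply: eq_sums (sumsZ (c := h j x) (fs x bx)) => i; ring.
apply: (@an_series _ _ (fun j => M * mh j * r k ^+ j) _
   (fun j x => f x * h j x * x k ^+ j)) => //.
- by move=> j; apply: an_mulXn (r0 _ _).
- move=> n; under eq_bigr do rewrite -mulrA.
  by rewrite -mulr_sumr; apply: ler_wpM2l => //; exact: hM.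
- move=> x bx; apply: eq_sums (sumsZ (c := f x) (hs x bx)) => j; ring.
Qed.

Lemma an_scale k r M f c : (forall i, (i < k)%N -> 0 < r i) ->
  an k r M f -> an k r (`|c| * M) (fun x => c * f x).
Proof. by move=> r0; apply: an_mul => //; exact: an_cst. Qed.

Lemma an_coord k r i : (forall i, (i < k)%N -> 0 < r i) -> (i < k)%N ->
  an k r (r i) (fun x => x i).
Proof.
elim: k => // k IH r0; rewrite ltnS leq_eqVlt => /orP[/eqP ->|ik].
  have := @an_mulXn k r 1 (fun=> 1) 1%N.
  rewrite mul1r expr1 => h; apply: an_ext (h _ _); last exact: r0.
    by move=> x _; rewrite mul1r expr1.
  by have := an_cst k.+1 r 1; rewrite normr1.
by apply: an_lift; apply: IH => // j jk; rewrite r0// ltnS ltnW.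
Qed.

Lemma an_exp k r M f n : (forall i, (i < k)%N -> 0 < r i) ->
  an k r M f -> an k r (M ^+ n) (fun x => f x ^+ n).
Proof.
move=> r0 fM; elim: n => [|n IH].
  by have := an_cst k r 1; rewrite normr1.
by rewrite exprS; apply: an_ext (an_mul r0 fM IH) => x _; rewrite exprS.
Qed.

(** Substituting functions of norm at most [r i] turns a monomial into a function of norm at most
    the weight of that monomial, so the norm cannot increase. *)
Lemma an_comp k r M f k' r' (phi : nat -> (nat -> R) -> R) :
  (forall i, (i < k')%N -> 0 < r' i) -> (forall i, (i < k)%N -> 0 < r i) ->
  an k r M f -> (forall i, (i < k)%N -> an k' r' (r i) (phi i)) ->
  an k' r' M (fun y => f (fun i => phi i y)).
Proof.
move=> r'0; elim: k M f => [|k IH] M f r0.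
  move=> [c cM fc] _.
  by apply: an_weak cM _; apply: an_ext (an_cst _ _ c) => x _; rewrite fc.
move=> [g [m [gm mM fs]]] phir.
apply: (@an_series _ _ (fun j => m j * r k ^+ j) _
   (fun j y => g j (fun i => phi i y) * phi k y ^+ j)) => //.
- move=> j; apply: an_mul => //; last exact/an_exp/phir.
  by apply: IH (gm j) _ => i ik; [apply: r0|apply: phir]; rewrite ltnS ltnW.
- move=> y hy; apply: fs => i ik.
  exact: an_bound (phir i ik) hy.
Qed.

Lemma an_shrink k r r' M f : (forall i, (i < k)%N -> 0 < r' i <= r i) ->
  an k r M f -> an k r' M f.
Proof.
move=> r'r fM.
have r'0 i : (i < k)%N -> 0 < r' i by move=> /r'r/andP[].
apply: (an_comp (phi := fun i x => x i)) fM _ => //.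
- by move=> i ik; have /andP[] := r'r i ik; exact: lt_le_trans.
- move=> i ik; apply: an_weak (an_coord _ _) => //.
  by have /andP[] := r'r i ik.
Qed.

End AnalyticFunctions.

(** * Lipschitz bounds, division by powers of a variable, identity theorem *)

Section AnalyticTheory.
Variable R : realType.
Implicit Types (r x y : nat -> R) (f g : (nat -> R) -> R) (M : R).

Definition upd x k (s : R) : nat -> R := fun i => if i == k then s else x i.

Lemma updE x k s : upd x k s k = s. Proof. by rewrite /upd eqxx. Qed.

Lemma upd_lt x k s i : (i < k)%N -> upd x k s i = x i.
Proof. by rewrite /upd => /ltn_eqF ->. Qed.

(** Points are infinite sequences so that the number of variables can vary without casts; this
    recovers that only the first [k] entries matter. *)
Lemma an_local k r M f x y : an k r M f -> box k r x ->
  (forall i, (i < k)%N -> x i = y i) -> f x = f y.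
Proof.
elim: k M f => [|k IH] M f; first by move=> [c _ fc]; rewrite !fc.
move=> [g [m [gm mM fs]]] bx xy.
have byy : box k.+1 r y by move=> i ik; rewrite -xy//; exact: bx.
apply: sums_uniq (fs x bx) _; apply: eq_sums (fs y byy) => j.
rewrite xy//; congr (_ * _); apply/esym/(IH _ _ (gm j) (boxW bx)) => i ik.
by apply: xy; rewrite ltnS ltnW.
Qed.

(** Halving the radius absorbs the factor j of the derivative, so the bound is a multiple of the
    weight [a ^+ j] that is uniform in [j]. *)
Lemma expr_lip (a X Y : R) j : 0 < a -> `|X| <= a / 2 -> `|Y| <= a / 2 ->
  `|X ^+ j - Y ^+ j| <= 2 / a * a ^+ j * `|X - Y|.
Proof.
move=> a0 Xa Ya; elim: j => [|j IH].
  by rewrite subrr normr0 !mulr_ge0 ?invr_ge0// ltW.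
have -> : X ^+ j.+1 - Y ^+ j.+1 = X * (X ^+ j - Y ^+ j) + (X - Y) * Y ^+ j.
  by rewrite !exprS; ring.
rewrite (le_trans (ler_normD _ _))// !normrM normrX.
have -> : 2 / a * a ^+ j.+1 * `|X - Y| =
    a / 2 * (2 / a * a ^+ j * `|X - Y|) + `|X - Y| * a ^+ j.
  by rewrite exprS; field; rewrite gt_eqF.
apply: lerD; first by rewrite ler_pM.
rewrite ler_wpM2l// lerXn2r ?nnegrE ?(ltW a0)//.
by rewrite (le_trans Ya)//; lra.
Qed.

Lemma an_lip k r : (forall i, (i < k)%N -> 0 < r i) ->
  exists2 c, 0 <= c & forall M f, an k r M f -> forall x y,
    box k (fun i => r i / 2) x -> box k (fun i => r i / 2) y ->
    `|f x - f y| <= c * M * \sum_(i < k) `|x i - y i|.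
Proof.
elim: k => [|k IH] r0.
  exists 0 => // M f [c _ fc] x y _ _.
  by rewrite !fc subrr normr0 big_ord0 mulr0.
have [|c c0 cP] := IH; first by move=> i ik; rewrite r0// ltnS ltnW.
have rk : 0 < r k by exact: r0.
exists (c + 2 / r k); first by rewrite addr_ge0// divr_ge0// ltW.
move=> M f fM x y bx byy; have M0 := an_ge0 fM.
move: fM => [g [m [gm mM fs]]].
have half z : box k.+1 (fun i => r i / 2) z -> box k.+1 r z.
  by move=> bz i ik; rewrite (le_trans (bz i ik))// ler_pdivrMr// ler_peMr ?ltW ?r0// ltr1n.
apply: sums_bound (sumsB (fs x (half x bx)) (fs y (half y byy))) _ => n.
set S := \sum_(i < k) `|x i - y i|.
have S0 : 0 <= S by exact: sumr_ge0.
rewrite (le_trans (ler_norm_sum _ _ _))//.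
apply: (@le_trans _ _ (\sum_(j < n) m j * r k ^+ j * (c * S + 2 / r k * `|x k - y k|))).
  apply: ler_sum => j _.
  have m0 := an_ge0 (gm j).
  have -> : g j x * x k ^+ j - g j y * y k ^+ j =
     (g j x - g j y) * x k ^+ j + g j y * (x k ^+ j - y k ^+ j) by ring.
  rewrite (le_trans (ler_normD _ _))// !normrM mulrDr lerD//.
    rewrite -mulrA [r k ^+ j * _]mulrC mulrA ler_pM//.
      by rewrite [m j * _]mulrCA mulrA; exact: cP (gm j) _ _ (boxW bx) (boxW byy).
    by rewrite normrX lerXn2r ?nnegrE ?(ltW rk)//; exact: half bx _ _.
  rewrite -mulrA ler_pM ?(an_bound (gm j) (boxW (half _ byy)))//.
  rewrite mulrA [r k ^+ j * _]mulrC.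
  by apply: expr_lip => //; [exact: bx|exact: byy].
rewrite -mulr_suml [in leRHS]mulrAC [leRHS]mulrC ler_pM//.
- by apply: sumr_ge0 => j _; rewrite mulr_ge0 ?exprn_ge0 ?(ltW rk)// (an_ge0 (gm j)).
- by rewrite addr_ge0 ?mulr_ge0 ?invr_ge0 ?(ltW rk).
rewrite big_ord_recr/= -/S mulrDr !mulrDl.
have h1 : 0 <= 2 / r k * S by rewrite !mulr_ge0// invr_ge0 ltW.
have h2 : 0 <= c * `|x k - y k| by rewrite mulr_ge0.
lra.
Qed.

(** The quotient [q] is the series with its first [D] coefficients dropped and the others shifted
    down. One family [p] serves every [D], so [D] can be chosen after looking at the
    coefficients. *)
Lemma an_div k r M f : (forall i, (i < k.+1)%N -> 0 < r i) -> an k.+1 r M f ->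
  exists p : nat -> (nat -> R) -> R,
  [/\ forall j, an k r (M / r k ^+ j) (p j),
      forall x, box k.+1 r x -> sums (fun j => p j x * x k ^+ j) (f x) &
      forall D, exists q, [/\ an k.+1 r (M / r k ^+ D) q,
        forall x, box k.+1 r x ->
          f x = \sum_(j < D) p j x * x k ^+ j + x k ^+ D * q x &
        forall x, box k.+1 r x -> x k = 0 -> q x = p D x]].
Proof.
move=> r0 [p [m [pm mM fs]]].
have rk : 0 < r k by exact: r0.
have m0 j : 0 <= m j by exact: an_ge0 (pm j).
have mr0 j : 0 <= m j * r k ^+ j by rewrite mulr_ge0// exprn_ge0// ltW.
exists p; split=> // [j|D].
  apply: an_weak (pm j); rewrite ler_pdivlMr ?exprn_gt0//.
  by apply: le_trans (mM j.+1); rewrite big_ord_recr/= lerDr sumr_ge0.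
have mD n : \sum_(j < n) m (D + j)%N * r k ^+ j <= M / r k ^+ D.
  rewrite ler_pdivlMr ?exprn_gt0// mulr_suml; apply: le_trans (mM (D + n)%N).
  rewrite big_split_ord/= ler_wpDl ?sumr_ge0//.
  by apply: ler_sum => j _; rewrite exprD; rewrite -mulrA [r k ^+ j * _]mulrC.
have hq x : exists l, box k.+1 r x -> sums (fun j => p (D + j)%N x * x k ^+ j) l.
  have [bx|nbx] := pselect (box k.+1 r x); last by exists 0.
  have [|l ? _] := @sums_abs _ (fun j => p (D + j)%N x * x k ^+ j) (fun j => m (D + j)%N * r k ^+ j) _ _ mD.
    move=> j; rewrite normrM normrX ler_pM ?(an_bound (pm _) (boxW bx))//.
    by rewrite lerXn2r ?nnegrE ?(ltW rk)// bx.
  by exists l.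
have [q qE] := choice hq.
exists q; split.
- by exists (fun j => p (D + j)%N), (fun j => m (D + j)%N); split => [j||]; [exact: pm|exact: mD|exact: qE].
- move=> x bx.
  have := sumsZ (c := x k ^+ D) (qE x bx) => h.
  have /sums_shift : sums (fun j => p j x * x k ^+ j) (f x) by exact: fs.
  move/(_ D) => h'; apply/eqP; rewrite addrC -subr_eq; apply/eqP.
  apply: sums_uniq h' _; apply: eq_sums h => j.
  by rewrite exprD; ring.
- move=> x bx xk; apply: sums_uniq (qE x bx) _.
  have := @sums_fin _ (fun j => p (D + j)%N x * x k ^+ j) 1%N.
  rewrite big_ord1 addn0 mulr1; apply => -[//|i _].
  by rewrite xk exprS mul0r mulr0.
Qed.

(** The exponent [a] is the first index whose coefficient, [g], is not identically zero. *)
Lemma an_factor k r M f : (forall i, (i < k.+1)%N -> 0 < r i) -> an k.+1 r M f ->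
  (forall x, box k.+1 r x -> f x = 0) \/
  exists (a : nat) f1 g M1 M2, [/\ an k.+1 r M1 f1, an k r M2 g,
    forall x, box k.+1 r x -> f x = x k ^+ a * f1 x,
    forall x, box k.+1 r x -> x k = 0 -> f1 x = g x &
    exists2 x, box k r x & g x != 0].
Proof.
move=> r0 fM; have [p [pM fs div]] := an_div r0 fM.
have [H|/existsNP[j0 Hj0]] := pselect (forall j x, box k r x -> p j x = 0).
  left=> x bx; apply: sums_uniq (fs x bx) _.
  have := @sums_fin _ (fun j => p j x * x k ^+ j) 0%N.
  by rewrite big_ord0; apply => j _; rewrite H ?mul0r//; exact: boxW.
right.
pose Pj j := `[< exists2 x, box k r x & p j x != 0 >].
have exP : exists j, Pj j.
  exists j0; apply/asboolP; apply: contrapT => H; apply: Hj0 => x bx.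
  by apply: contrapT => /eqP px; apply: H; exists x.
have [a /asboolP Pa mina] := ex_minnP exP.
have [q [qM fq q0]] := div a.
exists a, q, (p a), (M / r k ^+ a), (M / r k ^+ a); split=> // x bx.
rewrite fq// big1 ?add0r// => j _.
have [->|pj] := eqVneq (p j x) 0; first by rewrite mul0r.
have : Pj j by apply/asboolP; exists x => //; exact: boxW.
by move/mina; rewrite leqNgt ltn_ord.
Qed.

(** Recovers the value at [x k = 0] after an equation has been divided by a power of [x k], which is
    possible only where [x k] is nonzero. *)
Lemma an_cont0 k r M f s0 : (forall i, (i < k.+1)%N -> 0 < r i) ->
  an k.+1 r M f -> forall x, box k.+1 (fun i => r i / 2) x -> x k = 0 ->
  0 < s0 -> (forall s, 0 < s <= s0 -> s <= r k -> f (upd x k s) = 0) -> f x = 0.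
Proof.
move=> r0 fM x bx xk s00 H; apply/eqP; rewrite -normr_le0.
have [c c0 /(_ _ _ fM) cP] := an_lip r0; have M0 := an_ge0 fM.
apply/ler_addgt0Pr => e e0; rewrite add0r.
pose s := Num.min (Num.min s0 (r k / 2)) (e / (c * M + 1)).
have rk : 0 < r k by exact: r0.
have cM1 : 0 < c * M + 1 by rewrite ltr_wpDl// mulr_ge0.
have s_gt0 : 0 < s by rewrite !lt_min s00 !divr_gt0.
have s_s0 : s <= s0 by rewrite !ge_min lexx.
have s_r : s <= r k / 2 by rewrite !ge_min lexx !orbT.
have s_e : s <= e / (c * M + 1) by rewrite ge_min lexx orbT.
have bs : box k.+1 (fun i => r i / 2) (upd x k s).
  move=> i; rewrite /upd; have [->|ik] := eqVneq i k; last by exact: bx.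
  by rewrite ger0_norm// ltW.
have := cP _ _ bx bs; rewrite H ?s_gt0//; last by rewrite (le_trans s_r)//; lra.
rewrite subr0 big_ord_recr/= updE xk big1 ?add0r => [|i _]; last first.
  by rewrite upd_lt// subrr normr0.
rewrite normrN (gtr0_norm s_gt0) => /le_trans -> //.
apply: (@le_trans _ _ ((c * M + 1) * s)); first by rewrite ler_pM2r//; lra.
by rewrite mulrC -ler_pdivlMr.
Qed.

(** On the segment through [x] the function is a one-variable series in the scaling factor. If
    nonzero, it is a power times a function not vanishing at 0, which contradicts its vanishing for
    all factors up to [lam]. *)
Lemma an_identity k r M f (lam : R) : (forall i, (i < k)%N -> 0 < r i) ->
  an k r M f -> 0 < lam ->
  (forall x, box k (fun i => lam * r i) x -> f x = 0) ->
  forall x, box k r x -> f x = 0.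
Proof.
move=> r0 fM lam0 H x bx.
have FM : an 1 (fun=> 1) M (fun y => f (fun i => y 0%N * x i)).
  apply: (an_comp (phi := fun i y => y 0%N * x i)) r0 fM _ => // i ik.
  rewrite -[r i]mul1r; apply: an_mul => //.
    by apply: an_coord.
  by apply: an_weak (bx i ik) _; exact: an_cst.
have one : forall i, (i < 1)%N -> 0 < (fun=> 1 : R) i by [].
have [H0|] := an_factor one FM.
  have := H0 (fun=> 1); rewrite (_ : (fun i => 1 * x i) = x); last first.
    by apply/funext => i; rewrite mul1r.
  by apply=> i _; rewrite normr1.
move=> [a [f1 [g [M1 [M2 [f1M gM fE f1E [z _]]]]]]].
have b0 : box 1 (fun=> 1 / 2) (fun=> 0 : R) by move=> i _; rewrite normr0; lra.
have [c _ gc] := gM.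
have -> : g z = 0; last by rewrite eqxx.
rewrite gc -(gc (fun=> 0)) -f1E//; last by move=> i _; rewrite normr0.
apply: (an_cont0 one f1M b0 erefl lam0) => s /andP[s0 slam] s1.
have bs : box 1 (fun=> 1) (upd (fun=> 0) 0 s).
  by case=> // _; rewrite updE gtr0_norm.
have := fE _ bs; rewrite updE H.
  by move/esym/eqP; rewrite mulf_eq0 expf_eq0 (gt_eqF s0) andbF => /eqP.
move=> i ik; rewrite normrM (gtr0_norm s0); apply: ler_pM => //; first exact: ltW.
exact: bx.
Qed.

(** The lowest coefficients of the two factors in the last variable have product zero, so by
    induction one of them vanishes, against its choice. *)
Lemma an_domain k r M M' f f' : (forall i, (i < k)%N -> 0 < r i) ->
  an k r M f -> an k r M' f' ->
  (forall x, box k r x -> f x * f' x = 0) ->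
  (forall x, box k r x -> f x = 0) \/ (forall x, box k r x -> f' x = 0).
Proof.
elim: k M M' f f' => [|k IH] M M' f f' r0.
  move=> [c _ fc] [c' _ fc'] /(_ (fun=> 0)).
  rewrite fc fc' => /(_ ltac:(by move=> ?)) /eqP; rewrite mulf_eq0.
  by case/orP => /eqP E; [left|right] => x _; rewrite ?fc ?fc'.
move=> fM f'M ff'.
have [|[a [f1 [g [M1 [M2 [f1M gM fE f1E [z bz gz]]]]]]]] := an_factor r0 fM; first by left.
have [|[a' [f1' [g' [M1' [M2' [f1M' gM' fE' f1E' [z' bz' gz']]]]]]]] := an_factor r0 f'M; first by right.
exfalso.
have r0' i : (i < k)%N -> 0 < r i by move=> ik; rewrite r0// ltnS ltnW.
have gg : forall x, box k r x -> g x * g' x = 0.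
  (* The Lipschitz bound behind [an_cont0] holds on the half box only; the identity theorem extends
     the conclusion to the whole box. *)
  have half : (0 : R) < 2^-1 by rewrite invr_gt0.
  apply: (an_identity r0' (an_mul r0' gM gM') half) => x bx.
  pose y := upd x k 0.
  have rk : 0 < r k by exact: r0.
  have byy : box k.+1 (fun i => r i / 2) y.
    move=> i; rewrite ltnS leq_eqVlt => /orP[/eqP->|ik].
      by rewrite /y updE normr0 divr_ge0// ltW.
    by rewrite /y upd_lt// mulrC; exact: bx.
  have half' z1 : box k.+1 (fun i => r i / 2) z1 -> box k.+1 r z1.
    by move=> bz1 i ik; rewrite (le_trans (bz1 i ik))// ler_pdivrMr// ler_peMr ?ltW ?r0// ltr1n.
  have bxr : box k r x.
    move=> i ik; rewrite (le_trans (bx i ik))//= ler_piMl ?ltW ?r0'//; lra.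
  have xy i : (i < k)%N -> x i = y i by move=> ik; rewrite /y upd_lt.
  have yk : y k = 0 by exact: updE.
  have byr := half' _ byy.
  rewrite (an_local gM bxr xy) (an_local gM' bxr xy) -(f1E _ byr yk) -(f1E' _ byr yk).
  apply: (an_cont0 r0 (an_mul r0 f1M f1M') byy yk rk) => s /andP[s0 _] sr.
  have bs : box k.+1 r (upd y k s).
    move=> i; rewrite ltnS leq_eqVlt => /orP[/eqP->|ik].
      by rewrite updE gtr0_norm.
    by rewrite /y !upd_lt//; exact: bxr.
  have := ff' _ bs; rewrite fE// fE'// updE => /eqP.
  rewrite !mulf_eq0 !expf_eq0 (gt_eqF s0) !andbF /=.
  by case/orP => /eqP ->; rewrite ?mul0r ?mulr0.
have [H|H] := IH _ _ _ _ r0' gM gM' gg.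
  by rewrite H// eqxx in gz.
by rewrite H// eqxx in gz'.
Qed.

(** Every monomial has degree at least one, so shrinking all radii by [lam] gains a factor [lam].
    The smallness conditions of the preparation theorem are met this way. *)
Lemma an_small k r M f (lam : R) : (forall i, (i < k)%N -> 0 < r i) ->
  an k r M f -> f (fun=> 0) = 0 -> 0 < lam <= 1 ->
  an k (fun i => lam * r i) (lam * M) f.
Proof.
elim: k M f => [|k IH] M f r0.
  move=> [c cM fc]; rewrite fc => c0 /andP[l0 _]; exists 0; last by move=> x; rewrite fc.
  by rewrite normr0; apply: mulr_ge0; [exact: ltW|exact: le_trans cM].
move=> fM; have M0 := an_ge0 fM; move: fM.
move=> [g [m [gm mM fs]]] f0 /andP[l0 l1].
have rk : 0 < r k by exact: r0.
have r0' i : (i < k)%N -> 0 < r i by move=> ik; rewrite r0// ltnS ltnW.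
have lr i : (i < k.+1)%N -> 0 < lam * r i <= r i.
  by move=> ik; rewrite mulr_gt0 ?r0//= ler_piMl// ltW// r0.
have b0 : box k.+1 r (fun=> 0) by move=> i ik; rewrite normr0 ltW// r0.
have g0 : g 0%N (fun=> 0) = 0.
  rewrite -[RHS]f0; apply: sums_uniq _ (fs _ b0).
  have := @sums_fin _ (fun j => g j (fun=> 0) * 0 ^+ j) 1%N.
  rewrite big_ord1 mulr1; apply=> -[//|j _].
  by rewrite exprS mul0r mulr0.
exists g, (fun j => if j == 0%N then lam * m 0%N else m j); split.
- case=> [|j] /=; first by apply: IH (gm 0%N) g0 _ => //; rewrite l0.
  by apply: an_shrink (gm j.+1) => i ik; rewrite lr// ltnS ltnW.
- move=> n; apply: (@le_trans _ _ (\sum_(j < n) lam * (m j * r k ^+ j))).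
    apply: ler_sum => -[[|j] jn] _ /=; first by rewrite !expr0 !mulr1.
    rewrite exprMn mulrCA exprS -mulrA ler_wpM2l ?(ltW l0)//.
    rewrite ler_piMl ?mulr_ge0 ?exprn_ge0 ?(an_ge0 (gm j.+1)) ?(ltW rk)//.
    by rewrite exprn_ile1// ltW.
  by rewrite -mulr_sumr ler_wpM2l ?(ltW l0).
- move=> x bx; apply: fs => i ik; rewrite (le_trans (bx i ik))//.
  by have /andP[] := lr i ik.
Qed.

End AnalyticTheory.

(** * The Weierstrass preparation theorem *)

Section Weierstrass.
Variable R : realType.
Implicit Types (r x y : nat -> R) (f g : (nat -> R) -> R) (M : R).

Definition isan k r f := exists M, an k r M f.

Lemma isan_cst k r c : isan k r (fun=> c).
Proof. by exists `|c|; exact: an_cst. Qed.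

Lemma isanD k r f g : isan k r f -> isan k r g -> isan k r (fun x => f x + g x).
Proof. by move=> [M fM] [N gN]; exists (M + N); exact: an_add. Qed.

Lemma isanM k r f g : (forall i, (i < k)%N -> 0 < r i) ->
  isan k r f -> isan k r g -> isan k r (fun x => f x * g x).
Proof. by move=> r0 [M fM] [N gN]; exists (M * N); exact: an_mul. Qed.

Lemma isanN k r f : (forall i, (i < k)%N -> 0 < r i) ->
  isan k r f -> isan k r (fun x => - f x).
Proof.
move=> r0 [M fM]; exists (`|-1| * M).
by apply: an_ext (an_scale (-1) r0 fM) => x _; rewrite mulN1r.
Qed.

Lemma isan_sum (I : Type) (s : seq I) (P : pred I) k r (F : I -> (nat -> R) -> R) :
  (forall i, P i -> isan k r (F i)) -> isan k r (fun x => \sum_(i <- s | P i) F i x).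
Proof.
move=> H; elim: s => [|i s [M sM]].
  have [M hM] := isan_cst k r 0.
  by exists M; apply: an_ext hM => x _; rewrite big_nil.
case Pi : (P i); last by exists M; apply: an_ext sM => x _; rewrite big_cons Pi.
have [N hN] : isan k r (fun x => F i x + \sum_(j <- s | P j) F j x).
  by apply: isanD; [exact: H|exists M].
by exists N; apply: an_ext hN => x _; rewrite big_cons Pi.
Qed.

Lemma isan_prod (I : Type) (s : seq I) (P : pred I) k r (F : I -> (nat -> R) -> R) :
  (forall i, (i < k)%N -> 0 < r i) ->
  (forall i, P i -> isan k r (F i)) -> isan k r (fun x => \prod_(i <- s | P i) F i x).
Proof.
move=> r0 H; elim: s => [|i s [M sM]].
  have [M hM] := isan_cst k r 1.
  by exists M; apply: an_ext hM => x _; rewrite big_nil.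
case Pi : (P i); last by exists M; apply: an_ext sM => x _; rewrite big_cons Pi.
have [N hN] : isan k r (fun x => F i x * \prod_(j <- s | P j) F j x).
  by apply: isanM => //; [exact: H|exists M].
by exists N; apply: an_ext hN => x _; rewrite big_cons Pi.
Qed.

Lemma sum_quarter n : \sum_(i < n) (4^-1 : R) ^+ i <= 4 / 3.
Proof.
have -> : \sum_(i < n) (4^-1 : R) ^+ i = 4 / 3 - 4 / 3 * 4^-1 ^+ n.
  elim: n => [|n IH]; first by rewrite big_ord0 mulr1 subrr.
  by rewrite big_ord_recr/= IH exprS; field.
by rewrite gerBl mulr_ge0// exprn_ge0// invr_ge0.
Qed.

Lemma an_inv k r v : (forall i, (i < k)%N -> 0 < r i) -> an k r 4^-1 v ->
  exists2 u, an k r (4 / 3) u &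
    forall x, box k r x -> u x * (1 - v x) = 1 /\ 0 < u x.
Proof.
move=> r0 vM.
have vn i : an k r (4^-1 ^+ i) (fun x => v x ^+ i) by exact: an_exp.
have hu x : exists l, box k r x -> sums (fun i => v x ^+ i) l.
  have [bx|nbx] := pselect (box k r x); last by exists 0.
  have [l ? _] := @sums_abs _ (fun j => v x ^+ j) (fun j => 4^-1 ^+ j) _
    (fun j => an_bound (vn j) bx) sum_quarter.
  by exists l.
have [u uE] := choice hu.
exists u; first exact: (an_series r0 vn sum_quarter uE).
move=> x bx.
have h1 := uE x bx; have h2 := sumsZ (c := v x) h1.
have h3 := (sums_shift _ _ 1).1 h1.
have E : u x - 1 = v x * u x.
  rewrite big_ord1 expr0 in h3.
  by apply: sums_uniq h3 _; apply: eq_sums h2 => i; rewrite exprS.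
have uv : u x * (1 - v x) = 1 by rewrite mulrBr mulr1 [u x * _]mulrC -E; ring.
split=> //.
have := an_bound vM bx; rewrite ler_norml => /andP[_ v4].
have v1 : 0 < 1 - v x by lra.
by rewrite -(pmulr_lgt0 _ v1) uv.
Qed.

Lemma scale_exists (c d : R) : 0 <= c -> 0 < d -> exists2 l : R, 0 < l <= 1 & l * c <= d.
Proof.
move=> c0 d0; have c1 : 0 < c + 1 by rewrite ltr_wpDl.
exists (Num.min 1 (d / (c + 1))).
  by rewrite lt_min ltr01 divr_gt0//= ge_min lexx.
apply: (@le_trans _ _ (d / (c + 1) * c)).
  by rewrite ler_wpM2r// ge_min lexx orbT.
by rewrite mulrAC ler_pdivrMr// ler_pM2l// lerDl.
Qed.

Lemma min_radius k r : (forall i, (i < k)%N -> 0 < r i) ->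
  exists2 rho : R, 0 < rho & forall i, (i < k)%N -> rho <= r i.
Proof.
elim: k => [|k IH] r0; first by exists 1.
have [|rho rho0 H] := IH; first by move=> i ik; rewrite r0// ltnS ltnW.
exists (Num.min rho (r k)); first by rewrite lt_min rho0 r0.
move=> i; rewrite ltnS leq_eqVlt => /orP[/eqP->|ik]; first by rewrite ge_min lexx orbT.
by rewrite ge_min H.
Qed.

(* Division of [x_k ^ D] by [f = P + x_k ^ D Q]: writing [w] for the product of
   the quotient with [Q], the equation to solve is [w = 1 - tau (w h)] where
   [h = P / Q] has small norm and [tau] drops the terms of degree < D and
   divides by [x_k ^ D]; hence [w] is the sum of the iterates [ws]. *)
Lemma weierstrass_division k r D h : (forall i, (i < k.+1)%N -> 0 < r i) ->
  an k.+1 r (4^-1 * r k ^+ D) h ->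
  exists (w : (nat -> R) -> R) (p : nat -> (nat -> R) -> R),
    (forall j, isan k r (p j)) /\
    forall x, box k.+1 r x -> 0 < w x /\
      w x * h x + x k ^+ D * w x = x k ^+ D + \sum_(j < D) p j x * x k ^+ j.
Proof.
move=> r0 hM.
have r0' i : (i < k)%N -> 0 < r i by move=> ik; rewrite r0// ltnS ltnW.
have rk : 0 < r k by exact: r0.
(* The analyticity hypothesis stands after the existential so that [choice] yields a total function
   that can be iterated; the junk value is never reached from [ws]. *)
have step (a : nat * ((nat -> R) -> R)) :
  exists b : ((nat -> R) -> R) * (nat -> (nat -> R) -> R),
    an k.+1 r (4^-1 ^+ a.1) a.2 ->
    [/\ an k.+1 r (4^-1 ^+ a.1.+1) b.1,
        forall j, an k r (4^-1 ^+ a.1 * (4^-1 * r k ^+ D) / r k ^+ j) (b.2 j) &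
        forall x, box k.+1 r x ->
          a.2 x * h x = \sum_(j < D) b.2 j x * x k ^+ j - x k ^+ D * b.1 x].
  case: a => [n w] /=.
  have [wn|nwn] := pselect (an k.+1 r (4^-1 ^+ n) w); last first.
    by exists (fun=> 0, fun _ _ => 0).
  have [p [pM _ /(_ D)[q [qM qE _]]]] := an_div r0 (an_mul r0 wn hM).
  exists ((fun x => -1 * q x), p) => _; split=> // [|x bx].
    apply: an_weak (an_scale (-1) r0 qM).
    by rewrite normrN1 mul1r mulrA mulfK ?gt_eqF ?exprn_gt0// exprSr.
  by rewrite qE//=; ring.
have [nxt nxtE] := choice step.
(* The iterates of w -> - tau (w h) from 1; the n-th has norm at most 4^-n, since [h] has norm at
   most a quarter of [r k ^+ D]. *)
pose ws := fix ws n := if n is n'.+1 then (nxt (n', ws n')).1 else fun=> 1.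
have wsM n : an k.+1 r (4^-1 ^+ n) (ws n).
  elim: n => [|n IH]; first by have := an_cst k.+1 r 1; rewrite normr1.
  by have [] := nxtE (n, ws n) IH.
pose ps n := (nxt (n, ws n)).2.
have psM n j : an k r (4^-1 ^+ n * (4^-1 * r k ^+ D / r k ^+ j)) (ps n j).
  by have [_ H _] := nxtE (n, ws n) (wsM n); have := H j; rewrite !mulrA.
have psE n x : box k.+1 r x ->
    ws n x * h x = \sum_(j < D) ps n j x * x k ^+ j - x k ^+ D * ws n.+1 x.
  by have [_ _ H] := nxtE (n, ws n) (wsM n); exact: H.
have hw x : exists l, box k.+1 r x -> sums (ws ^~ x) l.
  have [bx|nbx] := pselect (box k.+1 r x); last by exists 0.
  have [l ? _] := @sums_abs _ (ws ^~ x) (fun j => 4^-1 ^+ j) _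
    (fun j => an_bound (wsM j) bx) sum_quarter.
  by exists l.
have [w wE] := choice hw.
have psB j n : \sum_(i < n) (4^-1 ^+ i * (4^-1 * r k ^+ D / r k ^+ j)) <=
    4 / 3 * (4^-1 * r k ^+ D / r k ^+ j).
  rewrite -mulr_suml ler_wpM2r ?sum_quarter//.
  by rewrite !mulr_ge0 ?invr_ge0 ?exprn_ge0// ltW.
have hp j : exists p, forall x, box k r x -> sums (fun n => ps n j x) (p x).
  suff hpx x : exists l, box k r x -> sums (fun n => ps n j x) l.
    by have [p pE] := choice hpx; exists p.
  have [bx|nbx] := pselect (box k r x); last by exists 0.
  have [l ? _] := @sums_abs _ (fun n => ps n j x)
    (fun i => 4^-1 ^+ i * (4^-1 * r k ^+ D / r k ^+ j)) _
    (fun i => an_bound (psM i j) bx) (psB j).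
  by exists l.
have [p pE] := choice hp.
exists w, p; split.
  by move=> j; eexists; apply: (an_series r0' (psM ^~ j) (psB j)) (pE j).
move=> x bx.
have h1 := wE x bx.
have h2 : sums (fun i => ws i.+1 x) (w x - 1).
  by have := (sums_shift _ _ 1).1 h1; rewrite big_ord1.
(* The iterates after the first sum to at most 1/3, which gives the positivity of [w]. *)
have w1 : `|w x - 1| <= 4^-1 * (4 / 3).
  apply: sums_bound h2 _ => n.
  rewrite (le_trans (ler_norm_sum _ _ _))//.
  apply: (@le_trans _ _ (\sum_(i < n) 4^-1 * 4^-1 ^+ i)).
    by apply: ler_sum => i _; rewrite -exprS; exact: an_bound (wsM _) bx.
  by rewrite -mulr_sumr ler_wpM2l ?sum_quarter// invr_ge0.
split; first by move: w1; rewrite ler_norml; lra.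
have h3 : sums (fun i => \sum_(j < D) ps i j x * x k ^+ j) (\sum_(j < D) p j x * x k ^+ j).
  elim: (D) => [|n IHn].
    rewrite big_ord0; apply: (@eq_sums _ (fun=> 0)) => [i|]; first by rewrite big_ord0.
    have := @sums_fin _ (fun=> 0 : R) 0%N.
    by rewrite big_ord0; apply.
  have hn : sums (fun i => ps i n x * x k ^+ n) (p n x * x k ^+ n).
    rewrite mulrC; apply: eq_sums (sumsZ (c := x k ^+ n) (pE n x (boxW bx))) => i.
    by rewrite mulrC.
  rewrite big_ord_recr/=; apply: eq_sums (sumsD IHn hn) => i.
  by rewrite big_ord_recr.
have h4 : sums (fun i => ws i x * h x) (w x * h x).
  by rewrite mulrC; apply: eq_sums (sumsZ (c := h x) h1) => i; rewrite mulrC.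
have h5 := sumsB h3 (sumsZ (c := x k ^+ D) h2).
have -> : w x * h x = \sum_(j < D) p j x * x k ^+ j - x k ^+ D * (w x - 1).
  by apply: sums_uniq h4 _; apply: eq_sums h5 => i; rewrite psE.
ring.
Qed.

(** Only signs are kept: the unit is [q0] times positive functions, so it contributes the constant
    sign [c]. The degree [D] is the order of vanishing of [f] at the origin along the last axis,
    finite because [f] is nonzero somewhere on this axis. *)
Lemma weierstrass_preparation k r M f (y0 : R) : (forall i, (i < k.+1)%N -> 0 < r i) ->
  an k.+1 r M f -> `|y0| <= r k -> f (upd (fun=> 0) k y0) != 0 ->
  exists (rho : R) (D : nat) (p : nat -> (nat -> R) -> R) (c : R),
    [/\ 0 < rho, forall j, isan k (fun=> rho) (p j) &
     forall x, box k.+1 (fun=> rho) x ->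
       Num.sg (f x) = c * Num.sg (x k ^+ D + \sum_(j < D) p j x * x k ^+ j)].
Proof.
move=> r0 fM y0r fy0.
have r0' i : (i < k)%N -> 0 < r i by move=> ik; rewrite r0// ltnS ltnW.
have rk : 0 < r k by exact: r0.
have [p [pM fs div]] := an_div r0 fM.
pose o : nat -> R := fun=> 0.
have bo r' k' : (forall i, (i < k')%N -> 0 < r' i) -> box k' r' o.
  by move=> H i ik; rewrite normr0 ltW// H.
have exD : exists j, p j o != 0.
  apply: contrapT => H.
  have bx : box k.+1 r (upd o k y0).
    move=> i; rewrite ltnS leq_eqVlt => /orP[/eqP->|ik]; first by rewrite updE.
    by rewrite upd_lt// normr0 ltW// r0'.
  case/negP: fy0; apply/eqP; apply: sums_uniq (fs _ bx) _.
  have := @sums_fin _ (fun j => p j (upd o k y0) * upd o k y0 k ^+ j) 0%N.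
  rewrite big_ord0; apply => j _.
  rewrite -(an_local (x := o) (pM j) (bo _ _ r0')) => [|i ik]; last by rewrite upd_lt.
  rewrite (_ : p j o = 0) ?mul0r//; apply/eqP/negPn/negP => pj; apply: H.
  by exists j.
have [D pD minD] := ex_minnP exD.
have p0 j : (j < D)%N -> p j o = 0.
  by move=> jD; apply/eqP; apply: contraLR jD => /minD; rewrite -leqNgt.
have {div} [Q [QM fQ Q0]] := div D.
have Qo : Q o = p D o by apply: Q0 => //; exact: bo.
pose q0 := p D o.
have vM : an k.+1 r (`|1| + `|- q0^-1| * (M / r k ^+ D)) (fun x => 1 + - q0^-1 * Q x).
  by apply: an_add; [exact: an_cst|exact: an_scale].
have vo : 1 + - q0^-1 * Q o = 0 by rewrite Qo mulNr mulVf// subrr.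
have q4 : (0 : R) < 4^-1 by rewrite invr_gt0.
(* Shrinks all radii until [1 - Q / q0] has norm at most 1/4, so that [Q] is invertible. *)
have [l /andP[l0 l1] lM] := scale_exists (an_ge0 vM) q4.
have v1M := an_weak lM (an_small r0 vM vo (introT andP (conj l0 l1))).
pose r1 := fun i => l * r i.
have r10 i : (i < k.+1)%N -> 0 < r1 i by move=> ik; rewrite mulr_gt0// r0.
have r11 i : (i < k.+1)%N -> 0 < r1 i <= r i.
  by move=> ik; rewrite r10//= ler_piMl// ltW// r0.
have r10' i : (i < k)%N -> 0 < r1 i by move=> ik; rewrite r10// ltnS ltnW.
have r1k : 0 < r1 k by exact: r10.
have [u uM uE] := an_inv r10 v1M.
have uQ x : box k.+1 r1 x -> (u x / q0) * Q x = 1 /\ 0 < u x.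
  move=> /uE[E u0]; split=> //; rewrite -[RHS]E; ring.
have p1M j : an k r1 (M / r k ^+ j) (p j).
  by apply: an_shrink (pM j) => i ik; rewrite r11// ltnS ltnW.
pose C := \sum_(j < D) (M / r k ^+ j * r1 k ^+ j).
have M0 := an_ge0 fM.
have C0 : 0 <= C * (`|q0^-1| * (4 / 3)).
  by rewrite !mulr_ge0 ?sumr_ge0// => i _; rewrite !mulr_ge0 ?invr_ge0 ?exprn_ge0 ?(ltW rk) ?(ltW r1k).
(* Shrinks all radii but the last: the coefficients of index below [D] vanish at the origin, so the
   low-degree part divided by [Q] becomes small while [r1 k ^+ D] is unchanged. *)
have [mu /andP[mu0 mu1] muC] := scale_exists C0 (mulr_gt0 q4 (exprn_gt0 D r1k)).
pose r2 i := if i == k then r1 k else mu * r1 i.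
have r2k : r2 k = r1 k by rewrite /r2 eqxx.
have r2i i : (i < k)%N -> r2 i = mu * r1 i by move=> ik; rewrite /r2 ltn_eqF.
have r21 i : (i < k.+1)%N -> 0 < r2 i <= r1 i.
  rewrite ltnS leq_eqVlt => /orP[/eqP->|ik]; first by rewrite r2k r1k lexx.
  by rewrite r2i// mulr_gt0 ?r10'//= ler_piMl// ltW// r10'.
have r20 i : (i < k.+1)%N -> 0 < r2 i by move=> /r21/andP[].
have r20' i : (i < k)%N -> 0 < r2 i by move=> ik; rewrite r20// ltnS ltnW.
have p2M j : (j < D)%N -> an k r2 (mu * (M / r k ^+ j)) (p j).
  move=> jD; have := an_small r10' (p1M j) (p0 j jD) (introT andP (conj mu0 mu1)).
  by apply: an_shrink => i ik; rewrite r2i// mulr_gt0 ?lexx ?r10'.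
have PM n : (n <= D)%N -> an k.+1 r2 (mu * \sum_(j < n) (M / r k ^+ j * r1 k ^+ j))
    (fun x => \sum_(j < n) p j x * x k ^+ j).
  elim: n => [|n IHn] nD.
    by apply: an_ext (an_weak _ (an0 _ _)) => [x _|]; rewrite ?big_ord0 ?mulr0.
  apply: an_ext (an_weak _ (an_add (IHn (ltnW nD))
    (an_mulXn n (an_lift (p2M n nD)) (r20 _ (ltnSn k))))) => [x _|].
    by rewrite big_ord_recr.
  by rewrite r2k big_ord_recr/= mulrDr !mulrA.
have uM2 : an k.+1 r2 (`|q0^-1| * (4 / 3)) (fun x => q0^-1 * u x).
  by apply: an_scale => //; exact: an_shrink uM.
have hM : an k.+1 r2 (4^-1 * r2 k ^+ D)
    (fun x => (\sum_(j < D) p j x * x k ^+ j) * (q0^-1 * u x)).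
  apply: an_weak (an_mul r20 (PM D (leqnn D)) uM2).
  by rewrite r2k -mulrA.
have [w [P [PA wP]]] := weierstrass_division r20 hM.
have [rho rho0 rho2] := min_radius r20.
exists rho, D, P, (Num.sg q0); split=> //.
  move=> j; have [N PN] := PA j; exists N; apply: an_shrink PN => i ik.
  by rewrite rho0 rho2// ltnS ltnW.
move=> x bx.
have bx2 : box k.+1 r2 x by move=> i ik; rewrite (le_trans (bx i ik))// rho2.
have bx1 : box k.+1 r1 x.
  by move=> i ik; rewrite (le_trans (bx2 i ik))//; have /andP[] := r21 i ik.
have bxr : box k.+1 r x.
  by move=> i ik; rewrite (le_trans (bx1 i ik))//; have /andP[] := r11 i ik.
have [w0 wE] := wP x bx2.
have [uQx u0] := uQ x bx1.
have -> : x k ^+ D + \sum_(j < D) P j x * x k ^+ j = w x * (u x / q0) * f x.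
  rewrite -wE fQ// mulrDr; congr (_ + _); first by ring.
  by rewrite -[in LHS](mul1r (w x)) -uQx; ring.
rewrite !sgrM (gtr0_sg w0) (gtr0_sg u0) !mul1r mulrA -sgrM.
by rewrite mulfV// sgr1 mul1r.
Qed.

End Weierstrass.

(** * Counting distinct roots *)

Section PowerSums.
Variable F : numFieldType.
Implicit Types (rs : seq F) (z w : F).

Definition powersum rs m := \sum_(z <- rs) z ^+ m.

Lemma deriv_prod_XsubC rs (Q : F -> {poly F}) :
  (forall z, z \in rs -> ('X - z%:P) * Q z = \prod_(w <- rs) ('X - w%:P)) ->
  (\prod_(w <- rs) ('X - w%:P))^`() = \sum_(z <- rs) Q z.
Proof.
elim: rs Q => [|w rs IH] Q HQ; first by rewrite !big_nil -[1]/(1%:P) derivC.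
rewrite !big_cons derivM derivXsubC mul1r; congr (_ + _).
  have := HQ w (mem_head _ _); rewrite big_cons => /mulfI -> //.
  by rewrite polyXsubC_eq0.
have dv z : z \in rs -> ('X - z%:P) %| \prod_(w <- rs) ('X - w%:P).
  by move=> zrs; rewrite dvdp_XsubCl root_prod_XsubC.
rewrite (IH (fun z => (\prod_(w <- rs) ('X - w%:P)) %/ ('X - z%:P))); last first.
  by move=> z /dv h; rewrite mulrC divpK.
rewrite mulr_sumr; apply: eq_big_seq => z zrs.
apply: (mulfI (x := 'X - z%:P)); first by rewrite polyXsubC_eq0.
rewrite HQ ?in_cons ?zrs ?orbT// big_cons mulrCA; congr (_ * _).
by rewrite mulrC divpK// dv.
Qed.

(** Newton's identities, read off as the coefficient of ['X^m] in the derivative, each cofactor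
    being expanded as the quotient of p(X) - p(z) by X - z. *)
Lemma powersum_deriv rs (p := \prod_(w <- rs) ('X - w%:P)) m :
  p`_m.+1 *+ m.+1 = \sum_(l < (size rs).+1 | (m < l)%N) p`_l * powersum rs (l - m.+1).
Proof.
have sp : size p = (size rs).+1 by rewrite size_prod_XsubC.
pose Q z : {poly F} := \sum_(l < size p) p`_l *: \sum_(i < l) 'X^(l.-1 - i) * (z ^+ i)%:P.
have HQ z : z \in rs -> ('X - z%:P) * Q z = p.
  move=> zrs; have pz : p.[z] = 0 by apply/eqP; rewrite -[_ == 0]/(root p z) root_prod_XsubC.
  have pE : p = \sum_(l < size p) p`_l *: 'X^l by rewrite -poly_def coefK.
  transitivity (p - (p.[z])%:P); last by rewrite pz subr0.
  rewrite [X in _ = X - _]pE horner_coef rmorph_sum -sumrB mulr_sumr.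
  apply: eq_bigr => l _.
  rewrite -scalerAr rmorphM /= mul_polyC -scalerBr; congr (_ *: _).
  rewrite rmorphXn subrXX; congr (_ * _); apply: eq_bigr => i _.
  by rewrite rmorphXn.
rewrite -coef_deriv (deriv_prod_XsubC HQ) coef_sum.
transitivity (\sum_(z <- rs) \sum_(l < size p | (m < l)%N) p`_l * z ^+ (l - m.+1)).
  apply: eq_bigr => z _; rewrite coef_sum [RHS]big_mkcond/=; apply: eq_bigr => l _.
  rewrite coefZ coef_sum; under eq_bigr => i _ do rewrite coefMC coefXn.
  case: ifP => ml; last first.
    rewrite big1 ?mulr0// => i _; rewrite (_ : m == _ = false) ?mul0r//.
    by apply/eqP => mE; have := ltn_ord i; move: ml mE; lia.
  congr (_ * _).
  have h : (l - m.+1 < l)%N by move: ml; lia.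
  rewrite (bigD1 (Ordinal h))//= [m == _](_ : _ = true) ?mul1r; last by apply/eqP; move: ml; lia.
  rewrite big1 ?addr0// => i /eqP ni; rewrite (_ : m == _ = false) ?mul0r//.
  apply/eqP => mi; apply: ni; apply: val_inj => /=.
  by have := ltn_ord i; move: mi ml; lia.
rewrite exchange_big/= sp; apply: eq_bigr => l _.
by rewrite -mulr_sumr.
Qed.

(** Newton's identities solved for the power sum of highest order, whose coefficient is the leading
    coefficient 1; hence a recursion without division. *)
Lemma powersum_lt rs (p := \prod_(w <- rs) ('X - w%:P)) k : (k < size rs)%N ->
  powersum rs k = p`_(size rs - k) *+ (size rs - k) -
    \sum_(l < size rs | (size rs - k <= l)%N) p`_l * powersum rs (l - (size rs - k)).
Proof.
move=> kD; have := powersum_deriv rs (size rs - k.+1).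
rewrite -/p -subSn// subSS => ->.
rewrite big_mkcond big_ord_recr/= -big_mkcond/= leq_subr.
have -> : p`_(size rs) = 1.
  have /monicP := monic_prod_XsubC rs xpredT id.
  by rewrite lead_coefE size_prod_XsubC.
rewrite mul1r (_ : (size rs - (size rs - k) = k)%N); last by lia.
by rewrite addrAC subrr add0r.
Qed.

Lemma powersum_ge rs (p := \prod_(w <- rs) ('X - w%:P)) k : (size rs <= k)%N ->
  powersum rs k = - \sum_(l < size rs) p`_l * powersum rs (l + (k - size rs)).
Proof.
move=> Dk; apply/eqP; rewrite -subr_eq0 opprK; apply/eqP.
have -> : powersum rs k = p`_(size rs) * powersum rs (size rs + (k - size rs)).
  rewrite subnKC//; have /monicP := monic_prod_XsubC rs xpredT id.
  by rewrite lead_coefE size_prod_XsubC => ->; rewrite mul1r.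
transitivity (\sum_(l < (size rs).+1) p`_l * powersum rs (l + (k - size rs))).
  by rewrite big_ord_recr/= addrC.
under eq_bigr do rewrite mulr_sumr.
rewrite exchange_big big_seq big1//= => z zrs.
have pz : p.[z] = 0 by apply/eqP; rewrite -[_ == 0]/(root p z) root_prod_XsubC.
under eq_bigr do rewrite exprD mulrA.
have sp : (size p <= (size rs).+1)%N by rewrite size_prod_XsubC.
by rewrite -mulr_suml -(horner_coef_wide _ sp) pz mul0r.
Qed.

(** A right inverse of this Vandermonde matrix has as columns the coefficients of the Lagrange
    interpolation polynomials. *)
Lemma row_free_powers D (t : seq F) : uniq t -> (size t <= D)%N ->
  row_free (\matrix_(i < size t, b < D) t`_i ^+ b).
Proof.
move=> ut tD; apply/row_freeP.
pose N (j : 'I_(size t)) := \prod_(l < size t | l != j) ('X - (t`_l)%:P).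
have Nj j : (N j).[t`_j] != 0.
  rewrite horner_prod; apply/prodf_neq0 => l lj.
  by rewrite hornerXsubC subr_eq0 nth_uniq// eq_sym.
have Ni i j : i != j -> (N j).[t`_i] = 0.
  move=> ij; rewrite horner_prod (bigD1 i)//= hornerXsubC subrr mul0r//.
exists (\matrix_(b < D, j < size t) ((N j).[t`_j]^-1 * (N j)`_b)).
apply/matrixP => i j; rewrite !mxE.
transitivity ((N j).[t`_j]^-1 * (N j).[t`_i]).
  have sN : (size (N j) <= D)%N.
    have E : \prod_(l < size t) ('X - (t`_l)%:P) = N j * ('X - (t`_j)%:P).
      by rewrite (bigD1 j)//= mulrC.
    have := size_prod_XsubC (enum 'I_(size t)) (fun l : 'I__ => t`_l).
    rewrite big_enum /= E size_Mmonic ?monicXsubC//; last first.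
      by apply: contraNneq (Nj j) => ->; rewrite horner0.
    rewrite size_XsubC addn2 /= => -[->].
    by rewrite size_enum_ord.
  rewrite [in RHS](horner_coef_wide t`_i sN) mulr_sumr; apply: eq_bigr => b _.
  by rewrite !mxE; ring.
have [->|ij] := eqVneq i j; first by rewrite mulVf.
by rewrite (Ni _ _ ij) mulr0.
Qed.

(** The Hankel matrix factors as V^T diag(mu) V, with V the Vandermonde matrix of the distinct roots
    and mu their multiplicities, which are nonzero in characteristic 0. *)
Lemma rank_hankel rs : \rank (\matrix_(a < size rs, b < size rs) powersum rs (a + b)) =
  size (undup rs).
Proof.
set t := undup rs; set D := size rs.
have tD : (size t <= D)%N by exact: size_undup.
set V := \matrix_(i < size t, b < D) t`_i ^+ b.
have Vf : row_free V by apply: row_free_powers => //; exact: undup_uniq.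
pose mu : 'rV[F]_(size t) := \row_i (count_mem t`_i rs)%:R.
have muU : diag_mx mu \in unitmx.
  rewrite unitmxE det_diag unitfE; apply/prodf_neq0 => i _.
  rewrite mxE pnatr_eq0 -lt0n -has_count has_pred1 -mem_undup.
  by rewrite mem_nth.
have -> : (\matrix_(a < D, b < D) powersum rs (a + b)) = V^T *m diag_mx mu *m V.
  apply/matrixP => a b; rewrite mul_mx_diag !mxE /powersum.
  rewrite -(big_undup_iterop_count _ rs) /= -/t (big_nth 0) big_mkord.
  apply: eq_bigr => i _; rewrite !mxE exprD.
  by rewrite -[iterop _ _ _ _]/(_ *+ _) -mulr_natr; ring.
rewrite mxrankMfree// -mxrank_tr trmx_mul trmxK tr_diag_mx mxrankMfree//.
exact: mxrank_unit.
Qed.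

End PowerSums.

(** Selections of rows and columns may repeat indices: repetitions only produce zero minors, and
    plain finite functions form a [finType]. *)
Lemma rank_minors (F : fieldType) m n (A : 'M[F]_(m, n)) d :
  reflect (exists (f : {ffun 'I_d -> 'I_m}) (g : {ffun 'I_d -> 'I_n}),
     \det (mxsub f g A) != 0) (d <= \rank A)%N.
Proof.
apply: (iffP idP) => [dA|[f [g fg]]].
  have h m' n' (B : 'M[F]_(m', n')) : (d <= \rank B)%N ->
      exists f : {ffun 'I_d -> 'I_m'}, row_free (rowsub f B).
    move=> dB; exists [ffun i => maxrankfun B (widen_ord dB i)].
    have := @maxrowsub_free _ _ _ B; set C := rowsub _ _ => /row_freeP[E CE].
    apply/row_freeP; exists (colsub (widen_ord dB) E).
    rewrite -[RHS](_ : mxsub (widen_ord dB) (widen_ord dB) 1%:M = _); last first.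
      by apply/matrixP => i j; rewrite !mxE.
    rewrite -CE; apply/matrixP => i j; rewrite !mxE; apply: eq_bigr => l _.
    by rewrite !mxE !ffunE.
  have [f ff] := h _ _ A dA.
  have [|g gg] := h _ _ (rowsub f A)^T.
    by rewrite mxrank_tr (eqP ff).
  exists f, g; rewrite -unitfE -unitmxE -unitmx_tr -row_free_unit.
  move: gg; congr (row_free _); apply/matrixP => i j; rewrite !mxE//.
have : \rank (mxsub f g A) = d.
  by rewrite mxrank_unit// unitmxE unitfE.
move=> <-.
have -> : mxsub f g A = (rowsub g (rowsub f A)^T)^T.
  by apply/matrixP => i j; rewrite !mxE.
rewrite mxrank_tr (leq_trans (mxrankS (rowsub_sub _ _)))// mxrank_tr.
exact: mxrankS (rowsub_sub _ _).
Qed.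

(** * Roots in small discs *)

Section Clusters.
Variable C : numClosedFieldType.
Implicit Types (rs : seq C).

Lemma near_root rs (x e : C) : 0 <= e ->
  `|(\prod_(z <- rs) ('X - z%:P)).[x]| < e ^+ size rs ->
  exists2 z, z \in rs & `|x - z| < e.
Proof.
move=> e0; elim: rs => [|z rs IH]; first by rewrite big_nil hornerC normr1 ltxx.
rewrite big_cons hornerM hornerXsubC normrM /= exprS.
have [xz _|ex] := real_ltP (normr_real (x - z)) (ger0_real e0).
  by exists z => //; rewrite mem_head.
move=> H; have [|w wrs xw] := IH; last by exists w => //; rewrite in_cons wrs orbT.
have [//|le] := real_ltP (normr_real (\prod_(z <- rs) ('X - z%:P)).[x]) (ger0_real (exprn_ge0 (size rs) e0)).
have := le_lt_trans (ler_pM e0 (exprn_ge0 _ e0) ex le) H.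
by rewrite ltxx.
Qed.

(** Pigeonhole: the discs of radius [d] about the distinct points of [rs0] are disjoint and each
    meets [rs]; with equally many distinct points on both sides, each contains exactly one. *)
Lemma cluster rs0 rs (d : C) : 0 < d ->
  (forall a b, a \in rs0 -> b \in rs0 -> a != b -> 2 * d <= `|a - b|) ->
  size (undup rs) = size (undup rs0) ->
  (forall a, a \in rs0 -> exists2 z, z \in rs & `|a - z| < d) ->
  (forall z, z \in rs -> exists2 a, a \in rs0 & `|a - z| < d) /\
  (forall a z z', a \in rs0 -> z \in rs -> z' \in rs ->
     `|a - z| < d -> `|a - z'| < d -> z = z').
Proof.
move=> d0 sep sz near.
have near' a : exists z, a \in rs0 -> z \in rs /\ `|a - z| < d.
  by case: (boolP (a \in rs0)) => [/near[z]|_]; [exists z|exists 0].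
have [phi phiE] := choice near'.
have same a b z : a \in rs0 -> b \in rs0 -> `|a - z| < d -> `|b - z| < d -> a = b.
  move=> a0 b0 az bz; apply/eqP/negPn/negP => ab.
  have /le_lt_trans := sep _ _ a0 b0 ab; move/(_ (2 * d)) => h; suff /h : `|a - b| < 2 * d by rewrite ltxx.
  have -> : a - b = (a - z) - (b - z) by ring.
  by rewrite (le_lt_trans (ler_normB _ _))// mulr_natl mulr2n ltrD.
have inj : {in undup rs0 &, injective phi}.
  move=> a b; rewrite !mem_undup => a0 b0 ab.
  have [_ az] := phiE a a0; have [_ bz] := phiE b b0.
  by apply: same az _ => //; rewrite ab.
have um : uniq (map phi (undup rs0)) by rewrite map_inj_in_uniq// undup_uniq.
have sub : {subset map phi (undup rs0) <= undup rs}.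
  move=> z /mapP[a]; rewrite !mem_undup => a0 ->.
  by have [] := phiE a a0.
have [_ E] := uniq_min_size um sub ltac:(by rewrite size_map sz).
have img z : z \in rs -> exists2 a, a \in rs0 & z = phi a.
  rewrite -mem_undup -E => /mapP[a]; rewrite mem_undup => ? ->.
  by exists a.
split=> [z /img[a a0 ->]|a z z' a0 /img[b b0 ->] /img[b' b0' ->] h h'].
  by exists a => //; have [] := phiE a a0.
have [_ hb] := phiE b b0; have [_ hb'] := phiE b' b0'.
by rewrite -(same _ _ _ a0 b0 h hb) -(same _ _ _ a0 b0' h' hb').
Qed.

End Clusters.

(** * Real roots of nearby monic polynomials *)

Section RealRoots.
Variable R : realType.
Implicit Types (p q : {poly R}) (x y : R).
Local Notation C := R[i].
Local Notation toC := (map_poly (real_complex R)).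

Definition croots p : seq C := sval (closed_field_poly_normal (toC p)).
Definition ncroots p := size (undup (croots p)).

Lemma crootsE p : p \is monic -> toC p = \prod_(z <- croots p) ('X - z%:P).
Proof.
move=> pm; rewrite /croots; case: closed_field_poly_normal => /= r {1}->.
by rewrite lead_coef_map (monicP pm) scale1r.
Qed.

Lemma size_croots p : p \is monic -> size (croots p) = (size p).-1.
Proof.
by move=> pm; have := size_map_poly (real_complex R) p; rewrite crootsE// size_prod_XsubC => <-.
Qed.

Lemma mem_croots p z : p \is monic -> (z \in croots p) = root (toC p) z.
Proof. by move=> pm; rewrite crootsE// root_prod_XsubC. Qed.

Lemma mem_rootsR p x : p \is monic -> (x \in rootsR p) = root p x.
Proof.
move=> pm; have := roots_on_rootsR (monic_neq0 pm) => /(_ x).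
by rewrite inE /= => <-.
Qed.

Lemma real_croots p x : p \is monic -> (x%:C%C \in croots p) = root p x.
Proof. by move=> pm; rewrite mem_croots// fmorph_root. Qed.

Lemma conj_croots p z : p \is monic -> (z^*%C \in croots p) = (z \in croots p).
Proof.
move=> pm; rewrite !mem_croots// -complex_root_conj.
rewrite -map_poly_comp (eq_map_poly (g := real_complex R))// => x /=.
exact: conjc_real.
Qed.

Lemma dist_real_complex x y : `|x%:C%C - y%:C%C| = `|x - y|%:C%C :> C.
Proof.
rewrite -rmorphB normc_def /= expr0n addr0 sqrtr_sqr.
by [].
Qed.

Lemma conj_real_sub x (z : C) : (x%:C%C - z)^*%C = x%:C%C - z^*%C.
Proof. by rewrite rmorphB; congr (_ - _); exact: conjc_real. Qed.

Lemma conj_fixed_real (z : C) : z = z^*%C -> exists x, z = x%:C%C.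
Proof.
case: z => a b []/eqP; rewrite -subr_eq0 opprK -mulr2n mulrn_eq0/= => /eqP ->.
by exists a.
Qed.

(** A disc about a real root is stable under conjugation and contains a single root of [p], which is
    therefore real. A disc about a non-real root contains no real number, as its centre is [2 * d]
    away from its conjugate. Displacements below [d] keep the order of roots that are [2 * d]
    apart. *)
Lemma rootsR_close p0 p (d : R) : 0 < d -> p0 \is monic -> p \is monic ->
  size p = size p0 ->
  (forall a b, a \in croots p0 -> b \in croots p0 -> a != b -> (2 * d)%:C%C <= `|a - b|) ->
  ncroots p = ncroots p0 ->
  (forall a, a \in croots p0 -> `|(toC p).[a]| < (d ^+ (size p).-1)%:C%C) ->
  [/\ size (rootsR p) = size (rootsR p0),
      forall j, (j < size (rootsR p0))%N -> `|(rootsR p)`_j - (rootsR p0)`_j| < d &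
      forall x y z, root p0 x -> root p y -> z \in croots p ->
        `|x - y| < d -> `|x%:C%C - z| < d%:C%C -> z = y%:C%C].
Proof.
move=> d0 p0m pm szp sep nc small.
have dC : 0 < d%:C%C :> C by rewrite ltcR.
have [|||H1 H2] := @cluster _ (croots p0) (croots p) d%:C%C dC.
- by move=> a b a0 b0 /(sep _ _ a0 b0); rewrite rmorphM /= rmorph_nat.
- exact: nc.
- move=> a a0; apply: near_root; first exact: ltW.
  by rewrite -crootsE// size_croots// -rmorphXn; exact: small.
have uniqR x y z : root p0 x -> root p y -> z \in croots p ->
    `|x - y| < d -> `|x%:C%C - z| < d%:C%C -> z = y%:C%C.
  move=> rx ry zr xy xz; apply: (H2 x%:C%C) => //.
  - by rewrite real_croots.
  - by rewrite real_croots.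
  - by rewrite dist_real_complex ltcR.
have real_near x : root p0 x -> exists2 y, root p y & `|x - y| < d.
  move=> rx.
  have x0 : x%:C%C \in croots p0 by rewrite real_croots.
  have [|z zr xz] := @near_root _ (croots p) x%:C%C d%:C%C (ltW dC).
    by rewrite -crootsE// size_croots// -rmorphXn; exact: small.
  have zc : z = z^*%C.
    apply: (H2 x%:C%C) => //; first by rewrite conj_croots.
    by rewrite -conj_real_sub normcJ.
  have [y yE] := conj_fixed_real zc.
  exists y; first by rewrite -real_croots// -yE.
  by move: xz; rewrite yE dist_real_complex ltcR.
have near' x : exists y, root p0 x -> root p y /\ `|x - y| < d.
  by case: (boolP (root p0 x)) => [/real_near[y]|_]; [exists y|exists 0].
have [phi phiE] := choice near'.
have sepR x y : root p0 x -> root p0 y -> x < y -> 2 * d <= y - x.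
  move=> rx ry xy.
  have := sep x%:C%C y%:C%C; rewrite !real_croots// => /(_ rx ry).
  rewrite (inj_eq (@complexI _)) (lt_eqF xy) => /(_ erefl).
  by rewrite dist_real_complex lecR distrC gtr0_norm// subr_gt0.
have mapE : map phi (rootsR p0) = rootsR p.
  apply: lt_sorted_eq.
  - apply: (@homo_sorted_in _ _ (fun x => root p0 x) phi <%R <%R).
    + move=> x y rx ry xy.
      have [_ hx] := phiE x rx; have [_ hy] := phiE y ry.
      have := sepR x y rx ry xy.
      by move: hx hy; rewrite !ltr_norml; lra.
    + by apply/allP => x; rewrite mem_rootsR.
    + exact: sorted_roots.
  - exact: sorted_roots.
  - move=> y; apply/mapP/idP => [[x xr ->]|].
      by rewrite mem_rootsR//; have [] := phiE x; rewrite -?mem_rootsR.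
    rewrite mem_rootsR// => ry.
    have [|a a0 ay] := H1 y%:C%C; first by rewrite real_croots.
    have ac : a = a^*%C.
      apply/eqP/negPn/negP => /(sep _ _ a0); rewrite conj_croots// => /(_ a0).
      move=> /le_lt_trans; move/(_ (2 * d)%:C%C) => h.
      suff /h : `|a - a^*%C| < (2 * d)%:C%C by rewrite ltxx.
      have -> : a - a^*%C = (y%:C%C - a)^*%C - (y%:C%C - a).
        by rewrite conj_real_sub; ring.
      rewrite (le_lt_trans (ler_normB _ _))// normcJ rmorphM rmorph_nat /= distrC.
      by rewrite mulr_natl mulr2n ltrD.
    have [x xE] := conj_fixed_real ac.
    have rx : root p0 x by rewrite -real_croots// -xE.
    exists x; first by rewrite mem_rootsR.
    have [rp hp] := phiE x rx.
    apply: (@complexI R); apply: uniqR hp _ => //; first by rewrite real_croots.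
    by rewrite -xE.
split=> //; first by rewrite -mapE size_map.
move=> j js; rewrite -mapE (nth_map 0)// distrC.
have rx : root p0 (rootsR p0)`_j by rewrite -mem_rootsR// mem_nth.
by have [] := phiE _ rx.
Qed.

End RealRoots.

(** * Real roots along a path *)

Section RootPaths.
Variable R : realType.
Implicit Types (p q : {poly R}) (eta s : R) (f g : R -> R).
Local Notation C := R[i].
Local Notation toC := (map_poly (real_complex R)).

Definition halfitv eta : set R := [set s | 0 < s <= eta].

Definition cont_on eta f := forall s0, halfitv eta s0 ->
  f s @[s --> within (halfitv eta) (nbhs s0)] --> f s0.

Lemma cont_onP eta f : cont_on eta f <-> forall s0, 0 < s0 <= eta -> forall e, 0 < e ->
  exists2 d, 0 < d & forall s, 0 < s <= eta -> `|s - s0| < d -> `|f s - f s0| < e.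
Proof.
split=> [H s0 J0 e e0|H s0 J0].
  have /cvgrPdist_lt/(_ e e0) := H s0 J0.
  rewrite near_withinE => -[d /= d0 Hd]; exists d => // s Js sd.
  by rewrite distrC; apply: Hd => //=; rewrite distrC.
apply/cvgrPdist_lt => e e0; rewrite near_withinE.
have [d d0 Hd] := H s0 J0 e e0; exists d => //= s sd Js.
by rewrite distrC; apply: Hd => //; rewrite distrC.
Qed.

Lemma cont_cst eta (c : R) : cont_on eta (fun=> c).
Proof. by move=> s0 _; exact: cvg_cst. Qed.

Lemma contD eta f g : cont_on eta f -> cont_on eta g -> cont_on eta (fun s => f s + g s).
Proof. by move=> cf cg s0 J0; apply: cvgD; [exact: cf|exact: cg]. Qed.

Lemma contM eta f g : cont_on eta f -> cont_on eta g -> cont_on eta (fun s => f s * g s).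
Proof. by move=> cf cg s0 J0; apply: cvgM; [exact: cf|exact: cg]. Qed.

Lemma cont_exp eta f n : cont_on eta f -> cont_on eta (fun s => f s ^+ n).
Proof.
move=> cf; elim: n => [|n IH]; first exact: cont_cst.
by rewrite (_ : (fun s => _) = (fun s => f s * f s ^+ n)); [exact: contM|apply/funext => s; rewrite exprS].
Qed.

Lemma cont_sum eta n (F : nat -> R -> R) : (forall i, cont_on eta (F i)) ->
  cont_on eta (fun s => \sum_(i < n) F i s).
Proof.
move=> cF; elim: n => [|n IH].
  by rewrite (_ : (fun s => _) = fun=> 0); [exact: cont_cst|apply/funext => s; rewrite big_ord0].
rewrite (_ : (fun s => _) = (fun s => \sum_(i < n) F i s + F n s)); first exact: contD.
by apply/funext => s; rewrite big_ord_recr.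
Qed.

Lemma cont_ext eta f g : (forall s, 0 < s <= eta -> f s = g s) ->
  cont_on eta f -> cont_on eta g.
Proof.
move=> fg /cont_onP cf; apply/cont_onP => s0 J0 e /(cf s0 J0)[d d0 H].
by exists d => // s Js; rewrite -!fg//; exact: H.
Qed.

Lemma cont_horner eta (P : R -> {poly R}) (xi : R -> R) n :
  (forall s, 0 < s <= eta -> (size (P s) <= n)%N) ->
  (forall j, cont_on eta (fun s => (P s)`_j)) -> cont_on eta xi ->
  cont_on eta (fun s => (P s).[xi s]).
Proof.
move=> sP cP cxi.
apply: (@cont_ext _ (fun s => \sum_(j < n) (P s)`_j * xi s ^+ j)).
  by move=> s Js; rewrite (horner_coef_wide _ (sP s Js)).
apply: (@cont_sum _ _ (fun j s => (P s)`_j * xi s ^+ j)) => j.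
exact: (contM (cP j) (@cont_exp _ _ j cxi)).
Qed.

(** Connectedness of the interval, through the supremum of the points up to which the property
    persists; leftward propagation is rightward propagation of the negation. *)
Lemma loc_const eta (Q : R -> Prop) :
  (forall s0, 0 < s0 <= eta -> exists2 d, 0 < d &
     forall s, 0 < s <= eta -> `|s - s0| < d -> (Q s <-> Q s0)) ->
  forall a b, 0 < a <= eta -> 0 < b <= eta -> Q a -> Q b.
Proof.
move=> HQ.
suff up P : (forall s0, 0 < s0 <= eta -> exists2 d, 0 < d &
     forall s, 0 < s <= eta -> `|s - s0| < d -> (P s <-> P s0)) ->
     forall a b, 0 < a <= eta -> 0 < b <= eta -> a <= b -> P a -> P b.
  move=> a b Ja Jb Qa; have [ab|/ltW ba] := leP a b; first exact: up HQ _ _ Ja Jb ab Qa.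
  apply: contrapT => nQb.
  have /up : forall s0, 0 < s0 <= eta -> exists2 d, 0 < d &
     forall s, 0 < s <= eta -> `|s - s0| < d -> (~ Q s <-> ~ Q s0).
    move=> s0 /HQ[d d0 H]; exists d => // s Js /(H s Js)[h1 h2].
    by split=> h h'; apply: h; [exact: h2|exact: h1].
  by move=> /(_ b a Jb Ja ba nQb).
move=> HP a b Ja Jb ab Pa.
pose S := [set s | a <= s <= b /\ forall u, a <= u <= s -> P u].
have aS : S a by split; rewrite ?lexx// => u ua; rewrite -(le_anti ua).
have supS : has_sup S by split; [exists a|exists b => s [/andP[]]].
set c := sup S.
have ac : a <= c by apply: ub_le_sup => //; case: supS.
have cb : c <= b by apply: ge_sup => [|s [/andP[]]]//; exists a.
have Jc : 0 < c <= eta.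
  case/andP: Ja => a0 _; case/andP: Jb => _ bb.
  by rewrite (lt_le_trans a0 ac) (le_trans cb bb).
have [d d0 Hd] := HP c Jc.
have [s [/andP[as_ sb] sP] cs] : exists2 s, S s & c - d < s.
  by apply: sup_adherent.
have sc : s <= c by apply: ub_le_sup => //; [case: supS|split; rewrite ?as_].
have Pc : P c.
  apply: (Hd s _ _).1; last by apply: sP; rewrite as_ lexx.
    case/andP: Ja => a0 _; case/andP: Jb => _ bb.
    by rewrite (lt_le_trans a0 as_) (le_trans sb bb).
  by rewrite distrC ger0_norm ?subr_ge0//; lra.
have Pac u : a <= u <= c -> P u.
  move=> /andP[au uc]; have [us|su] := leP u s; first by apply: sP; rewrite au.
  apply: (Hd u _ _).2 => //.
    case/andP: Ja => a0 _; case/andP: Jb => _ bb.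
    by rewrite (lt_le_trans a0 au) (le_trans uc)// (le_trans cb).
  by rewrite distrC ger0_norm ?subr_ge0//; lra.
have [bc|cb'] := leP b c; first by apply: Pac; rewrite ab.
pose w := Num.min b (c + d / 2).
have wb : w <= b by rewrite ge_min lexx.
have wd : w <= c + d / 2 by rewrite ge_min lexx orbT.
have cw : c < w by rewrite lt_min cb' ltrDl divr_gt0.
have : w <= c.
  apply: ub_le_sup; first by case: supS.
  split; first by rewrite wb andbT (le_trans ac)// ltW.
  move=> u /andP[au uw]; have [uc|cu] := leP u c; first by apply: Pac; rewrite au.
  apply: (Hd u _ _).2 => //.
    case/andP: Ja => a0 _; case/andP: Jb => _ bb.
    by rewrite (lt_le_trans a0 au) (le_trans uw)// (le_trans wb).
  by rewrite ger0_norm ?subr_ge0 ?ltW//; lra.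
by rewrite leNgt cw.
Qed.

Lemma sg_near (a b : R) : `|a - b| < `|b| -> Num.sg a = Num.sg b.
Proof.
have [b0|b0|->] := ltgtP b 0; last by rewrite normr0 ltNge normr_ge0.
  by rewrite (ltr0_norm b0) ltr_norml => h; rewrite !ltr0_sg//; lra.
by rewrite (gtr0_norm b0) ltr_norml => h; rewrite !gtr0_sg//; lra.
Qed.

Lemma sg_const eta f : cont_on eta f ->
  (forall s0, 0 < s0 <= eta -> f s0 = 0 -> exists2 d, 0 < d &
     forall s, 0 < s <= eta -> `|s - s0| < d -> f s = 0) ->
  forall a b, 0 < a <= eta -> 0 < b <= eta -> Num.sg (f b) = Num.sg (f a).
Proof.
move=> /cont_onP cf f0 a b Ja Jb.
apply: (@loc_const eta (fun s => Num.sg (f s) = Num.sg (f a))) Ja Jb _ => // s0 J0.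
have [fs|fs] := eqVneq (f s0) 0.
  have [d d0 H] := f0 s0 J0 fs; exists d => // s Js sd.
  by rewrite H// fs.
have [|d d0 H] := cf s0 J0 `|f s0|; first by rewrite normr_gt0.
by exists d => // s Js sd; rewrite (sg_near (H s Js sd)).
Qed.

Lemma cont_ivt eta f a b y : cont_on eta f -> 0 < a <= eta -> 0 < b <= eta ->
  f a <= y <= f b -> exists2 s, Num.min a b <= s <= Num.max a b & f s = y.
Proof.
move=> cf Ja Jb /andP[ay yb].
pose m := Num.min a b; pose M := Num.max a b.
pose clip s := Num.max m (Num.min s M).
have mM : m <= M by rewrite le_max ge_min lexx.
have Jm : 0 < m by rewrite lt_min; case/andP: Ja => ->; case/andP: Jb => ->.
have JM : M <= eta by rewrite ge_max; case/andP: Ja => _ ->; case/andP: Jb => _ ->.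
have clipJ s : m <= clip s <= M.
  move: mM; rewrite /clip; move: (m) (M) => u v uv.
  by rewrite le_max lexx ge_max uv ge_min lexx orbT.
have clipE s : m <= s <= M -> clip s = s.
  by move=> /andP[h1 h2]; rewrite /clip (min_idPl h2); apply/max_idPr.
have clip_lip s s' : `|clip s - clip s'| <= `|s - s'|.
  rewrite /clip; move: mM; move: (m) (M) => u v uv.
  have h1 := ler_norm (s - s'); have h2 := ler_norm (- (s - s')).
  rewrite normrN in h2; rewrite ler_norml.
  by case: (leP s v) => h3; case: (leP s' v) => h4; case: (leP u s) => h5;
    case: (leP u s') => h6; rewrite ?(max_idPr uv); apply/andP; split; lra.
apply: contrapT => H.
have ne s : f (clip s) - y != 0.
  apply/eqP => fs; apply: H; exists (clip s) => //; lra.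
have cfc : cont_on eta (fun s => f (clip s) - y).
  apply/cont_onP => s0 J0 e e0.
  have cJ s : 0 < clip s <= eta.
    by have /andP[h1 h2] := clipJ s; rewrite (lt_le_trans Jm h1) (le_trans h2).
  have [d d0 Hd] := (cont_onP eta f).1 cf (clip s0) (cJ s0) e e0.
  exists d => // s Js sd; rewrite opprB addrA subrK; apply: Hd => //.
  exact: le_lt_trans sd.
have am : clip a = a by apply: clipE; rewrite /m /M ge_min le_max lexx.
have bm : clip b = b by apply: clipE; rewrite /m /M ge_min le_max lexx !orbT.
have : Num.sg (f b - y) = Num.sg (f a - y).
  rewrite -{1}bm -{1}am; apply: (sg_const cfc) => // s0 _ /eqP.
  by rewrite (negbTE (ne s0)).
have na := ne a; have nb := ne b; rewrite am in na; rewrite bm in nb.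
rewrite (@ltr0_sg _ (f a - y)) ?gtr0_sg; first lra.
  by rewrite lt_neqAle eq_sym nb subr_ge0 yb.
by rewrite lt_neqAle na subr_le0 ay.
Qed.

(** Otherwise [(size zs).+1] points spaced by [2 * e] fit in the interval, and two of them are
    within [e] of the same element. *)
Lemma cover_itv (zs : seq R) (a b e : R) : 0 < e -> a <= b ->
  (forall y, a <= y <= b -> exists2 z, z \in zs & `|y - z| < e) ->
  b - a <= 2 * e * (size zs)%:R.
Proof.
move=> e0 ab H; rewrite leNgt; apply/negP => big.
pose y (i : 'I_(size zs).+1) := a + 2 * e * i%:R.
have yab i : a <= y i <= b.
  rewrite /y lerDl !mulr_ge0 ?(ltW e0)//= -lerBrDl (le_trans _ (ltW big))//.
  by rewrite ler_pM2l ?mulr_gt0// ler_nat -ltnS.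
have hc i : exists j : 'I_(size zs), `|y i - zs`_j| < e.
  have [z zin yz] := H _ (yab i).
  have zi : (index z zs < size zs)%N by rewrite index_mem.
  by exists (Ordinal zi) => /=; rewrite nth_index.
have [g gE] := choice hc.
have ginj : injective g.
  move=> i j gij; apply/eqP/negPn/negP => nij.
  have h1 := gE i; have h2 := gE j; rewrite gij in h1.
  have : 2 * e <= `|y i - y j|.
    have -> : y i - y j = 2 * e * (i%:R - j%:R) by rewrite /y; ring.
    rewrite normrM gtr0_norm ?mulr_gt0// ler_pMr ?mulr_gt0//.
    have [ij|ij|ij] := ltngtP i j; last by rewrite (val_inj ij) eqxx in nij.
      by rewrite distrC -natrB ?(ltnW ij)// ger0_norm// ler1n subn_gt0.
    by rewrite -natrB ?(ltnW ij)// ger0_norm// ler1n subn_gt0.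
  have -> : y i - y j = (y i - zs`_(g j)) - (y j - zs`_(g j)) by ring.
  rewrite leNgt => /negP; apply; rewrite (le_lt_trans (ler_normB _ _))//.
  by rewrite mulr_natl mulr2n ltrD.
by have := leq_card g ginj; rewrite !card_ord ltnn.
Qed.

(** Each such [y] is within [e] of a complex root, hence of its real part, and there are
    [(size p).-1] roots. *)
Lemma sublevel_itv p (a b e : R) : p \is monic -> 0 < e -> a <= b ->
  (forall y, a <= y <= b -> `|p.[y]| < e ^+ (size p).-1) ->
  b - a <= 2 * e * (size p).-1%:R.
Proof.
move=> pm e0 ab H; rewrite -(size_croots pm).
rewrite -(size_map (@complex.Re R)); apply: cover_itv => // y /H yp.
have e0C : 0 <= e%:C%C :> C by rewrite lecR ltW.
have [|z zin yz] := @near_root _ (croots p) y%:C%C e%:C%C e0C.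
  rewrite -crootsE// size_croots// horner_map -rmorphXn /=.
  by have := dist_real_complex p.[y] 0; rewrite !subr0 => ->; rewrite ltcR.
exists (complex.Re z); first exact: map_f.
rewrite -ltcR (le_lt_trans _ yz)//.
by have := normc_ge_Re (y%:C%C - z); case: z {zin yz}.
Qed.

End RootPaths.

(** * Continuity and Hoelder bounds for the ordered real roots *)

Section RootLift.
Variable R : realType.
Implicit Types (p q : {poly R}) (eta s : R) (f g : R -> R).
Local Notation C := R[i].
Local Notation toC := (map_poly (real_complex R)).

Lemma fin_min (T : eqType) (t : seq T) (f : T -> R) :
  (forall x, x \in t -> 0 < f x) -> exists2 d, 0 < d & forall x, x \in t -> d <= f x.
Proof.
elim: t => [|x t IH] H; first by exists 1.
have [|d d0 Hd] := IH; first by move=> y yt; apply: H; rewrite in_cons yt orbT.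
exists (Num.min (f x) d); first by rewrite lt_min d0 H// mem_head.
move=> y; rewrite in_cons ge_min => /orP[/eqP->|/Hd ->]; last by rewrite orbT.
by rewrite lexx.
Qed.

Lemma eval_diff p0 p (a : C) B N : (size p <= N)%N -> (size p0 <= N)%N ->
  `|a| <= B%:C%C ->
  `|(toC p).[a] - (toC p0).[a]| <= (\sum_(j < N) `|p`_j - p0`_j| * B ^+ j)%:C%C.
Proof.
move=> sp sp0 aB.
rewrite !(@horner_coef_wide _ N)//; try by rewrite size_map_poly.
rewrite -sumrB rmorph_sum (le_trans (ler_norm_sum _ _ _))// ler_sum// => j _.
rewrite !coef_map -mulrBl normrM normrX rmorphM rmorphXn.
have -> : `|real_complex R p`_j - real_complex R p0`_j| = `|p`_j - p0`_j|%:C%C.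
  exact: dist_real_complex.
have B0 : 0 <= B%:C%C :> C by exact: le_trans (normr_ge0 a) aB.
apply: ler_wpM2l; first by rewrite lecR.
by rewrite lerXn2r ?nnegrE.
Qed.

Lemma eval_diff_real p0 p (a : R) B N : (size p <= N)%N -> (size p0 <= N)%N ->
  `|a| <= B ->
  `|p.[a] - p0.[a]| <= \sum_(j < N) `|p`_j - p0`_j| * B ^+ j.
Proof.
move=> sp sp0 aB; rewrite -lecR -dist_real_complex.
have := @eval_diff p0 p a%:C%C B N sp sp0.
rewrite !horner_map; apply.
by have := dist_real_complex a 0; rewrite !subr0 => ->; rewrite lecR.
Qed.

Lemma cont_norm eta f : cont_on eta f -> cont_on eta (fun s => `|f s|).
Proof. by move=> cf s0 J0; apply: cvg_norm; exact: cf. Qed.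

Definition poly_family eta (P : R -> {poly R}) n :=
  (forall s, 0 < s <= eta -> P s \is monic /\ size (P s) = n.+1) /\
  (forall j, cont_on eta (fun s => (P s)`_j)).

Lemma croots_small eta P n s0 e (zs : seq C) : poly_family eta P n -> 0 < s0 <= eta ->
  0 < e -> (forall z, z \in zs -> root (toC (P s0)) z) ->
  exists2 d, 0 < d & forall s, 0 < s <= eta -> `|s - s0| < d ->
    forall z, z \in zs -> `|(toC (P s)).[z]| < e%:C%C.
Proof.
move=> [Pm Pc] J0 e0 zr.
(* Since [fin_min] gives lower bounds, it is applied to the inverses of 1 + |z|; the inverse of [b]
   then bounds every |z|. *)
have [b b0 Hb] := @fin_min _ zs (fun z => (1 + complex.Re `|z|)^-1)
  (fun z _ => ltac:(rewrite invr_gt0 ltr_wpDr// normc_def; exact: sqrtr_ge0)).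
have zB z : z \in zs -> `|z| <= (b^-1)%:C%C.
  move=> /Hb h.
  have z0 : 0 <= complex.Re `|z| by rewrite normc_def; exact: sqrtr_ge0.
  have -> : `|z| = (complex.Re `|z|)%:C%C by rewrite normc_def.
  rewrite lecR; apply: (@le_trans _ _ (1 + complex.Re `|z|)); first by rewrite lerDr.
  by rewrite -[leLHS]invrK lef_pV2 ?posrE ?invr_gt0 ?ltr_wpDr.
have cg : cont_on eta (fun s => \sum_(j < n.+1) `|(P s)`_j - (P s0)`_j| * b^-1 ^+ j).
  apply: (@cont_sum _ _ _ (fun j s => `|(P s)`_j - (P s0)`_j| * b^-1 ^+ j)) => j.
  apply: (contM _ (@cont_cst _ _ (b^-1 ^+ j))); apply: cont_norm.
  exact: (contD (Pc j) (@cont_cst _ _ _)).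
have [d d0 Hd] := (cont_onP _ _).1 cg s0 J0 e e0.
exists d => // s Js sd z zin; have := Hd s Js sd.
rewrite [X in _ - X]big1 ?subr0 => [|j _]; last by rewrite subrr normr0 mul0r.
rewrite ger0_norm; last first.
  by apply: sumr_ge0 => j _; rewrite mulr_ge0 ?exprn_ge0// invr_ge0 ltW.
rewrite -ltcR => h; apply: le_lt_trans h.
have -> : (toC (P s)).[z] = (toC (P s)).[z] - (toC (P s0)).[z].
  by rewrite (eqP (zr z zin)) subr0.
apply: eval_diff; last exact: (zB z zin).
  by have [_ ->] := Pm s Js.
by have [_ ->] := Pm s0 J0.
Qed.

(** The radius [d'] may have to be smaller than [e]: it must also separate the complex roots of
    [P s0], which makes the nearby root unique. *)
Lemma roots_cont eta P n : poly_family eta P n ->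
  (forall s s', 0 < s <= eta -> 0 < s' <= eta -> ncroots (P s) = ncroots (P s')) ->
  forall s0 e, 0 < s0 <= eta -> 0 < e -> exists d d', [/\ 0 < d, 0 < d' <= e &
    forall s, 0 < s <= eta -> `|s - s0| < d ->
  [/\ size (rootsR (P s)) = size (rootsR (P s0)),
      forall j, (j < size (rootsR (P s0)))%N -> `|(rootsR (P s))`_j - (rootsR (P s0))`_j| < d' &
      forall x y z, root (P s0) x -> root (P s) y -> z \in croots (P s) ->
        `|x - y| < d' -> `|x%:C%C - z| < d'%:C%C -> z = y%:C%C]].
Proof.
move=> Pf nc s0 e J0 e0; have [Pm Pc] := Pf.
have [P0m P0s] := Pm s0 J0.
pose prs := [seq ab <- [seq (a, b) | a <- croots (P s0), b <- croots (P s0)] | ab.1 != ab.2].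
have [d1 d10 Hd1] := @fin_min _ prs (fun ab => complex.Re `|ab.1 - ab.2|)
  (fun ab H => ltac:(move: H; rewrite mem_filter => /andP[ab12 _]; rewrite -ltcR;
     rewrite RRe_real ?normr_real// normr_gt0 subr_eq0; exact: ab12)).
pose d' := Num.min e (d1 / 2).
have d'0 : 0 < d' by rewrite lt_min e0 divr_gt0.
have d'1 : 2 * d' <= d1.
  have : d' <= d1 / 2 by rewrite ge_min lexx orbT.
  lra.
have [d d0 Hd] := @croots_small eta P n s0 (d' ^+ n) (croots (P s0)) Pf J0
  (exprn_gt0 _ d'0) (fun z zin => ltac:(rewrite -mem_croots//; exact: zin)).
exists d, d'; split=> //; first by rewrite d'0 ge_min lexx.
move=> s Js sd; have [Psm Pss] := Pm s Js.
apply: rootsR_close => //.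
- by rewrite Pss P0s.
- move=> a b a0 b0 ab.
  have : (a, b) \in prs by rewrite mem_filter ab /=; apply/allpairsP; exists (a, b).
  move=> /Hd1; rewrite -lecR RRe_real ?normr_real//= => h.
  by apply: le_trans h; rewrite lecR.
- exact: nc.
- by rewrite Pss /=; exact: Hd.
Qed.

Lemma size_rootsR_const eta P n : poly_family eta P n ->
  (forall s s', 0 < s <= eta -> 0 < s' <= eta -> ncroots (P s) = ncroots (P s')) ->
  forall s s', 0 < s <= eta -> 0 < s' <= eta ->
  size (rootsR (P s)) = size (rootsR (P s')).
Proof.
move=> Pf nc s s' Js Js'.
apply: (@loc_const _ eta (fun u => size (rootsR (P s)) = size (rootsR (P u)))) Js Js' _ => //.
move=> s0 J0; have [d [d' [d0 _ H]]] := roots_cont Pf nc J0 (@ltr01 R).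
exists d => // u Ju ud; have [-> _ _] := H u Ju ud; by split.
Qed.

Lemma cont_rootsR eta P n j : poly_family eta P n ->
  (forall s s', 0 < s <= eta -> 0 < s' <= eta -> ncroots (P s) = ncroots (P s')) ->
  (forall s, 0 < s <= eta -> (j < size (rootsR (P s)))%N) ->
  cont_on eta (fun s => (rootsR (P s))`_j).
Proof.
move=> Pf nc js; apply/cont_onP => s0 J0 e e0.
have [d [d' [d0 /andP[_ d'e] H]]] := roots_cont Pf nc J0 e0.
exists d => // s Js sd; have [_ h _] := H s Js sd.
exact: lt_le_trans (h _ (js s0 J0)) d'e.
Qed.

Lemma rootsR_root p j : p \is monic -> (j < size (rootsR p))%N -> root p (rootsR p)`_j.
Proof. by move=> pm js; rewrite -mem_rootsR// mem_nth. Qed.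

(* The zero of a factor that follows a root of the product: the complex roots of
   [Q s] near [x] are roots of [P s], and there is only one of those. *)
Lemma zero_rootsR eta P n Q m j : poly_family eta P n -> poly_family eta Q m ->
  (forall s, 0 < s <= eta -> Q s %| P s) ->
  (forall s s', 0 < s <= eta -> 0 < s' <= eta -> ncroots (P s) = ncroots (P s')) ->
  (forall s, 0 < s <= eta -> (j < size (rootsR (P s)))%N) ->
  forall s0, 0 < s0 <= eta -> (Q s0).[(rootsR (P s0))`_j] = 0 ->
  exists2 d, 0 < d & forall s, 0 < s <= eta -> `|s - s0| < d ->
    (Q s).[(rootsR (P s))`_j] = 0.
Proof.
move=> Pf Qf QP nc js s0 J0 Q0.
have [d [d' [d0 /andP[d'0 _] H]]] := roots_cont Pf nc J0 (@ltr01 R).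
have [d2 d20 Hd2] := @croots_small eta Q m s0 (d' ^+ m) [:: ((rootsR (P s0))`_j)%:C%C]
  Qf J0 (exprn_gt0 _ d'0)
  (fun z zin => ltac:(move: zin; rewrite inE => /eqP ->; rewrite fmorph_root; exact/eqP)).
exists (Num.min d d2); first by rewrite lt_min d0.
move=> s Js; rewrite lt_min => /andP[sd sd2].
have [Qm Qs] := Qf.1 s Js; have [Pm _] := Pf.1 s Js; have [P0m _] := Pf.1 s0 J0.
have [_ hj uniq_] := H s Js sd.
have := Hd2 s Js sd2 _ (mem_head _ _); set x := _`_j => hx.
have [||z zin xz] := @near_root _ (croots (Q s)) x%:C%C d'%:C%C.
- by rewrite lecR ltW.
- by rewrite -crootsE// size_croots// Qs -rmorphXn; exact: hx.
have zP : z \in croots (P s).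
  rewrite mem_croots//; rewrite mem_croots// in zin.
  rewrite -dvdp_XsubCl in zin; rewrite -dvdp_XsubCl (dvdp_trans zin)//.
  by rewrite dvdp_map; exact: QP.
have rj : root (P s) (rootsR (P s))`_j by apply: rootsR_root => //; exact: js.
have := uniq_ x (rootsR (P s))`_j z (rootsR_root P0m (js _ J0)) rj zP _ xz.
rewrite distrC => /(_ (hj _ (js _ J0))) zE.
by move: zin; rewrite zE real_croots// => /eqP.
Qed.

(** By the intermediate value theorem every number between the two positions of the root is a root
    of some intermediate [P u], so [P s] is small on that whole interval, which is therefore
    short. *)
Lemma rootsR_holder eta P n j : poly_family eta P n ->
  (forall s s', 0 < s <= eta -> 0 < s' <= eta -> ncroots (P s) = ncroots (P s')) ->
  (forall s, 0 < s <= eta -> (j < size (rootsR (P s)))%N) ->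
  forall s s' e, 0 < s <= eta -> 0 < s' <= eta -> 0 < e ->
  (forall u y, Num.min s s' <= u <= Num.max s s' -> root (P u) y ->
    `|(P s).[y]| < e ^+ n) ->
  `|(rootsR (P s))`_j - (rootsR (P s'))`_j| <= 2 * e * n%:R.
Proof.
move=> Pf nc js s s' e Js Js' e0 H.
have cL := cont_rootsR Pf nc js.
have [Pm Ps] := Pf.1 s Js.
have key a b : 0 < a <= eta -> 0 < b <= eta -> Num.min a b = Num.min s s' ->
  Num.max a b = Num.max s s' -> (rootsR (P a))`_j <= (rootsR (P b))`_j ->
  (rootsR (P b))`_j - (rootsR (P a))`_j <= 2 * e * n%:R.
  move=> Ja Jb mE ME ab.
  have := @sublevel_itv _ (P s) _ _ e Pm e0 ab; rewrite Ps /=; apply=> y yab.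
  have [u] := cont_ivt cL Ja Jb yab; rewrite mE ME => uI <-.
  apply: (H u) => //.
  have Ju : 0 < u <= eta.
    case/andP: uI; rewrite ge_min le_max => /orP[su|su] /orP[us|us];
    by case/andP: Js => ? ?; case/andP: Js' => ? ?; apply/andP; split; lra.
  by apply: rootsR_root; [have [] := Pf.1 u Ju|exact: js].
have [h|/ltW h] := leP (rootsR (P s))`_j (rootsR (P s'))`_j.
  by rewrite distrC ger0_norm ?subr_ge0//; exact: key.
by rewrite ger0_norm ?subr_ge0//; apply: key => //; rewrite (minC, maxC).
Qed.

End RootLift.

(** * Lifting a path between consecutive roots *)

Section LiftPath.
Variable R : realType.
Implicit Types (p : {poly R}) (eta s : R).

Lemma sorted_bracket (L : seq R) (a b x : R) : sorted <%R L -> a \in L -> b \in L ->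
  a <= x < b -> exists2 j, (j.+1 < size L)%N & L`_j <= x < L`_j.+1.
Proof.
move=> sL aL bL /andP[ax xb].
have mono i j : (i < size L)%N -> (j < size L)%N -> (i <= j)%N -> L`_i <= L`_j.
  move=> iL jL; rewrite leq_eqVlt => /orP[/eqP-> //|ij].
  by apply/ltW/(sorted_ltn_nth lt_trans) => //; rewrite ?inE.
have exi : exists i, (i < size L)%N && (x < L`_i).
  by exists (index b L); rewrite index_mem bL nth_index.
have [[|j] /andP[jL xj] minj] := ex_minnP exi.
  have := mono 0%N (index a L) jL; rewrite index_mem nth_index// => /(_ aL isT) h.
  by have := lt_le_trans xj (le_trans h ax); rewrite ltxx.
exists j => //; rewrite xj andbT leNgt; apply/negP => xj'.
by have := minj j; rewrite xj' (ltnW jL) ltnn => /(_ isT).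
Qed.

Lemma sorted_gap (L : seq R) j x : sorted <%R L -> (j.+1 < size L)%N ->
  L`_j < x < L`_j.+1 -> x \notin L.
Proof.
move=> sL jL /andP[jx xj]; apply/negP => xL.
have iL : (index x L < size L)%N by rewrite index_mem.
have E := nth_index 0 xL.
have [ij|ji] := leqP (index x L) j.
  have : L`_(index x L) <= L`_j.
    move: ij; rewrite leq_eqVlt => /orP[/eqP-> //|ij].
    by apply/ltW/(sorted_ltn_nth lt_trans) => //; rewrite ?inE// ltnW.
  by rewrite E leNgt jx.
have : L`_j.+1 <= L`_(index x L).
  move: ji; rewrite leq_eqVlt => /orP[/eqP-> //|ji].
  by apply/ltW/(sorted_ltn_nth lt_trans) => //; rewrite ?inE.
by rewrite E leNgt xj.
Qed.

Lemma lift_path (I : Type) eta (P : R -> {poly R}) n (Q : I -> R -> {poly R})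
    (m : I -> nat) (B x tau : R) :
  poly_family eta P n -> (forall i, poly_family eta (Q i) (m i)) ->
  (forall s s', 0 < s <= eta -> 0 < s' <= eta -> ncroots (P s) = ncroots (P s')) ->
  (forall i s, 0 < s <= eta -> Q i s %| P s) ->
  (forall s, 0 < s <= eta -> root (P s) (- B) /\ root (P s) B) ->
  0 < tau <= eta -> - B <= x < B ->
  exists xi : R -> R, [/\ xi tau = x, cont_on eta xi,
    forall i s, 0 < s <= eta -> Num.sg (Q i s).[xi s] = Num.sg (Q i tau).[x] &
    forall s s' e, 0 < s <= eta -> 0 < s' <= eta -> 0 < e ->
      (forall u y, Num.min s s' <= u <= Num.max s s' -> root (P u) y ->
         `|(P s).[y]| < e ^+ n) -> `|xi s - xi s'| <= 2 * e * n%:R].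
Proof.
move=> Pf Qf nc QP rB Jt xB.
pose L s := rootsR (P s).
have Lsort s : sorted <%R (L s) by exact: sorted_roots.
have Pm s : 0 < s <= eta -> P s \is monic by move=> /(Pf.1 s)[].
have [rB1 rB2] := rB tau Jt.
have [j jL /andP[jx xj]] : exists2 j, (j.+1 < size (L tau))%N &
    (L tau)`_j <= x < (L tau)`_j.+1.
  by apply: sorted_bracket xB; rewrite ?Lsort// mem_rootsR ?Pm.
have jLs s : 0 < s <= eta -> (j.+1 < size (L s))%N.
  by move=> Js; rewrite /L (size_rootsR_const Pf nc Js Jt).
have jLs' s : 0 < s <= eta -> (j < size (L s))%N by move=> /jLs/ltnW.
have c0 : cont_on eta (fun s => (L s)`_j) by exact: cont_rootsR Pf nc jLs'.
have c1 : cont_on eta (fun s => (L s)`_j.+1) by exact: cont_rootsR Pf nc jLs.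
have Llt s : 0 < s <= eta -> (L s)`_j < (L s)`_j.+1.
  by move=> Js; apply: (sorted_ltn_nth lt_trans) => //; rewrite ?inE ?jLs' ?jLs.
pose lam := (x - (L tau)`_j) / ((L tau)`_j.+1 - (L tau)`_j).
have den : 0 < (L tau)`_j.+1 - (L tau)`_j by rewrite subr_gt0 Llt.
have lam0 : 0 <= lam by apply: divr_ge0; [rewrite subr_ge0|exact: ltW].
have lam1 : lam < 1 by rewrite ltr_pdivrMr// mul1r ltrD2r.
pose xi s := (1 - lam) * (L s)`_j + lam * (L s)`_j.+1.
have xit : xi tau = x by rewrite /xi /lam; field; rewrite gt_eqF.
have cxi : cont_on eta xi.
  exact: (contD (contM (@cont_cst _ _ _) c0) (contM (@cont_cst _ _ _) c1)).
exists xi; split=> //.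
  move=> i s Js; rewrite -xit.
  have cQ : cont_on eta (fun s => (Q i s).[xi s]).
    apply: (@cont_horner _ _ _ _ (m i).+1) cxi; last exact: (Qf i).2.
    by move=> u Ju; have [_ ->] := (Qf i).1 u Ju.
  apply: (sg_const cQ) Jt Js => s0 J0.
  (* If [lam = 0] the path follows a root and [zero_rootsR] applies; otherwise it stays strictly
     between consecutive roots of [P], where no factor vanishes. *)
  have [lamE|lamN] := eqVneq lam 0.
    have xiE u : xi u = (L u)`_j by rewrite /xi lamE; ring.
    rewrite xiE => Q0.
    have [d d0 H] := zero_rootsR Pf (Qf i) (QP i) nc jLs' J0 Q0.
    by exists d => // u Ju ud; rewrite xiE; exact: H.
  move=> Q0; exfalso.
  have lam_gt0 : 0 < lam by rewrite lt_neqAle eq_sym lamN.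
  have : xi s0 \notin L s0.
    apply: (@sorted_gap _ j); rewrite ?jLs// /xi.
    have := Llt s0 J0; set u := _`_j; set v := _`_j.+1 => uv.
    by apply/andP; split; nra.
  rewrite mem_rootsR ?Pm// => /negP; apply.
  by rewrite -dvdp_XsubCl (dvdp_trans _ (QP i s0 J0))// dvdp_XsubCl; apply/eqP.
move=> s s' e Js Js' e0 H.
have h0 := rootsR_holder Pf nc jLs' Js Js' e0 H.
have h1 := rootsR_holder Pf nc jLs Js Js' e0 H.
have -> : xi s - xi s' = (1 - lam) * ((L s)`_j - (L s')`_j) +
    lam * ((L s)`_j.+1 - (L s')`_j.+1) by rewrite /xi; ring.
rewrite (le_trans (ler_normD _ _))// (normrM (1 - lam)) (normrM lam) (ger0_norm lam0).
rewrite (@ger0_norm _ (1 - lam)); last by rewrite subr_ge0 ltW.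
have -> : 2 * e * n%:R = (1 - lam) * (2 * e * n%:R) + lam * (2 * e * n%:R) by ring.
by apply: lerD; apply: ler_wpM2l => //; rewrite subr_ge0 ltW.
Qed.

(** Cauchy's bound; it confines the roots of all polynomials of a path to one interval, on which the
    change of the polynomial is estimated. *)
Lemma monic_root_bound p (y A : R) n : p \is monic -> size p = n.+1 -> root p y ->
  \sum_(j < n) `|p`_j| <= A -> `|y| <= 1 + A.
Proof.
move=> pm sp ry hA.
have A0 : 0 <= A by apply: le_trans hA; exact: sumr_ge0.
have [y1|y1] := leP `|y| 1; first by rewrite (le_trans y1)// lerDl.
case: n sp hA => [|n] sp hA.
  move: ry; rewrite /root (horner_coef p) sp big_ord1 mulr1.
  by have /monicP := pm; rewrite lead_coefE sp /= => ->; rewrite oner_eq0.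
apply: (@le_trans _ _ A); last by rewrite lerDr.
apply: le_trans hA.
have yn : 0 < `|y| ^+ n by rewrite exprn_gt0// (lt_trans _ y1).
rewrite -(ler_pM2r yn) -exprS.
have E : y ^+ n.+1 = - \sum_(j < n.+1) p`_j * y ^+ j.
  move: ry; rewrite /root horner_coef sp big_ord_recr /=.
  have /monicP := pm; rewrite lead_coefE sp /= => ->.
  by rewrite mul1r addrC addr_eq0 => /eqP.
rewrite -normrX E normrN mulr_suml (le_trans (ler_norm_sum _ _ _))// ler_sum// => j _.
by rewrite normrM normrX ler_wpM2l// ler_weXn2l ?ltW// -ltnS.
Qed.

End LiftPath.

(** * Paths of constant signs *)

Section AnalyticPolynomials.
Variable R : realType.
Local Notation C := R[i].
Local Notation toC := (map_poly (real_complex R)).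
Implicit Types (x y r : nat -> R).

(** Monicity and degree hold at every point, inside the box or not, which removes side conditions
    from root counting. *)
Definition anpoly k r n (p : (nat -> R) -> {poly R}) :=
  (forall x, p x \is monic /\ size (p x) = n.+1) /\
  forall j, isan k r (fun x => (p x)`_j).

Lemma isan_ext k r f g : (forall x, f x = g x) -> isan k r f -> isan k r g.
Proof. by move=> fg [M fM]; exists M; apply: an_ext fM. Qed.

Lemma anpolyM k r n m p q : (forall i, (i < k)%N -> 0 < r i) ->
  anpoly k r n p -> anpoly k r m q -> anpoly k r (n + m) (fun x => p x * q x).
Proof.
move=> r0 [pm pc] [qm qc]; split=> [x|j].
  have [pmx psx] := pm x; have [qmx qsx] := qm x.
  by rewrite monicMr// size_Mmonic ?monic_neq0// psx qsx addSn addnS.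
apply: (@isan_ext _ _ (fun x => \sum_(i < j.+1) (p x)`_i * (q x)`_(j - i))).
  by move=> x; rewrite coefM.
by apply: isan_sum => i _; exact: isanM.
Qed.

Lemma anpoly_cst k r n p : p \is monic -> size p = n.+1 -> anpoly k r n (fun=> p).
Proof. by move=> pm sp; split=> // j; exact: isan_cst. Qed.

Lemma anpoly_prod (I : Type) (t : seq I) k r (m : I -> nat) (P : I -> (nat -> R) -> {poly R}) :
  (forall i, (i < k)%N -> 0 < r i) ->
  (forall i, anpoly k r (m i) (P i)) ->
  anpoly k r (\sum_(i <- t) m i) (fun x => \prod_(i <- t) P i x).
Proof.
move=> r0 PA; elim: t => [|i t IH].
  rewrite big_nil (_ : (fun x => _) = fun=> 1).
    by apply: anpoly_cst; [exact: monic1|rewrite size_poly1].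
  by apply/funext => x; rewrite big_nil.
rewrite big_cons (_ : (fun x => _) = (fun x => P i x * \prod_(i <- t) P i x)).
  exact: anpolyM.
by apply/funext => x; rewrite big_cons.
Qed.

Lemma anpoly_local k r n p x y : anpoly k r n p -> box k r x ->
  (forall i, (i < k)%N -> x i = y i) -> p x = p y.
Proof.
move=> [_ pc] bx xy; apply/polyP => j.
by have [M pM] := pc j; exact: an_local pM bx xy.
Qed.

(** Newton's recursion, by strong induction on [m], expresses power sums as polynomials in the
    coefficients; in particular they are real. *)
Lemma powersum_isan k r n p m : (forall i, (i < k)%N -> 0 < r i) -> anpoly k r n p ->
  exists2 N, isan k r N & forall x, powersum (croots (p x)) m = (N x)%:C%C.
Proof.
move=> r0 [pm pc]; elim/ltn_ind: m => m IH.
have hN i : exists N, (i < m)%N ->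
    isan k r N /\ forall x, powersum (croots (p x)) i = (N x)%:C%C.
  case: (ltnP i m) => [/IH[N NA NE]|im]; first by exists N.
  by exists (fun=> 0).
have [N NE] := choice hN.
have cE x j : (\prod_(w <- croots (p x)) ('X - w%:P))`_j = ((p x)`_j)%:C%C.
  by rewrite -crootsE ?coef_map//; have [] := pm x.
have sE x : size (croots (p x)) = n.
  by have [pmx psx] := pm x; rewrite size_croots// psx.
have [mn|nm] := ltnP m n.
  exists (fun x => (p x)`_(n - m) *+ (n - m) -
    \sum_(l < n | (n - m <= l)%N) (p x)`_l * N (l - (n - m))%N x).
    apply: isanD.
      apply: (@isan_ext _ _ (fun x => (n - m)%:R * (p x)`_(n - m))).
        by move=> x; rewrite mulr_natl.
      by apply: isanM => //; exact: isan_cst.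
    apply: isanN => //; apply: isan_sum => l nl; apply: isanM => //.
    by have /NE[] : (l - (n - m) < m)%N by have := ltn_ord l; move: nl mn; lia.
  move=> x; rewrite powersum_lt ?sE// !cE rmorphB rmorphMn rmorph_sum /=.
  congr (_ - _); apply: eq_bigr => l nl; rewrite cE rmorphM /=.
  have /NE[_ ->] // : (l - (n - m) < m)%N by have := ltn_ord l; move: nl mn; lia.
exists (fun x => - \sum_(l < n) (p x)`_l * N (l + (m - n))%N x).
  apply: isanN => //; apply: isan_sum => l _; apply: isanM => //.
  by have /NE[] : (l + (m - n) < m)%N by have := ltn_ord l; move: nm; lia.
move=> x; rewrite powersum_ge ?sE// rmorphN rmorph_sum /=.
congr (- _); apply: eq_bigr => l _; rewrite cE rmorphM /=.
have /NE[_ ->] // : (l + (m - n) < m)%N by have := ltn_ord l; move: nm; lia.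
Qed.

Lemma isan_det k r d (A : 'I_d -> 'I_d -> (nat -> R) -> R) :
  (forall i, (i < k)%N -> 0 < r i) -> (forall i j, isan k r (A i j)) ->
  isan k r (fun x => \det (\matrix_(i, j) A i j x)).
Proof.
move=> r0 AA; apply: (@isan_ext _ _ (fun x => \sum_(s : 'S_d) (-1) ^+ s * \prod_i A i (s i) x)).
  by move=> x; apply: eq_bigr => s _; congr (_ * _); apply: eq_bigr => i _; rewrite mxE.
apply: isan_sum => s _; apply: isanM => //; first exact: isan_cst.
by apply: isan_prod => // i _.
Qed.

(* [F] consists of the minors of the Hankel matrix of power sums, whose rank is
   the number of distinct complex roots. *)
Lemma ncroots_minors k r n p : (forall i, (i < k)%N -> 0 < r i) -> anpoly k r n p ->
  exists (I : finType) (F : I -> (nat -> R) -> R), (forall i, isan k r (F i)) /\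
    forall x y, (forall i, Num.sg (F i x) = Num.sg (F i y)) ->
      ncroots (p x) = ncroots (p y).
Proof.
move=> r0 pA.
have hN m : exists N, isan k r N /\ forall x, powersum (croots (p x)) m = (N x)%:C%C.
  by have [N ? ?] := powersum_isan m r0 pA; exists N.
have [N NE] := choice hN.
pose H x : 'M[R]_n := \matrix_(a, b) N (a + b)%N x.
have rk x : \rank (H x) = ncroots (p x) :> nat.
  have sE : size (croots (p x)) = n.
    by have [pmx psx] := pA.1 x; rewrite size_croots// psx.
  rewrite /ncroots -rank_hankel -(mxrank_map (real_complex R)).
  case: (n) / sE @H; congr (\rank _); apply/matrixP => a b; rewrite !mxE.
  by have [_ ->] := NE (a + b)%N.
pose T := {d : 'I_n.+1 & ({ffun 'I_d -> 'I_n} * {ffun 'I_d -> 'I_n})%type}.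
pose minor (t : T) x := let: existT d fg := t in \det (mxsub fg.1 fg.2 (H x)).
exists T, minor; split=> [[d [f g]]|x y xy].
  apply: (@isan_ext _ _ (fun x => \det (\matrix_(i, j) N (f i + g j)%N x))).
    by move=> x; congr (\det _); apply/matrixP => i j; rewrite !mxE.
  by apply: isan_det => // i j; have [] := NE (f i + g j)%N.
rewrite -!rk.
have le u v : (forall t, Num.sg (minor t u) = Num.sg (minor t v)) ->
   (\rank (H u) <= \rank (H v))%N.
  move=> uv; have dn : (\rank (H u) < n.+1)%N by rewrite ltnS rank_leq_row.
  have /rank_minors[f [g fg]] := leqnn (\rank (H u)).
  apply/rank_minors; exists f, g.
  have := uv (existT (fun d : 'I_n.+1 => ({ffun 'I_d -> 'I_n} * {ffun 'I_d -> 'I_n})%type)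
     (Ordinal dn) (f, g)).
  by rewrite /= => E; rewrite -sgr_eq0 -E sgr_eq0.
by apply/eqP; rewrite eqn_leq !le.
Qed.

End AnalyticPolynomials.

(** * Tame families and the induction step *)

Section TamePaths.
Variable R : realType.
Implicit Types (x y : nat -> R).

(* The path through [x] is parametrised by its first coordinate: in the
   application this is the distance to the origin. *)
Definition tame k (I : Type) (F : I -> (nat -> R) -> R) := exists eta K e : R,
  [/\ 0 < eta, 0 < K, 0 < e & forall x, box k (fun=> eta) x -> 0 < x 0%N ->
   exists g : R -> nat -> R,
    [/\ g (x 0%N) = x,
        forall s, 0 < s <= eta -> g s 0%N = s,
        forall i, (i < k)%N -> cont_on eta (fun s => g s i),
        forall i s s', (i < k)%N -> 0 < s <= eta -> 0 < s' <= eta ->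
          `|g s i - g s' i| <= K * Num.max s s' `^ e &
        forall i s, 0 < s <= eta -> Num.sg (F i (g s)) = Num.sg (F i x)]].

Lemma powR_small (K e sigma : R) : 0 < K -> 0 < e -> 0 < sigma ->
  exists2 eta, 0 < eta & forall s, 0 < s <= eta -> K * s `^ e <= sigma.
Proof.
move=> K0 e0 s0; have sK : 0 < sigma / K by rewrite divr_gt0.
exists ((sigma / K) `^ e^-1); first exact: powR_gt0.
move=> s /andP[sp sl]; rewrite mulrC -ler_pdivlMr//.
apply: (@le_trans _ _ (((sigma / K) `^ e^-1) `^ e)).
  by apply: ge0_ler_powR => //; rewrite ?nnegrE ?powR_ge0 // ltW.
by rewrite -powRrM mulVf ?gt_eqF// powRr1// ltW.
Qed.

Lemma max_half (eta s s' : R) : 0 < s <= eta -> 0 < s' <= eta -> 0 < Num.max s s' <= eta.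
Proof. by move=> /andP[s0 sE] /andP[s0' sE']; rewrite lt_max s0 ge_max sE. Qed.

Lemma half_coord k (eta : R) x : (0 < k)%N -> box k (fun=> eta) x -> 0 < x 0%N ->
  0 < x 0%N <= eta.
Proof. by move=> k0 /(_ 0%N k0) h x0; rewrite x0 (le_trans (ler_norm _)). Qed.

(** A path leaves its starting point by at most a multiple of a power of [eta], so a smaller [eta]
    confines it to any box while [K] and [e] stay the same. Constants built from [K] and [e] can
    thus be fixed before [eta]. *)
Lemma tame_near k (I : Type) (F : I -> (nat -> R) -> R) : (0 < k)%N -> tame k F ->
  exists2 Ke : R * R, 0 < Ke.1 /\ 0 < Ke.2 & forall sigma, 0 < sigma ->
  exists2 eta0 : R, 0 < eta0 & forall eta, 0 < eta <= eta0 ->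
  forall x, box k (fun=> eta) x -> 0 < x 0%N ->
   exists g : R -> nat -> R,
    [/\ g (x 0%N) = x,
        forall s, 0 < s <= eta -> g s 0%N = s /\ box k (fun=> sigma) (g s),
        forall i, (i < k)%N -> cont_on eta (fun s => g s i),
        forall i s s', (i < k)%N -> 0 < s <= eta -> 0 < s' <= eta ->
          `|g s i - g s' i| <= Ke.1 * Num.max s s' `^ Ke.2 &
        forall i s, 0 < s <= eta -> Num.sg (F i (g s)) = Num.sg (F i x)].
Proof.
move=> k0 [eta1 [K [e [eta10 K0 e0 H]]]]; exists (K, e) => // sigma s0.
have s20 : 0 < sigma / 2 by rewrite divr_gt0.
have [eta2 eta20 H2] := powR_small K0 e0 s20.
exists (Num.min (Num.min eta1 eta2) (sigma / 2)); first by rewrite !lt_min eta10 eta20.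
move=> eta /andP[eta0]; rewrite !le_min => /andP[/andP[le1 le2] le3] x bx x0.
have up s : 0 < s <= eta -> 0 < s <= eta1.
  by move=> /andP[-> h]; exact: le_trans le1.
have Jx : 0 < x 0%N <= eta by exact: half_coord bx x0.
have [|g [gx g0 gc gh gs]] := H x _ x0.
  by move=> i ik; exact: le_trans (bx i ik) le1.
have gh' i s s' : (i < k)%N -> 0 < s <= eta -> 0 < s' <= eta ->
          `|g s i - g s' i| <= K * Num.max s s' `^ e.
  by move=> ik Js Js'; apply: gh => //; exact: up.
exists g; split=> //.
- move=> s Js; split; first by apply: g0; exact: up.
  move=> i ik; have := gh' i s (x 0%N) ik Js Jx; rewrite gx => h1.
  have h2 : K * Num.max s (x 0%N) `^ e <= sigma / 2.
    by apply: H2; have /andP[-> h] := max_half Js Jx; exact: le_trans h le2.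
  have h3 : `|x i| <= sigma / 2 by apply: le_trans (bx i ik) le3.
  have := ler_normD (g s i - x i) (x i); rewrite subrK; lra.
- move=> i ik; apply/cont_onP => u Ju eps eps0.
  have [d d0 Hd] := (cont_onP _ _).1 (gc i ik) u (up u Ju) eps eps0.
  by exists d => // s Js; apply: Hd; exact: up.
- by move=> i s Js; apply: gs; exact: up.
Qed.

(** The constant [L] depends on [f] alone, so it serves all the paths of a tame family. *)
Lemma an_path k (rho : R) f : 0 < rho -> isan k (fun=> rho) f ->
  exists2 L, 0 <= L & forall eta K e (g : R -> nat -> R), 0 <= K ->
   (forall s, 0 < s <= eta -> box k (fun=> rho / 2) (g s)) ->
   (forall i s s', (i < k)%N -> 0 < s <= eta -> 0 < s' <= eta ->
          `|g s i - g s' i| <= K * Num.max s s' `^ e) ->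
   (forall i, (i < k)%N -> cont_on eta (fun s => g s i)) ->
   (forall s s', 0 < s <= eta -> 0 < s' <= eta ->
      `|f (g s) - f (g s')| <= L * (K * Num.max s s' `^ e)) /\
   cont_on eta (fun s => f (g s)).
Proof.
move=> rho0 [M fM].
have [c c0 cP] := @an_lip R k (fun=> rho) (fun _ _ => rho0).
have M0 := an_ge0 fM.
have cM0 : 0 <= c * M by rewrite mulr_ge0.
exists (c * M * k%:R); first by rewrite mulr_ge0.
move=> eta K e g K0 gb gh gc; split=> [s s' Js Js'|].
  apply: le_trans (cP M f fM _ _ (gb s Js) (gb s' Js')) _.
  rewrite -!mulrA ler_wpM2l// ler_wpM2l//.
  apply: (@le_trans _ _ (\sum_(i < k) K * Num.max s s' `^ e)).
    by apply: ler_sum => i _; exact: gh.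
  by rewrite sumr_const card_ord [leRHS]mulr_natl.
apply/cont_onP => s0 J0 eps eps0.
have cs : cont_on eta (fun s => \sum_(i < k) (if (i < k)%N then `|g s i - g s0 i| else 0)).
  apply: (@cont_sum _ _ _ (fun i s => if (i < k)%N then `|g s i - g s0 i| else 0)) => i.
  case: ltnP => ik; last exact: cont_cst.
  apply: cont_norm; apply: (contD (gc i ik)); exact: cont_cst.
have cM1 : 0 < c * M + 1 by rewrite ltr_wpDl.
have [d d0 Hd] := (cont_onP _ _).1 cs s0 J0 (eps / (c * M + 1)) (divr_gt0 eps0 cM1).
exists d => // s Js sd; apply: le_lt_trans (cP M f fM _ _ (gb s Js) (gb s0 J0)) _.
have := Hd s Js sd; rewrite [X in _ - X]big1 ?subr0 => [|i _]; last first.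
  by rewrite subrr normr0 if_same.
under eq_bigr => i _ do rewrite ltn_ord.
have S0 : 0 <= \sum_(i < k) `|g s i - g s0 i| by exact: sumr_ge0.
rewrite ger0_norm// ltr_pdivlMr// mulrC; apply: le_lt_trans.
by rewrite ler_wpM2r// lerDl.
Qed.

Lemma choice_ge0 (Q : nat -> R -> Prop) :
  (forall j, exists2 L, 0 <= L & Q j L) ->
  exists L : nat -> R, forall j, 0 <= L j /\ Q j (L j).
Proof.
move=> H; have H' j : exists L, 0 <= L /\ Q j L by have [L ? ?] := H j; exists L.
by have [L LP] := choice H'; exists L.
Qed.

Lemma tame_step k (I : finType) (F : I -> (nat -> R) -> R) (rho : R)
    (P : I -> (nat -> R) -> {poly R}) (m : I -> nat) (c : I -> R) :
  (0 < k)%N ->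
  (forall (I' : finType) (F' : I' -> (nat -> R) -> R),
    (forall i, isan k (fun=> rho) (F' i)) -> tame k F') ->
  0 < rho -> (forall i, anpoly k (fun=> rho) (m i) (P i)) ->
  (forall i x, box k.+1 (fun=> rho) x -> 0 < x 0%N ->
     Num.sg (F i x) = c i * Num.sg (P i x).[x k]) ->
  tame k.+1 F.
Proof.
move=> k0 IH rho0 PA FP.
have r0 : forall i, (i < k)%N -> 0 < (fun=> rho : R) i by [].
(* Strictly larger than any admissible last coordinate, as the upper bracket in [lift_path] is
   strict. *)
pose B := rho + 1.
have fB : anpoly k (fun=> rho) 1 (fun=> 'X - B%:P).
  by apply: anpoly_cst; rewrite ?monicXsubC ?size_XsubC.
have fB' : anpoly k (fun=> rho) 1 (fun=> 'X - (- B)%:P).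
  by apply: anpoly_cst; rewrite ?monicXsubC ?size_XsubC.
pose Pi x := ('X - B%:P) * ('X - (- B)%:P) * \prod_(i <- enum I) P i x.
pose n := (1 + 1 + \sum_(i <- enum I) m i)%N.
have PiA : anpoly k (fun=> rho) n Pi.
  by apply: anpolyM => //; [exact: anpolyM|exact: anpoly_prod].
have n0 : (0 < n)%N by [].
have [I' [F' [F'A F'nc]]] := ncroots_minors r0 PiA.
have [[K e] /= [K0 e0] near] := tame_near k0 (IH I' F' F'A).
have [M0 M0E] : exists M : nat -> R, forall j, an k (fun=> rho) (M j) (fun x => (Pi x)`_j).
  by have [M ME] := choice PiA.2; exists M.
have [L LE] := choice_ge0 (fun j => an_path rho0 (PiA.2 j)).
(* Cauchy's bound for the roots of [Pi] over the whole box. *)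
pose A := 1 + \sum_(j < n) M0 j.
have M00 j : 0 <= M0 j by exact: an_ge0 (M0E j).
have A0 : 0 <= A by rewrite addr_ge0 ?sumr_ge0.
(* For |y| <= [A], two polynomials of the path differ at [y] by at most [Lam] times the [e]-th power
   of the larger parameter. *)
pose Lam := \sum_(j < n.+1) L j * K * A ^+ j.
have Lam0 : 0 <= Lam.
  by apply: sumr_ge0 => j _; rewrite !mulr_ge0 ?exprn_ge0 ?(LE j).1 ?(ltW K0).
have Lam1 : 0 < Lam + 1 by rewrite ltr_wpDl.
(* The bound of [lift_path] controls the [n]-th power of the displacement, so the exponent is
   divided by [n]. *)
pose e' := e / n%:R.
have nR : 0 < n%:R :> R by rewrite ltr0n.
have e'0 : 0 < e' by rewrite divr_gt0.
pose K1 := 2 * (Lam + 1) `^ n%:R^-1 * n%:R.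
have K10 : 0 < K1 by rewrite !mulr_gt0 ?powR_gt0.
have KK : 0 < K + K1 by rewrite addr_gt0.
have rho2 : 0 < rho / 2 by rewrite divr_gt0.
have [eta1 eta10 nearP] := near _ rho2.
have [eta2 eta20 small] := powR_small K10 e'0 rho2.
pose eta := Num.min (Num.min eta1 eta2) (Num.min (rho / 2) 1).
have eta0 : 0 < eta by rewrite !lt_min eta10 eta20 rho2 ltr01.
have [etaE1 etaE2] : eta <= eta1 /\ eta <= eta2.
  by split; rewrite !ge_min lexx ?orbT.
have [etaE3 etaE4] : eta <= rho / 2 /\ eta <= 1.
  by split; rewrite !ge_min lexx ?orbT.
exists eta, (K + K1), e'; split=> // x bx x0.
have Jx : 0 < x 0%N <= eta by exact: half_coord bx x0.
have [|g [gx g0 gc gh gs]] := nearP eta _ x (boxW bx) x0; first by rewrite eta0.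
have gb s : 0 < s <= eta -> box k (fun=> rho / 2) (g s) by move=> /g0[].
pose PP s := Pi (g s).
have PPf : poly_family eta PP n.
  split=> [s Js|j]; first exact: PiA.1.
  exact: ((LE j).2 eta K e g (ltW K0) gb gh gc).2.
have Qf i : poly_family eta (fun s => P i (g s)) (m i).
  split=> [s Js|j]; first exact: (PA i).1.
  have [L' _ /(_ eta K e g (ltW K0) gb gh gc)[_]] := an_path rho0 ((PA i).2 j).
  by [].
have nc s s' : 0 < s <= eta -> 0 < s' <= eta -> ncroots (PP s) = ncroots (PP s').
  by move=> Js Js'; apply: F'nc => i; rewrite !gs.
have QP i s : 0 < s <= eta -> P i (g s) %| PP s.
  move=> _; apply: dvdp_mull; rewrite (big_rem i) ?mem_enum//=.
  exact: dvdp_mulr.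
have rB s : 0 < s <= eta -> root (PP s) (- B) /\ root (PP s) B.
  by move=> _; rewrite /PP /Pi !rootM !root_XsubC !eqxx !orbT.
have xB : - B <= x k < B.
  have := bx k (ltnSn k); rewrite ler_norml /B => /andP[h1 h2].
  by apply/andP; split; lra.
have [xi [xit cxi xis xih]] := lift_path PPf Qf nc QP rB Jx xB.
have xiK s s' : 0 < s <= eta -> 0 < s' <= eta ->
    `|xi s - xi s'| <= K1 * Num.max s s' `^ e'.
  move=> Js Js'; have Jm := max_half Js Js'.
  set mx := Num.max s s' in Jm *.
  have mx0 : 0 < mx by case/andP: Jm.
  have me0 : 0 < mx `^ e by exact: powR_gt0.
  (* An [n]-th root of the bound on the polynomials; [Lam + 1] instead of [Lam] makes the required
     inequality strict. *)
  pose eps := ((Lam + 1) * mx `^ e) `^ n%:R^-1.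
  have eps0 : 0 < eps by rewrite powR_gt0// mulr_gt0.
  have epsn : eps ^+ n = (Lam + 1) * mx `^ e.
    rewrite -powR_mulrn ?(ltW eps0)// -powRrM mulVf ?gt_eqF// powRr1// ltW//.
    by rewrite mulr_gt0.
  have -> : K1 * mx `^ e' = 2 * eps * n%:R.
    rewrite /K1 /eps powRM ?powR_ge0 ?(ltW Lam1)// -powRrM -/e'; ring.
  apply: xih => // u y uI ry.
  have Ju : 0 < u <= eta.
    case/andP: uI; rewrite ge_min le_max => /orP[su|su] /orP[us|us];
    by case/andP: Js => ? ?; case/andP: Js' => ? ?; apply/andP; split; lra.
  have yA : `|y| <= A.
    have [PPm PPs] := PPf.1 u Ju.
    apply: (monic_root_bound PPm PPs ry); apply: ler_sum => j _.
    apply: an_bound (M0E j) _ => i ik.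
    by rewrite (le_trans (gb u Ju i ik))// ler_pdivrMr// ler_peMr// ?ler1n// ltW.
  have -> : (PP s).[y] = (PP s).[y] - (PP u).[y] by rewrite (eqP ry) subr0.
  apply: (@le_lt_trans _ _ (Lam * mx `^ e)); last by rewrite epsn ltr_pM2r// ltrDl.
  have [_ ss] := PPf.1 s Js; have [_ su] := PPf.1 u Ju.
  apply: (le_trans (@eval_diff_real _ (PP u) (PP s) y A n.+1 _ _ yA)); rewrite ?ss ?su//.
  rewrite mulr_suml; apply: ler_sum => j _.
  rewrite [leRHS]mulrAC -[L j * K * _]mulrA ler_wpM2r ?exprn_ge0//.
  have := ((LE j).2 eta K e g (ltW K0) gb gh gc).1 s u Js Ju => /le_trans; apply.
  rewrite ler_wpM2l ?(LE j).1// ler_wpM2l ?(ltW K0)//.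
  have Jsu := max_half Js Ju.
  apply: ge0_ler_powR; rewrite ?nnegrE ?(ltW e0) ?(ltW mx0)//.
    by case/andP: Jsu => /ltW.
  by rewrite ge_max /mx le_max lexx /=; case/andP: uI.
have xib s : 0 < s <= eta -> `|xi s| <= rho.
  move=> Js; have := xiK s (x 0%N) Js Jx; rewrite xit => h1.
  have h2 : K1 * Num.max s (x 0%N) `^ e' <= rho / 2.
    by apply: small; have /andP[-> h] := max_half Js Jx; exact: le_trans h etaE2.
  have h3 : `|x k| <= rho / 2 by apply: le_trans (bx k (ltnSn k)) etaE3.
  have := ler_normD (xi s - x k) (x k); rewrite subrK; lra.
exists (fun s => upd (g s) k (xi s)); split.
- apply/funext => i; rewrite /upd; case: eqP => [->|_]; first exact: xit.
  by rewrite gx.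
- by move=> s Js; rewrite upd_lt//; have [] := g0 s Js.
- move=> i; rewrite ltnS leq_eqVlt => /orP[/eqP->|ik].
    by apply: cont_ext cxi => s _; rewrite updE.
  by apply: cont_ext (gc i ik) => s _; rewrite upd_lt.
- move=> i s s' ik Js Js'.
  have /andP[m0 m1] := max_half Js Js'.
  move: ik; rewrite ltnS leq_eqVlt => /orP[/eqP->|ik].
    rewrite !updE (le_trans (xiK s s' Js Js'))// ler_wpM2r ?powR_ge0//.
    by rewrite lerDr ltW.
  rewrite !upd_lt// (le_trans (gh i s s' ik Js Js'))//.
  apply: ler_pM; rewrite ?powR_ge0 ?(ltW K0)//; first by rewrite lerDl ltW.
  apply: ger_powR; first by rewrite m0 (le_trans m1).
  by rewrite ler_pdivrMr// ler_peMr ?(ltW e0)// ler1n.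
- move=> i s Js.
  have bs : box k.+1 (fun=> rho) (upd (g s) k (xi s)).
    move=> j; rewrite ltnS leq_eqVlt => /orP[/eqP->|jk]; first by rewrite updE xib.
    by rewrite upd_lt// (le_trans (gb s Js j jk))// ler_pdivrMr// ler_peMr// ?ler1n// ltW.
  have bx' : box k.+1 (fun=> rho) x.
    move=> j jk; rewrite (le_trans (bx j jk))// (le_trans etaE3)//.
    by rewrite ler_pdivrMr// ler_peMr// ?ler1n// ltW.
  have [g0s _] := g0 s Js; have s_gt0 : 0 < s by case/andP: Js.
  rewrite FP//; last by rewrite upd_lt// g0s.
  rewrite FP// updE; congr (_ * _).
  have -> : P i (upd (g s) k (xi s)) = P i (g s).
    by apply: (anpoly_local (PA i) (boxW bs)) => j jk; rewrite upd_lt.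
  by rewrite (xis i s Js) gx.
Qed.

End TamePaths.

(** * Induction on the number of variables *)

Section TameTheorem.
Variable R : realType.
Implicit Types (x y z : nat -> R) (f : (nat -> R) -> R).

(** Since [an_factor] treats the last variable, this exchange lets it divide by powers of the first
    one, the parameter of the paths. *)
Definition swap0 k x : nat -> R :=
  fun i => if i == 0%N then x k else if i == k then x 0%N else x i.

Lemma swap0K k x : swap0 k (swap0 k x) = x.
Proof.
apply/funext => i; rewrite /swap0 eqxx.
have [->|i0] := eqVneq i 0%N; last by have [->|] := eqVneq i k.
by have [->|] := eqVneq k 0%N.
Qed.

Lemma box_swap0 k (rho : R) x : box k.+1 (fun=> rho) x -> box k.+1 (fun=> rho) (swap0 k x).
Proof.
move=> bx i ik; rewrite /swap0; case: eqP => _; first exact: bx.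
by case: eqP => _; exact: bx.
Qed.

Lemma isan_swap0 k (rho : R) f : 0 < rho -> isan k.+1 (fun=> rho) f ->
  isan k.+1 (fun=> rho) (fun x => f (swap0 k x)).
Proof.
move=> rho0 [M fM]; exists M.
apply: (an_comp (phi := fun i x => swap0 k x i)) fM _ => // i ik.
rewrite /swap0; case: eqP => _; first exact: an_coord.
by case: eqP => _; exact: an_coord.
Qed.

(** A power of [x 0%N] is positive where [x 0%N] is, so dividing by it preserves signs. The factor
    [b] is 0, with [f'] equal to 1, when [f] vanishes identically, and 1 otherwise. *)
Lemma factor_first k (rho : R) f : 0 < rho -> isan k.+1 (fun=> rho) f ->
  exists (b : R) f', [/\ isan k.+1 (fun=> rho) f',
    forall x, box k.+1 (fun=> rho) x -> 0 < x 0%N -> Num.sg (f x) = b * Num.sg (f' x) &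
    exists2 z, box k.+1 (fun=> rho) z & z 0%N = 0 /\ f' z != 0].
Proof.
move=> rho0 fA; have [M fM] := isan_swap0 rho0 fA.
have r0 : forall i, (i < k.+1)%N -> 0 < (fun=> rho : R) i by [].
have [f0|[a [f1 [g [M1 [M2 [f1M gM fE f1E [z bz gz]]]]]]]] := an_factor r0 fM.
  exists 0, (fun=> 1); split; first exact: isan_cst.
    by move=> x bx _; rewrite mul0r -[x](swap0K k) f0 ?sgr0//; exact: box_swap0.
  by exists (fun=> 0) => [i _|]; rewrite ?normr0 ?ltW// oner_neq0.
exists 1, (fun x => f1 (swap0 k x)); split.
- by apply: isan_swap0 => //; exists M1.
- move=> x bx x0; rewrite mul1r -{1}[x](swap0K k) fE; last exact: box_swap0.
  by rewrite sgrM gtr0_sg ?mul1r// exprn_gt0// /swap0 eqxx; case: eqP => // ->.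
have by_ : box k.+1 (fun=> rho) (upd z k 0).
  move=> i; rewrite ltnS leq_eqVlt => /orP[/eqP->|ik]; first by rewrite updE normr0 ltW.
  by rewrite upd_lt//; exact: bz.
exists (swap0 k (upd z k 0)); first exact: box_swap0.
split; first by rewrite /swap0 eqxx updE.
rewrite swap0K f1E ?updE//.
by rewrite -(an_local gM bz)// => i ik; rewrite upd_lt.
Qed.

Lemma prod_nonzero (I : Type) (t : seq I) k (rho : R) (h : I -> (nat -> R) -> R) :
  0 < rho -> (forall i, isan k (fun=> rho) (h i)) ->
  (forall i, exists2 x, box k (fun=> rho) x & h i x != 0) ->
  exists2 x, box k (fun=> rho) x & \prod_(i <- t) h i x != 0.
Proof.
move=> rho0 hA hN; elim: t => [|i t [x bx hx]].
  by exists (fun=> 0) => [i _|]; rewrite ?normr0 ?ltW// big_nil oner_neq0.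
have r0 : forall i, (i < k)%N -> 0 < (fun=> rho : R) i by [].
apply: contrapT => H.
have [M hM] := hA i; have [N tN] := isan_prod t (P := xpredT) r0 (fun i _ => hA i).
have [h0|t0] : (forall x, box k (fun=> rho) x -> h i x = 0) \/
    (forall x, box k (fun=> rho) x -> \prod_(i <- t) h i x = 0).
  apply: (an_domain r0 hM tN) => y by_; apply: contrapT => /eqP hy; apply: H.
  by exists y => //; rewrite big_cons.
  by have [y by_] := hN i; rewrite h0 ?eqxx.
by rewrite t0 ?eqxx in hx.
Qed.

(** After division by a power of the variable, each function not identically zero is nonzero at 0;
    signs are thus constant on a short interval, which itself is the path. *)
Lemma tame_base (I : finType) (F : I -> (nat -> R) -> R) (rho : R) : 0 < rho ->
  (forall i, isan 1 (fun=> rho) (F i)) -> tame 1 F.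
Proof.
move=> rho0 FA.
have r0 : forall i, (i < 1)%N -> 0 < (fun=> rho : R) i by [].
have hs i : exists es : R * R, 0 < es.1 /\
    forall x, box 1 (fun=> es.1) x -> 0 < x 0%N -> Num.sg (F i x) = es.2.
  have [M fM] := FA i.
  have [f0|[a [f1 [g [M1 [M2 [f1M gM fE f1E [z bz gz]]]]]]]] := an_factor r0 fM.
    by exists (rho, 0); split=> //= x bx _; rewrite f0// sgr0.
  have [c c0 /(_ _ _ f1M) cP] := an_lip r0.
  have M10 := an_ge0 f1M.
  have cM1 : 0 < c * M1 + 1 by rewrite ltr_wpDl// mulr_ge0.
  have gz0 : 0 < `|g z| by rewrite normr_gt0.
  pose eta := Num.min (rho / 2) (`|g z| / (c * M1 + 1) / 2).
  have eta0 : 0 < eta by rewrite lt_min !divr_gt0.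
  exists (eta, Num.sg (g z)); split=> //= x bx x0.
  have etar : eta <= rho / 2 by rewrite ge_min lexx.
  have etag : eta <= `|g z| / (c * M1 + 1) / 2 by rewrite ge_min lexx orbT.
  have bx2 : box 1 (fun=> rho / 2) x by move=> i' ik; exact: le_trans (bx i' ik) etar.
  have bx1 : box 1 (fun=> rho) x by move=> i' ik; have := bx2 i' ik; lra.
  have b0 : box 1 (fun=> rho / 2) (fun=> 0 : R).
    by move=> i' _; rewrite normr0 divr_ge0// ltW.
  have gE : f1 (fun=> 0) = g z.
    rewrite f1E//; last by move=> i' _; rewrite normr0 ltW.
    by have [d _ dE] := gM; rewrite !dE.
  rewrite fE// sgrM gtr0_sg ?exprn_gt0// mul1r; apply: sg_near.
  rewrite -gE; apply: le_lt_trans (cP _ _ bx2 b0) _.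
  rewrite big_ord1 subr0 gE.
  apply: (@le_lt_trans _ _ ((c * M1 + 1) * eta)).
    by apply: ler_pM; rewrite ?mulr_ge0// ?lerDl//; exact: bx.
  rewrite mulrC -ltr_pdivlMr// (le_lt_trans etag)// ltr_pdivrMr// ltr_pMr ?ltr1n//.
  by rewrite divr_gt0.
have [es esP] := choice hs.
have [eta eta0 etaP] := @fin_min R I (enum I) (fun i => (es i).1) (fun i _ => (esP i).1).
exists eta, 1, 1; split=> // x bx x0; exists (fun s => upd x 0 s); split.
- by apply/funext => i; rewrite /upd; case: eqP => [->|].
- by move=> s _; rewrite updE.
- move=> [|//] _; apply/cont_onP => s0 _ e e0; by exists e.
- move=> [|//] s s' _ /andP[s0 _] /andP[s0' _]; rewrite !updE mul1r powRr1; last first.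
    by rewrite le_max ltW.
  by have [h|h] := leP s s'; rewrite ler_norml; lra.
- move=> i s /andP[s0 sE].
  rewrite !(esP i).2 ?updE//.
    move=> [|//] _; apply: le_trans (bx 0%N isT) _.
    by apply: etaP; rewrite mem_enum.
  move=> [|//] _; rewrite updE gtr0_norm// (le_trans sE)//.
  by apply: etaP; rewrite mem_enum.
Qed.

Lemma anpoly_weierstrass k r D (p : nat -> (nat -> R) -> R) :
  (forall j, isan k r (p j)) ->
  anpoly k r D (fun x => 'X^D + \poly_(j < D) p j x).
Proof.
move=> pA; split=> [x|j].
  have sp : (size (\poly_(j < D) p j x) < size ('X^D : {poly R}))%N.
    by rewrite size_polyXn ltnS size_poly.
  split; last by rewrite size_polyDl// size_polyXn.
  by rewrite monicE lead_coefDl// lead_coefXn.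
apply: (@isan_ext _ _ _ (fun x => (j == D)%:R + (if (j < D)%N then p j x else 0))).
  by move=> x; rewrite coefD coefXn coef_poly.
apply: isanD; first exact: isan_cst.
by case: ltnP => _; [exact: pA|exact: isan_cst].
Qed.

Lemma horner_weierstrass D (p : nat -> R) (y : R) :
  ('X^D + \poly_(j < D) p j).[y] = y ^+ D + \sum_(j < D) p j * y ^+ j.
Proof. by rewrite hornerD hornerXn horner_poly. Qed.

(** The linear map sending the [k]-th basis vector to [z] and fixing the others; it preserves the
    first coordinate when [z 0%N = 0]. *)
Definition shear k z y : nat -> R := fun i => (if i == k then 0 else y i) + z i * y k.

Definition unshear k z x : nat -> R :=
  fun i => if i == k then x k / z k else x i - z i * (x k / z k).

Lemma shearK k z x : z k != 0 -> shear k z (unshear k z x) = x.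
Proof.
move=> zk; apply/funext => i; rewrite /shear /unshear eqxx.
by have [->|ik] := eqVneq i k; [field|ring].
Qed.

Lemma tame_shear k (I : Type) (F : I -> (nat -> R) -> R) z (B : R) : (0 < k)%N ->
  z 0%N = 0 -> z k != 0 -> (forall i, `|z i| <= B) ->
  tame k.+1 (fun i y => F i (shear k z y)) -> tame k.+1 F.
Proof.
move=> k0 z0 zk zB [eta [K [e [eta0 K0 e0 H]]]].
have B0 : 0 <= B by exact: le_trans (normr_ge0 (z k)) (zB k).
have zk0 : 0 < `|z k| by rewrite normr_gt0.
(* On the first [k.+1] coordinates, [unshear] enlarges the sup norm by at most this factor. *)
pose A := 1 + (1 + B) / `|z k|.
have A1 : 0 < (1 + B) / `|z k| by rewrite divr_gt0// ltr_wpDr.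
have A0 : 0 < A by rewrite addr_gt0.
have B1 : 0 < 1 + B by rewrite ltr_wpDr.
exists (eta / A), ((1 + B) * K), e; split; rewrite ?divr_gt0 ?mulr_gt0// => x bx x0.
have le : eta / A <= eta by rewrite ler_pdivrMr// ler_peMr ?(ltW eta0)// lerDl ltW.
have up s : 0 < s <= eta / A -> 0 < s <= eta.
  by move=> /andP[-> h]; exact: le_trans le.
have y0 : unshear k z x 0%N = x 0%N.
  by rewrite /unshear ltn_eqF// z0 mul0r subr0.
have yb : box k.+1 (fun=> eta) (unshear k z x).
  have xk : `|x k / z k| <= eta / A / `|z k|.
    by rewrite normrM normfV ler_wpM2r ?invr_ge0//; exact: bx.
  have E : eta = eta / A + eta / A / `|z k| + B * (eta / A / `|z k|).
    by rewrite /A; field; rewrite !gt_eqF// addr_gt0.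
  have q0 : 0 <= eta / A by apply: divr_ge0; exact: ltW.
  have q1 : 0 <= eta / A / `|z k| by apply: divr_ge0 => //; exact: ltW.
  have q2 : 0 <= B * (eta / A / `|z k|) by rewrite mulr_ge0.
  move=> i ik; rewrite /unshear; case: eqP => _; first lra.
  have h1 := bx i ik; have h2 := ler_normB (x i) (z i * (x k / z k)).
  have h3 : `|z i * (x k / z k)| <= B * (eta / A / `|z k|).
    by rewrite normrM; apply: ler_pM.
  lra.
have [|g [gx g0 gc gh gs]] := H _ yb; first by rewrite y0.
rewrite y0 in gx.
exists (fun s => shear k z (g s)); split.
- by rewrite gx shearK.
- by move=> s Js; rewrite /shear ltn_eqF// z0 mul0r addr0 g0//; exact: up.
- move=> i ik.
  have c : cont_on eta (fun s => shear k z (g s) i).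
    apply: contD; last by apply: contM (gc k _) => //; exact: cont_cst.
    by case: eqP => _; [exact: cont_cst|exact: gc].
  apply/cont_onP => u Ju eps eps0.
  have [d d0 Hd] := (cont_onP _ _).1 c u (up u Ju) eps eps0.
  by exists d => // s Js; apply: Hd; exact: up.
- move=> i s s' ik Js Js'; rewrite /shear.
  have hk := gh k s s' (ltnSn k) (up s Js) (up s' Js').
  have hi := gh i s s' ik (up s Js) (up s' Js').
  have m0 : 0 <= K * Num.max s s' `^ e by rewrite mulr_ge0 ?powR_ge0 ?ltW.
  have h : `|z i * (g s k - g s' k)| <= B * (K * Num.max s s' `^ e).
    by rewrite normrM; apply: ler_pM.
  case: eqP => _.
    have -> : 0 + z i * g s k - (0 + z i * g s' k) = z i * (g s k - g s' k) by ring.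
    lra.
  have -> : g s i + z i * g s k - (g s' i + z i * g s' k) =
    (g s i - g s' i) + z i * (g s k - g s' k) by ring.
  have := ler_normD (g s i - g s' i) (z i * (g s k - g s' k)); lra.
- by move=> i s Js; rewrite gs ?shearK//; exact: up.
Qed.

Theorem tame_an k (I : finType) (F : I -> (nat -> R) -> R) (rho : R) : (0 < k)%N ->
  0 < rho -> (forall i, isan k (fun=> rho) (F i)) -> tame k F.
Proof.
elim: k I F rho => // -[|k] IH I F rho _ rho0 FA; first exact: tame_base FA.
set K := k.+1 in IH FA *.
have K0 : (0 < K)%N by [].
have r0 : forall i, (i < K.+1)%N -> 0 < (fun=> rho : R) i by [].
have hf i : exists bf : R * ((nat -> R) -> R), [/\ isan K.+1 (fun=> rho) bf.2,
    forall x, box K.+1 (fun=> rho) x -> 0 < x 0%N ->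
      Num.sg (F i x) = bf.1 * Num.sg (bf.2 x) &
    exists2 z, box K.+1 (fun=> rho) z & z 0%N = 0 /\ bf.2 z != 0].
  by have [b [f' ?]] := factor_first rho0 (FA i); exists (b, f').
have [bf bfP] := choice hf.
(* A vector with first coordinate 0 is sought at which every reduced function is nonzero, and whose
   last coordinate is nonzero (the case [None]), so that the shear is invertible. *)
pose h (o : option I) x := if o is Some i then (bf i).2 (upd x 0 0) else x K.
have hA o : isan K.+1 (fun=> rho) (h o).
  case: o => [i|]; last by exists rho; exact: an_coord.
  have [[M fM] _ _] := bfP i; exists M.
  apply: (an_comp (phi := fun j x => upd x 0 0 j)) fM _ => // j jk.
  rewrite /upd; case: eqP => _; last exact: an_coord.
  by apply: an_weak (an0 _ _); exact: ltW.
have hN o : exists2 x, box K.+1 (fun=> rho) x & h o x != 0.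
  case: o => [i|]; last first.
    by exists (fun=> rho) => [i _|]; rewrite /h ?ger0_norm ?gt_eqF// ltW.
  have [_ _ [z bz [z0 fz]]] := bfP i; exists z => //=.
  by rewrite (_ : upd z 0 0 = z)//; apply/funext => j; rewrite /upd; case: eqP => [->|].
pose q : R := 4^-1.
have q0 : 0 < q by rewrite invr_gt0.
(* The product of all these functions is not identically zero, so by the identity theorem it is
   nonzero somewhere in the box of a quarter of the radius. *)
have [z1 bz1 hz1] : exists2 x, box K.+1 (fun=> q * rho) x &
    \prod_(o <- enum (option I : finType)) h o x != 0.
  apply: contrapT => H.
  have [x bx] := prod_nonzero (enum (option I : finType)) rho0 hA hN.
  have [M PM] := isan_prod (enum (option I : finType)) (P := xpredT) r0 (fun o _ => hA o).
  rewrite (an_identity r0 PM q0) ?eqxx// => y by_.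
  by apply: contrapT => /eqP hy; apply: H; exists y.
have hz o : h o z1 != 0.
  by move: hz1; rewrite prodf_seq_neq0 => /allP/(_ o); rewrite mem_enum; apply.
pose z i := if (i <= K)%N then upd z1 0 0 i else 0.
have z0 : z 0%N = 0 by rewrite /z /= updE.
have zK : z K != 0 by rewrite /z leqnn /upd; exact: (hz None).
have zB i : `|z i| <= q * rho.
  rewrite /z; case: ifP => iK; last by rewrite normr0 mulr_ge0 ?ltW.
  rewrite /upd; case: eqP => _; last exact: bz1.
  by rewrite normr0 mulr_ge0 ?ltW.
apply: (tame_shear K0 z0 zK zB).
(* The last radius is 1 so that the box contains the point 1 of the last axis, which the shear maps
   to [z]; a quarter for [z] and a half for the other variables keep the shear within [rho]. *)
pose r' i : R := if i == K then 1 else rho / 2.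
have r'0 i : 0 < r' i by rewrite /r'; case: eqP => _ //; rewrite divr_gt0.
have GA i : isan K.+1 r' (fun y => (bf i).2 (shear K z y)).
  have [[M fM] _ _] := bfP i; exists M.
  apply: (an_comp (phi := fun j y => shear K z y j)) fM _ => // j jk.
  have zj : an K.+1 r' (q * rho * r' K) (fun y => z j * y K).
    apply: an_mul => //; last exact: an_coord.
    by apply: an_weak (zB j) _; exact: an_cst.
  rewrite /shear; case: eqP => jK.
    apply: an_weak (an_add (an0 _ _) zj).
    by rewrite add0r {1}/r' eqxx mulr1 /q; lra.
  apply: an_weak (an_add (an_coord (fun i _ => r'0 i) jk) zj).
  by rewrite /r' eqxx mulr1; move/eqP/negbTE: jK => ->; rewrite /q; lra.
have hw i : exists w : R * nat * (nat -> (nat -> R) -> R) * R,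
    [/\ 0 < w.1.1.1, forall j, isan K (fun=> w.1.1.1) (w.1.2 j) &
     forall x, box K.+1 (fun=> w.1.1.1) x -> Num.sg ((bf i).2 (shear K z x)) =
       w.2 * Num.sg (x K ^+ w.1.1.2 + \sum_(j < w.1.1.2) w.1.2 j x * x K ^+ j)].
  have [M GM] := GA i.
  have [||w1 [w2 [w3 [w4 ?]]]] := weierstrass_preparation (y0 := 1) (fun j _ => r'0 j) GM.
  - by rewrite normr1 /r' eqxx.
  - have [[M' fM'] _ _] := bfP i.
    have := hz (Some i); rewrite /h (an_local fM' (x := upd z1 0 0) (y := z)).
    + congr ((bf i).2 _ != 0); apply/funext => j.
      by rewrite /shear /upd eqxx mulr1; case: eqP => _; rewrite add0r.
    + move=> j jK; rewrite /upd; case: eqP => _; first by rewrite normr0 ltW.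
      apply: le_trans (bz1 j jK) _; rewrite /q; lra.
    + by move=> j jK; rewrite /z -ltnS jK.
  by exists (w1, w2, w3, w4).
have [w wP] := choice hw.
have [rho1 rho10 rho1P] := @fin_min R I (enum I) (fun i => (w i).1.1.1)
  (fun i _ => let: And3 h _ _ := wP i in h).
pose rho2 := Num.min rho1 (Num.min 1 (rho / 2)).
have rho20 : 0 < rho2 by rewrite !lt_min rho10 ltr01 divr_gt0.
have [le1 [le2 le3]] : rho2 <= rho1 /\ rho2 <= 1 /\ rho2 <= rho / 2.
  by rewrite !ge_min !lexx ?orbT.
have lew i : rho2 <= (w i).1.1.1 by apply: le_trans le1 _; apply: rho1P; rewrite mem_enum.
apply: (@tame_step R K I _ rho2 (fun i x => 'X^((w i).1.1.2) +
    \poly_(j < (w i).1.1.2) (w i).1.2 j x) (fun i => (w i).1.1.2)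
    (fun i => (bf i).1 * (w i).2)) => //.
- by move=> I' F' F'A; apply: IH F'A.
- move=> i; apply: anpoly_weierstrass => j.
  have [_ /(_ j)[M wM] _] := wP i; exists M; apply: an_shrink wM => j' _.
  by rewrite rho20 lew.
move=> i x bx x0.
have [_ sF _] := bfP i; have [_ _ sw] := wP i.
have E : shear K z x 0%N = x 0%N by rewrite /shear z0 mul0r addr0.
rewrite sF ?E//; last first.
  move=> j jK; rewrite /shear.
  have h1 : `|z j * x K| <= q * rho * 1.
    rewrite normrM; apply: ler_pM => //; apply: le_trans (bx K (ltnSn K)) le2.
  case: eqP => _; first by rewrite add0r; move: h1; rewrite /q; lra.
  have h2 := le_trans (bx j jK) le3.
  have := ler_normD (x j) (z j * x K); move: h1; rewrite /q; lra.
rewrite sw ?mulrA; last by move=> j jK; exact: le_trans (bx j jK) (lew i).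
by rewrite horner_weierstrass.
Qed.

End TameTheorem.

(** * Euclidean norm and directions *)

Section Euclid.
Variable R : realType.
Implicit Types (e r : R).

Lemma enorm_ge0 n (x : 'rV[R]_n) : 0 <= enorm x.
Proof. exact: sqrtr_ge0. Qed.

Lemma sqr_enorm n (x : 'rV[R]_n) : enorm x ^+ 2 = \sum_(i < n) x ord0 i ^+ 2.
Proof. by rewrite sqr_sqrtr// sumr_ge0// => i _; exact: sqr_ge0. Qed.

Lemma enorm_coord n (x : 'rV[R]_n) i : `|x ord0 i| <= enorm x.
Proof.
rewrite -sqrtr_sqr ler_sqrt; last by apply: sumr_ge0 => j _; exact: sqr_ge0.
by rewrite (bigD1 i)//= lerDl sumr_ge0// => j _; exact: sqr_ge0.
Qed.

Lemma enorm_lt n (x : 'rV[R]_n) r : 0 < r ->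
  (forall i, `|x ord0 i| <= r / n.+1%:R) -> enorm x < r.
Proof.
move=> r0 H; rewrite -(ger0_norm (ltW r0)) -sqrtr_sqr ltr_sqrt ?exprn_gt0//.
have n0 : (0 : R) < n.+1%:R by rewrite ltr0n.
apply: (@le_lt_trans _ _ (\sum_(i < n) (r / n.+1%:R) ^+ 2)).
  by apply: ler_sum => i _; rewrite -real_normK ?num_real// lerXn2r ?nnegrE ?divr_ge0// ltW.
have E : (r / n.+1%:R) ^+ 2 *+ n = r ^+ 2 * (n%:R / n.+1%:R ^+ 2).
  by rewrite -[LHS]mulr_natr; field; rewrite gt_eqF.
rewrite sumr_const card_ord E gtr_pMr ?exprn_gt0// ltr_pdivrMr ?exprn_gt0// mul1r.
by rewrite -natrX ltr_nat (leq_trans (ltnSn n))// leq_pmulr.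
Qed.

Lemma enorm0 n : enorm (0 : 'rV[R]_n) = 0.
Proof. by rewrite /enorm big1 ?sqrtr0// => i _; rewrite mxE expr0n. Qed.

Lemma enorm_eq0 n (x : 'rV[R]_n) : (enorm x == 0) = (x == 0).
Proof.
apply/eqP/eqP => [x0|->]; last exact: enorm0.
apply/rowP => i; rewrite mxE; apply/eqP; rewrite -normr_le0 -x0.
exact: enorm_coord.
Qed.

Lemma enorm_gt0 n (x : 'rV[R]_n) : (0 < enorm x) = (x != 0).
Proof. by rewrite lt_neqAle eq_sym enorm_eq0 enorm_ge0 andbT. Qed.

Lemma enormZ n (c : R) (x : 'rV[R]_n) : enorm (c *: x) = `|c| * enorm x.
Proof.
rewrite /enorm -sqrtr_sqr -sqrtrM ?sqr_ge0// mulr_sumr; congr Num.sqrt.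
by apply: eq_bigr => i _; rewrite mxE exprMn.
Qed.

Lemma enormN n (x : 'rV[R]_n) : enorm (- x) = enorm x.
Proof. by rewrite -scaleN1r enormZ normrN1 mul1r. Qed.

Lemma enormC n (x y : 'rV[R]_n) : enorm (x - y) = enorm (y - x).
Proof. by rewrite -enormN opprB. Qed.

Lemma enormD n (x y : 'rV[R]_n) : enorm (x + y) <= enorm x + enorm y.
Proof.
have [->|x0] := eqVneq x 0; first by rewrite add0r enorm0 add0r.
have [->|y0] := eqVneq y 0; first by rewrite addr0 enorm0 addr0.
move: x0 y0; rewrite -!enorm_gt0 => x0 y0.
rewrite -(@ler_pXn2r _ 2)// ?nnegrE ?addr_ge0 ?enorm_ge0// sqr_enorm.
have h : \sum_(i < n) (x ord0 i * y ord0 i) *+ 2 <= (enorm x * enorm y) *+ 2.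
  have -> : (enorm x * enorm y) *+ 2 = \sum_(i < n)
     (enorm y / enorm x * x ord0 i ^+ 2 + enorm x / enorm y * y ord0 i ^+ 2).
    by rewrite big_split /= -!mulr_sumr -!sqr_enorm; field; rewrite !gt_eqF.
  apply: ler_sum => i _.
  set p := enorm x in x0 *; set q := enorm y in y0 *.
  rewrite -subr_ge0 (_ : _ - _ = (q * x ord0 i - p * y ord0 i) ^+ 2 / (p * q)); last first.
    by field; rewrite !gt_eqF.
  by rewrite divr_ge0 ?sqr_ge0 ?mulr_ge0 ?ltW.
rewrite sqrrD !sqr_enorm; under eq_bigr do rewrite mxE sqrrD.
move: h; rewrite !big_split /= => h; rewrite lerD2r lerD2l.
exact: h.
Qed.

Lemma enorm_dist n (x y : 'rV[R]_n) : `|enorm x - enorm y| <= enorm (x - y).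
Proof.
have h1 := enormD (x - y) y; have h2 := enormD (y - x) x.
rewrite !subrK in h1 h2; rewrite (enormC y) in h2.
by rewrite ler_norml; lra.
Qed.

Lemma unit_dist n (x y : 'rV[R]_n) : x != 0 -> y != 0 ->
  enorm ((enorm x)^-1 *: x - (enorm y)^-1 *: y) <= 2 * enorm (x - y) / enorm x.
Proof.
move=> x0 y0; have ex : 0 < enorm x by rewrite enorm_gt0.
have ey : 0 < enorm y by rewrite enorm_gt0.
have -> : (enorm x)^-1 *: x - (enorm y)^-1 *: y =
   (enorm x)^-1 *: (x - y) + ((enorm x)^-1 - (enorm y)^-1) *: y.
  by rewrite scalerBr scalerBl addrA subrK.
rewrite (le_trans (enormD _ _))// !enormZ gtr0_norm ?invr_gt0//.
have -> : (enorm x)^-1 - (enorm y)^-1 = (enorm y - enorm x) / (enorm x * enorm y).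
  by field; rewrite !gt_eqF.
rewrite normrM (@gtr0_norm _ (_ * _)^-1) ?invr_gt0 ?mulr_gt0//.
have -> : `|enorm y - enorm x| / (enorm x * enorm y) * enorm y = `|enorm y - enorm x| / enorm x.
  by field; rewrite !gt_eqF.
rewrite mulrC -mulrDl ler_pM2r ?invr_gt0// mulr_natl mulr2n lerD2l distrC.
exact: enorm_dist.
Qed.

Lemma nbhs_enorm n (a : 'rV[R]_n) (V : set 'rV[R]_n) :
  nbhs a V <-> exists2 e, 0 < e & forall x, enorm (x - a) < e -> V x.
Proof.
split=> [/nbhs_ballP[e /= e0 aV]|[e e0 H]].
  exists e => // x xa; apply: aV; split=> // i j.
  rewrite ord1 /ball /= -opprB normrN.
  by apply: le_lt_trans xa; have := enorm_coord (x - a) j; rewrite !mxE.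
apply/nbhs_ballP; exists (e / n.+1%:R) => /=; first by rewrite divr_gt0// ltr0n.
move=> x [_ ax]; apply: H; apply: enorm_lt => // i.
by have := ax ord0 i; rewrite /ball /= -opprB normrN !mxE => /ltW.
Qed.

Lemma cvg_enorm n (x : nat -> 'rV[R]_n) (l : 'rV[R]_n) :
  x @ \oo --> l <-> forall e, 0 < e ->
    exists N, forall i, (N <= i)%N -> enorm (x i - l) < e.
Proof.
split=> [xl e e0|H V /nbhs_enorm[e e0 eV]].
  have : nbhs l [set y | enorm (y - l) < e] by apply/nbhs_enorm; exists e.
  by move=> /xl[N _ HN]; exists N => i; exact: HN.
by have [N HN] := H e e0; exists N => // i /HN/eV.
Qed.

(** Sequences are traded for approximations at each scale; [enorm a = 1] follows because [a] is a
    limit of unit vectors. *)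
Lemma direction_setP n (A : set 'rV[R]_n) a : direction_set A a <->
  forall e, 0 < e -> exists x, [/\ A x, x != 0, enorm x < e &
    enorm ((enorm x)^-1 *: x - a) < e].
Proof.
split=> [[a1 [x [xA [/cvg_enorm x0 /cvg_enorm xa]]]] e e0|H].
  have [N HN] := x0 e e0; have [N' HN'] := xa e e0.
  exists (x (maxn N N')); have [? ?] := xA (maxn N N'); split=> //.
    by have := HN _ (leq_maxl N N'); rewrite subr0.
  exact: HN' (leq_maxr N N').
have inv0 i : (0 : R) < i.+1%:R^-1 by rewrite invr_gt0 ltr0n.
have [x xP] := choice (fun i => H i.+1%:R^-1 (inv0 i)).
have small e : 0 < e -> exists N, forall i, (N <= i)%N -> (i.+1%:R^-1 : R) < e.
  move=> e0; exists (Num.truncn e^-1) => i Ni.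
  rewrite -[e]invrK ltf_pV2 ?posrE ?invr_gt0 ?ltr0n//.
  by apply: lt_le_trans (truncnS_gt _) _; rewrite ler_nat.
have xa : forall e, 0 < e -> exists N, forall i, (N <= i)%N ->
    enorm ((enorm (x i))^-1 *: x i - a) < e.
  move=> e e0; have [N HN] := small e e0; exists N => i Ni.
  have [_ _ _ h] := xP i; exact: lt_trans h (HN i Ni).
split.
  apply/eqP; rewrite -subr_eq0 -normr_le0; apply/ler_addgt0Pr => e e0.
  have [N HN] := xa e e0; have := HN N (leqnn N).
  have [_ xn0 _ _] := xP N.
  have {1}-> : 1 = enorm ((enorm (x N))^-1 *: x N).
    by rewrite enormZ gtr0_norm ?invr_gt0 ?enorm_gt0// mulVf// enorm_eq0.
  by move=> h; rewrite add0r (le_trans (enorm_dist _ _))// enormC ltW.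
exists x; split; first by move=> i; have [] := xP i.
split; last exact/cvg_enorm.
apply/cvg_enorm => e e0; have [N HN] := small e e0; exists N => i Ni.
by have [_ _ h _] := xP i; rewrite subr0; exact: lt_trans h (HN i Ni).
Qed.

Lemma bolzano n (u : nat -> 'rV[R]_n) (M : R) : (forall i, enorm (u i) <= M) ->
  exists a, forall e N, 0 < e -> exists2 i, (N <= i)%N & enorm (u i - a) < e.
Proof.
move=> uM.
have cA : compact [set v : 'rV[R]_n | forall i, `[- M, M]%classic (v ord0 i)].
  by apply: (@rV_compact _ _ (fun=> `[- M, M]%classic)) => i; exact: segment_compact.
have [|a [_ ca]] := cA (u @ \oo) _.
  exists 0%N => // i _ j /=; rewrite in_itv /= -ler_norml.
  exact: le_trans (enorm_coord _ _) (uM i).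
exists a => e N e0.
have [||y [[i /= Ni <-] ya]] := ca [set u i | i in [set i | (N <= i)%N]]
    [set y | enorm (y - a) < e].
- by exists N => // i Ni; exists i.
- by apply/nbhs_enorm; exists e.
- by exists i.
Qed.

End Euclid.

(** * Sections of subanalytic germs *)

Section Conversion.
Variable R : realType.
Implicit Types (x : nat -> R) (f : (nat -> R) -> R).

Definition vec k x : 'rV[R]_k := \row_(i < k) x i.

Lemma an_sum_seq (I : Type) (s : seq I) (P : pred I) k r (M : I -> R) (F : I -> (nat -> R) -> R) :
  (forall i, P i -> an k r (M i) (F i)) ->
  an k r (\sum_(i <- s | P i) M i) (fun x => \sum_(i <- s | P i) F i x).
Proof.
move=> H; elim: s => [|i s IH].
  by rewrite big_nil; apply: an_ext (an0 _ _) => x _; rewrite big_nil.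
rewrite big_cons; case Pi : (P i); last by apply: an_ext IH => x _; rewrite big_cons Pi.
by apply: an_ext (an_add (H i Pi) IH) => x _; rewrite big_cons Pi.
Qed.

Lemma an_prod_seq (I : Type) (s : seq I) k r (M : I -> R) (F : I -> (nat -> R) -> R) :
  (forall i, (i < k)%N -> 0 < r i) -> (forall i, an k r (M i) (F i)) ->
  an k r (\prod_(i <- s) M i) (fun x => \prod_(i <- s) F i x).
Proof.
move=> r0 H; elim: s => [|i s IH].
  rewrite big_nil; apply: an_weak (an_ext _ (an_cst _ _ 1)); rewrite ?normr1// => x _.
  by rewrite big_nil.
by rewrite big_cons; apply: an_ext (an_mul r0 (H i) IH) => x _; rewrite big_cons.
Qed.

Lemma cube_widen k N (G : ('I_k -> nat) -> R) :
  \sum_(al : {ffun 'I_k -> 'I_N.+1}) G (fun i => al i) =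
  \sum_(al : {ffun 'I_k -> 'I_N.+2} | [forall i, (al i <= N)%N]) G (fun i => al i).
Proof.
pose w (al : {ffun 'I_k -> 'I_N.+1}) : {ffun 'I_k -> 'I_N.+2} :=
  [ffun i => widen_ord (leqnSn _) (al i)].
pose v (be : {ffun 'I_k -> 'I_N.+2}) : {ffun 'I_k -> 'I_N.+1} := [ffun i => inord (be i)].
rewrite (reindex_onto w v)/=; last first.
  move=> be /forallP H; apply/ffunP => i; rewrite !ffunE; apply: val_inj => /=.
  by rewrite inordK// ltnS; exact: H.
apply: eq_big => [al|al _]; last first.
  by congr G; apply/funext => i; rewrite ffunE.
apply/esym/andP; split; first by apply/forallP => i; rewrite ffunE /= -ltnS.
by apply/eqP/ffunP => i; rewrite !ffunE; apply: val_inj; rewrite /= inordK.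
Qed.

(** Partial sums over cubes of multi-indices become a series of polynomials, one for each shell [T]
    between successive cubes, and [an_series] applies; the absolute sum at the corner of the box
    bounds the norms. *)
Lemma psum_isan k (c : ('I_k -> nat) -> R) (a : 'rV[R]_k) (rho M : R) f : 0 < rho ->
  (forall N, pabssum c a (a + vec k (fun=> rho)) N <= M) ->
  (forall x, box k (fun=> rho) x -> psum c a (a + vec k x) N @[N --> \oo] --> f x) ->
  an k (fun=> rho) M f.
Proof.
move=> rho0 abs lim.
have r0 : forall i, (i < k)%N -> 0 < (fun=> rho : R) i by [].
pose mon (al : 'I_k -> nat) x := c al * \prod_(i < k) x i ^+ al i.
pose nrm (al : 'I_k -> nat) := `|c al| * \prod_(i < k) rho ^+ al i.
have monA al : an k (fun=> rho) (nrm al) (mon al).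
  apply: an_scale => //.
  apply: (@an_prod_seq _ _ k _ (fun i : 'I_k => rho ^+ al i)
    (fun (i : 'I_k) x => x i ^+ al i)) => // i.
  by apply: an_exp => //; exact: an_coord.
pose S (G : ('I_k -> nat) -> R) N := \sum_(al : {ffun 'I_k -> 'I_N.+1}) G (fun i => al i).
have psE x N : psum c a (a + vec k x) N = S (mon ^~ x) N.
  apply: eq_bigr => al _; congr (_ * _); apply: eq_bigr => i _.
  by rewrite !mxE addrAC subrr add0r.
have paE N : pabssum c a (a + vec k (fun=> rho)) N = S nrm N.
  apply: eq_bigr => al _; congr (_ * _); apply: eq_bigr => i _.
  by rewrite !mxE addrAC subrr add0r gtr0_norm.
pose T (G : ('I_k -> nat) -> R) N :=
  if N is N'.+1 then \sum_(al : {ffun 'I_k -> 'I_N'.+2} | ~~ [forall i, (al i <= N')%N]) G (fun i => al i)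
  else S G 0%N.
have ST G N : S G N = \sum_(j < N.+1) T G j.
  elim: N => [|N IH]; first by rewrite big_ord1.
  rewrite big_ord_recr -IH /= {1}/S (bigID (fun al : {ffun 'I_k -> 'I_N.+2} => [forall i, (al i <= N)%N]))/=.
  by rewrite -cube_widen.
have TA N : an k (fun=> rho) (T nrm N) (fun x => T (mon ^~ x) N).
  by case: N => [|N]; exact: an_sum_seq.
apply: (an_series r0 TA) => [[|n]|x bx].
- rewrite big_ord0; have := abs 0%N; apply: le_trans.
  by rewrite paE; apply: sumr_ge0 => al _; rewrite mulr_ge0// prodr_ge0// => i _; rewrite exprn_ge0// ltW.
- by rewrite -ST -paE.
have := lim x bx.
rewrite (_ : psum c a (a + vec k x) = S (mon ^~ x)); last first.
  by apply/funext => N; rewrite psE.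
rewrite (_ : S (mon ^~ x) = fun N => \sum_(j < N.+1) T (mon ^~ x) j); last first.
  by apply/funext => N; rewrite ST.
move=> h; apply/sumsP => e e0.
have /cvgrPdist_lt/(_ e e0)[N _ HN] := h.
exists N.+1 => -[//|n Nn]; rewrite distrC; exact: HN.
Qed.

Lemma enorm_vec_lt k (r : R) : 0 < r -> exists2 rho, 0 < rho &
  forall x, box k (fun=> rho) x -> enorm (vec k x) < r.
Proof.
move=> r0; exists (r / k.+1%:R); first by rewrite divr_gt0// ltr0n.
by move=> x bx; apply: enorm_lt => // i; rewrite mxE; exact: bx.
Qed.

Lemma isan_radius k (rho rho' : R) f : 0 < rho' <= rho ->
  isan k (fun=> rho) f -> isan k (fun=> rho') f.
Proof. by move=> H [M fM]; exists M; apply: an_shrink fM. Qed.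

Lemma analytic_isan k (U : set 'rV[R]_k) (f : 'rV[R]_k -> R) a :
  open U -> U a -> analytic_on U f ->
  exists2 rho, 0 < rho & isan k (fun=> rho) (fun x => f (a + vec k x)).
Proof.
move=> oU Ua /(_ a Ua)[r [c [r0 H]]].
have /nbhs_enorm[e e0 eU] : nbhs a U by exact: open_nbhs_nbhs.
have re0 : 0 < Num.min r e by rewrite lt_min r0.
have [rho rho0 hrho] := enorm_vec_lt k re0.
have hx x : box k (fun=> rho) x -> U (a + vec k x) /\ enorm (a + vec k x - a) < r.
  move=> /hrho; rewrite lt_min [a + _]addrC addrK => /andP[h1 h2]; split=> //.
  by apply: eU; rewrite addrK.
have [|U1 r1] := hx (fun=> rho); first by move=> i _; rewrite ger0_norm// ltW.
have [[M HM] _] := H _ U1 r1.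
exists rho => //; exists M; apply: (psum_isan (c := c)) => // x /hx[Ux rx].
by have [_] := H _ Ux rx.
Qed.

End Conversion.

(** * Paths through the points of a subanalytic germ *)

Section Sections.
Variable R : realType.

(* Polar coordinates in the first [n] variables: [u] is a direction followed by
   the remaining variables. *)
Definition blow n m (t : R) (u : 'rV[R]_(n + m)) : 'rV[R]_(n + m) :=
  row_mx (t *: lsubmx u) (rsubmx u).

Definition entry k (a : 'rV[R]_k) (i : nat) : R :=
  if insub i is Some j then a ord0 j else 0.

Lemma entryE k (a : 'rV[R]_k) (i : 'I_k) : entry a i = a ord0 i.
Proof. by rewrite /entry valK. Qed.

Lemma entry_bound k (a : 'rV[R]_k) i : `|entry a i| <= enorm a.
Proof.
rewrite /entry; case: insubP => [j _ _|_]; first exact: enorm_coord.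
by rewrite normr0 enorm_ge0.
Qed.

Lemma blowE n m t (u : 'rV[R]_(n + m)) i :
  blow t u ord0 i = if (i < n)%N then t * u ord0 i else u ord0 i.
Proof.
by case: (split_ordP i) => j ->; rewrite ?row_mxEl ?row_mxEr !mxE.
Qed.

(** In the coordinates t and u - [a0] the functions describing [Z] near [blow 0 a0] stay analytic,
    so [tame_an] applies although [blow] degenerates at t = 0. *)
Lemma local_sections n m (Z : set 'rV[R]_(n + m)) (a0 : 'rV[R]_(n + m)) :
  semianalytic Z -> exists eta K e : R, [/\ 0 < eta, 0 < K, 0 < e &
    forall u t s, enorm (lsubmx u) = 1 -> (forall i, `|u ord0 i - a0 ord0 i| <= eta) ->
      0 < t <= eta -> 0 < s <= eta -> Z (blow t u) ->
      exists u', [/\ enorm (lsubmx u') = 1, Z (blow s u') &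
        forall i, `|u ord0 i - u' ord0 i| <= K * Num.max t s `^ e]].
Proof.
move=> /(_ (blow 0 a0))[U [oU [Ua [q [p [f [g [fA [gA ZU]]]]]]]]].
set N := (n + m)%N in Z a0 U Ua oU f g fA gA ZU *.
set a := blow 0 a0 in Ua ZU.
pose A i := entry a0 i.
(* The displacement of the blown-up point from [a]. Index 0 of [x] holds t, which shifts the other
   variables by one. *)
pose Phi i (x : nat -> R) := if (i < n)%N then x 0%N * (A i + x i.+1) else x i.+1.
pose toU (x : nat -> R) : 'rV[R]_N := \row_(i < N) (A i + x i.+1).
have blowU x : blow (x 0%N) (toU x) = a + vec N (Phi ^~ x).
  apply/rowP => i; rewrite blowE [RHS]mxE blowE !mxE /Phi /A entryE.
  by case: ifP => _; [rewrite mul0r add0r|].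
pose hfun (w : 'I_q + 'I_q * 'I_p) : 'rV[R]_N -> R :=
  match w with inl j => f j | inr jl => g jl.1 jl.2 end.
have hw w : exists rho, 0 < rho /\ isan N (fun=> rho) (fun x => hfun w (a + vec N x)).
  have [|rho] := @analytic_isan R N U (hfun w) a oU Ua; last by exists rho.
  by case: w => [j|[j l]]; [exact: fA|exact: gA].
have [rw rwP] := choice hw.
have [rho1 rho10 rho1P] := @fin_min R _ (enum (('I_q + 'I_q * 'I_p)%type : finType)) rw (fun i _ => (rwP i).1).
have /nbhs_enorm[eU eU0 eUP] : nbhs a U by exact: open_nbhs_nbhs.
have [rho2 rho20 rho2P] := enorm_vec_lt N eU0.
pose rho := Num.min rho1 rho2.
have rho0 : 0 < rho by rewrite lt_min rho10.
have hA w : isan N (fun=> rho) (fun x => hfun w (a + vec N x)).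
  apply: isan_radius (rwP w).2; rewrite rho0 /=.
  by apply: (@le_trans _ _ rho1); [rewrite ge_min lexx|apply: rho1P; rewrite mem_enum].
pose B := enorm a0 + 1.
have B1 : 1 <= B by rewrite lerDr enorm_ge0.
have B0 : 0 < B by exact: lt_le_trans B1.
pose rho' := Num.min 1 (rho / B).
have rho'0 : 0 < rho' by rewrite lt_min ltr01 divr_gt0.
have rho'1 : rho' <= 1 by rewrite ge_min lexx.
have rho'B : rho' * B <= rho by rewrite -ler_pdivlMr// ge_min lexx orbT.
have r0 : forall i, (i < N.+1)%N -> 0 < (fun=> rho' : R) i by [].
have linA i : (i < N)%N -> an N.+1 (fun=> rho') B (fun x => A i + x i.+1).
  move=> iN; apply: an_weak (an_add (an_cst _ _ (A i)) (an_coord r0 (i := i.+1) iN)).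
  by apply: lerD => //; exact: entry_bound.
have PhiA i : (i < N)%N -> an N.+1 (fun=> rho') rho (Phi i).
  move=> iN; rewrite /Phi; case iin : (i < n)%N.
    by apply: an_weak (an_mul r0 (an_coord r0 (i := 0%N) isT) (linA i iN)).
  apply: an_weak (an_coord r0 (i := i.+1) iN).
  by apply: le_trans rho'B; rewrite ler_peMr// ltW.
have inU x : box N.+1 (fun=> rho') x -> U (a + vec N (Phi ^~ x)).
  move=> bx; apply: eUP; rewrite [a + _]addrC addrK; apply: rho2P => i iN.
  apply: le_trans (an_bound (PhiA i iN) bx) _.
  by rewrite ge_min lexx orbT.
(* The case [None] is the squared length of the direction minus 1: preserving its zero keeps the
   path on the unit sphere. *)
pose F (w : option ('I_q + 'I_q * 'I_p)%type) (x : nat -> R) :=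
  if w is Some w' then hfun w' (a + vec N (Phi ^~ x))
  else \sum_(i < n) (A i + x i.+1) ^+ 2 + -1.
have FA w : isan N.+1 (fun=> rho') (F w).
  case: w => [w|].
    by have [M hM] := hA w; exists M; exact: (an_comp (phi := Phi) r0 (fun _ _ => rho0) hM PhiA).
  apply: isanD; last exact: isan_cst.
  apply: isan_sum => i _; exists (B ^+ 2); apply: an_exp => //; apply: linA.
  exact: leq_trans (ltn_ord i) (leq_addr _ _).
have [[K e] /= [K0 e0] near] := tame_near (ltn0Sn N) (tame_an (ltn0Sn N) rho'0 FA).
have [eta eta0 nearP] := near rho' rho'0.
exists eta, K, e; split=> // u t s u1 ua Jt Js Zu.
have t0 : 0 < t by case/andP: Jt.
pose x (i : nat) : R := if i is j.+1 then entry u j - entry a0 j else t.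
have bx : box N.+1 (fun=> eta) x.
  case=> [|i] iN; first by rewrite /= gtr0_norm//; case/andP: Jt.
  have := ua (Ordinal (iN : (i < N)%N)); rewrite /x.
  by rewrite -!entryE.
have toUx : toU x = u.
  by apply/rowP => i; rewrite !mxE /x /A addrC subrK entryE.
have [|gam [gx gs _ gh gsg]] := nearP eta _ x bx t0; first by rewrite eta0 lexx.
have [gs0 bgs] := gs s Js; have [gt0 bgt] := gs t Jt.
have sg_None y : enorm (lsubmx (toU y)) = 1 <-> F None y = 0.
  have E : enorm (lsubmx (toU y)) ^+ 2 = \sum_(i < n) (A i + y i.+1) ^+ 2.
    by rewrite sqr_enorm; apply: eq_bigr => i _; rewrite !mxE.
  rewrite /F -E; split=> [->|/eqP]; first by rewrite expr1n subrr.
  by rewrite subr_eq0 sqrp_eq1 ?enorm_ge0// => /eqP.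
have ZP y : box N.+1 (fun=> rho') y -> Z (blow (y 0%N) (toU y)) <->
    exists j, F (Some (inl j)) y = 0 /\ forall l, 0 < F (Some (inr (j, l))) y.
  move=> by_; have Uy := inU y by_; rewrite blowU.
  split=> [Zy|H].
    have : (Z `&` U) (a + vec N (Phi ^~ y)) by split.
    by rewrite ZU => -[_].
  suff : (Z `&` U) (a + vec N (Phi ^~ y)) by case.
  by rewrite ZU; split.
have xt : x 0%N = t by [].
rewrite xt in gx.
exists (toU (gam s)); split.
- apply/sg_None/eqP; rewrite -sgr_eq0 gsg// sgr_eq0; apply/eqP/sg_None.
  by rewrite toUx.
- rewrite -{1}gs0; apply/ZP => //.
  have : Z (blow (x 0%N) (toU x)) by rewrite toUx.
  rewrite gx in bgt; move=> /(ZP x bgt)[j [fj gj]].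
  exists j; split; first by apply/eqP; rewrite -sgr_eq0 gsg// sgr_eq0 fj.
  by move=> l; rewrite -sgr_gt0 gsg// sgr_gt0.
- move=> i; have := gh i.+1 t s (ltn_ord i) Jt Js; rewrite gx => h.
  have {1}-> : u ord0 i = A i + x i.+1 by rewrite -toUx mxE.
  by rewrite mxE [A i + _ - _](_ : _ = x i.+1 - gam s i.+1) //; ring.
Qed.

(** Compactness by contradiction: if radius and exponent of order 1/(N+1) and constant N+1 fail for
    every N, the polar coordinates of the failing points accumulate at some [a0], where
    [local_sections] gives constants that contradict a late failure. *)
Lemma subanalytic_sections n (S : set 'rV[R]_n) : subanalytic_germ0 S ->
  exists del K e : R, [/\ 0 < del, 0 < K, 0 < e &
    forall x s, S x -> 0 < enorm x <= del -> 0 < s <= del ->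
      exists y, [/\ S y, enorm y = s &
        enorm ((enorm x)^-1 *: x - s^-1 *: y) <= K * Num.max (enorm x) s `^ e]].
Proof.
move=> [W [oW [W0 [m [Z [Zs [[M ZM] SW]]]]]]].
have /nbhs_enorm[dW dW0 dWP] : nbhs (0 : 'rV[R]_n) W by exact: open_nbhs_nbhs.
apply: contrapT => H.
pose inv (N : nat) : R := N.+1%:R^-1.
have inv0 N : 0 < inv N by rewrite invr_gt0 ltr0n.
pose del N := Num.min (dW / 2) (inv N).
have del0 N : 0 < del N by rewrite lt_min divr_gt0 ?inv0.
have hN N : exists xs : 'rV[R]_n * R, [/\ S xs.1, 0 < enorm xs.1 <= del N,
    0 < xs.2 <= del N & forall y, S y -> enorm y = xs.2 ->
      N.+1%:R * Num.max (enorm xs.1) xs.2 `^ inv N <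
      enorm ((enorm xs.1)^-1 *: xs.1 - xs.2^-1 *: y)].
  apply: contrapT => H'; apply: H; exists (del N), N.+1%:R, (inv N); split=> //.
  move=> x s Sx x0 s0; apply: contrapT => H2; apply: H'; exists (x, s); split=> // y Sy ys.
  by rewrite ltNge; apply/negP => le; apply: H2; exists y.
have [xs xsP] := choice hN.
pose x N := (xs N).1; pose s N := (xs N).2.
have xW N : W (x N).
  have [_ /andP[_ h] _ _] := xsP N; apply: dWP; rewrite subr0 (le_lt_trans h)//.
  by rewrite (@le_lt_trans _ _ (dW / 2)) ?ge_min ?lexx//; lra.
have hz N : exists z, Z z /\ lsubmx z = x N.
  have : (S `&` W) (x N) by split => //; have [] := xsP N.
  by rewrite SW => -[z Zz zx]; exists z.
have [z zP] := choice hz.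
(* Polar coordinates of a lift of [x N]; they are bounded, as directions are unit vectors and the
   hidden variables are bounded on [Z]. *)
pose u N : 'rV[R]_(n + m) := row_mx ((enorm (x N))^-1 *: x N) (rsubmx (z N)).
have lu N : lsubmx (u N) = (enorm (x N))^-1 *: x N by rewrite row_mxKl.
have u1 N : enorm (lsubmx (u N)) = 1.
  have [_ /andP[h _] _ _] := xsP N.
  by rewrite lu enormZ gtr0_norm ?invr_gt0// mulVf ?gt_eqF.
have blu N : blow (enorm (x N)) (u N) = z N.
  have [_ /andP[h _] _ _] := xsP N; have [_ zx] := zP N.
  by rewrite /blow lu row_mxKr scalerA mulfV ?gt_eqF// scale1r -zx hsubmxK.
have uM N : enorm (u N) <= (1 + `|M|) * (n + m).+1%:R.
  apply/ltW/enorm_lt; first by rewrite mulr_gt0 ?ltr0n// ltr_wpDr.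
  move=> i; rewrite mulfK ?pnatr_eq0//.
  case: (split_ordP i) => j ->.
    rewrite row_mxEl; apply: (@le_trans _ _ 1); last by rewrite lerDl.
    by rewrite -(u1 N) lu; exact: enorm_coord.
  rewrite row_mxEr mxE; have [Zz _] := zP N.
  rewrite (le_trans (enorm_coord _ _))// (le_trans (ZM _ Zz))//.
  by rewrite (le_trans (ler_norm M))// lerDr.
have [a0 a0P] := bolzano uM.
have [eta [K [e [eta0 K0 e0 loc]]]] := local_sections a0 Zs.
have bound : exists N0 : nat, forall N, (N0 <= N)%N ->
    [/\ inv N <= eta, inv N <= e & K * n.+1%:R <= N.+1%:R].
  exists (maxn (Num.truncn eta^-1) (maxn (Num.truncn e^-1) (Num.truncn (K * n.+1%:R)))).
  move=> N; rewrite !geq_max => /andP[h1 /andP[h2 h3]].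
  have up (r : R) : (Num.truncn r <= N)%N -> r <= N.+1%:R.
    by move=> h; apply/ltW/(lt_le_trans (truncnS_gt _)); rewrite ler_nat.
  split; [| |exact: up].
    by rewrite -[leRHS]invrK lef_pV2 ?posrE ?invr_gt0 ?ltr0n//; exact: up.
  by rewrite -[leRHS]invrK lef_pV2 ?posrE ?invr_gt0 ?ltr0n//; exact: up.
have [N0 N0P] := bound.
have [N NN uN] := a0P eta N0 eta0.
have [le1 le2 le3] := N0P N NN.
have [Sx Jx Js far] := xsP N.
have dle : del N <= inv N by rewrite ge_min lexx orbT.
have d1 : inv N <= 1 by rewrite invf_le1 ?ltr0n// ler1n.
have up t : 0 < t <= del N -> 0 < t <= eta.
  by move=> /andP[-> h]; rewrite (le_trans h)// (le_trans dle).
have [||u' [u'1 Zu' uu']] := loc (u N) (enorm (x N)) (s N) (u1 N) _ (up _ Jx) (up _ Js) _.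
- move=> i; have := enorm_coord (u N - a0) i; rewrite !mxE => h.
  exact/ltW/(le_lt_trans h).
- by rewrite blu; have [] := zP N.
have s0 : 0 < s N by case/andP: Js.
have Sy : S (s N *: lsubmx u').
  suff : (S `&` W) (s N *: lsubmx u') by case.
  by rewrite SW; exists (blow (s N) u') => //; rewrite row_mxKl.
have ey : enorm (s N *: lsubmx u') = s N by rewrite enormZ u'1 mulr1 gtr0_norm.
have := far _ Sy ey; rewrite ltNge => /negP; apply.
rewrite -/(x N) -/(s N) -lu scalerA mulVf ?gt_eqF// scale1r.
have /andP[m0 m1] := max_half Jx Js; set mx := Num.max _ _ in m0 m1 *.
apply: (@le_trans _ _ (K * mx `^ e * n.+1%:R)).
  apply/ltW/enorm_lt => [|i]; first by rewrite !mulr_gt0 ?powR_gt0.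
  rewrite mulfK ?pnatr_eq0//; have := uu' (lshift m i).
  by rewrite !mxE.
rewrite mulrAC; apply: ler_pM; rewrite ?powR_ge0 ?mulr_ge0 ?(ltW K0)//.
(* The larger parameter is at most 1, so the smaller exponent [inv N] gives the larger power. *)
apply: ger_powR => //.
by rewrite m0 (le_trans m1)// (le_trans dle).
Qed.

End Sections.

(** * Tangle neighbourhoods and directions *)

Section Tangles.
Variable R : realType.
(* [mathcomp.analysis] also has an [edist]. *)
Local Notation edist := Pilot.Defs.edist.

Lemma edist_le n (x b : 'rV[R]_n) (B : set 'rV[R]_n) : B b -> edist x B <= enorm (x - b).
Proof.
move=> Bb; apply: ge_inf; last by exists b.
by exists 0 => _ [c _ <-]; exact: enorm_ge0.
Qed.

Lemma edist_adherent n (x : 'rV[R]_n) (B : set 'rV[R]_n) e : B !=set0 -> 0 < e ->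
  exists2 b, B b & enorm (x - b) < edist x B + e.
Proof.
move=> [b0 Bb0] e0.
have [|_ [b Bb <-] h] := @inf_adherent R [set enorm (x - b) | b in B] e e0; last by exists b.
split; first by exists (enorm (x - b0)), b0.
by exists 0 => _ [c _ <-]; exact: enorm_ge0.
Qed.

Lemma closure_enorm n (B : set 'rV[R]_n) a e : closure B a -> 0 < e ->
  exists2 b, B b & enorm (b - a) < e.
Proof.
move=> cB e0; have [|b [Bb ba]] := cB [set b | enorm (b - a) < e]; last by exists b.
by apply/nbhs_enorm; exists e.
Qed.

Lemma edist_closure n (B : set 'rV[R]_n) a : closure B a -> edist a B = 0.
Proof.
move=> cB; apply/eqP; rewrite eq_le; apply/andP; split.
  apply/ler_addgt0Pr => e e0; have [b Bb ba] := closure_enorm cB e0.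
  by rewrite add0r (le_trans (edist_le _ Bb))// enormC ltW.
have [b Bb _] := closure_enorm cB (@ltr01 R).
apply: lb_le_inf; first by exists (enorm (a - b)), b.
by move=> _ [c _ <-]; exact: enorm_ge0.
Qed.

(* A point [x] of [S] is near a limit direction [a] of [S] (follow the section of
   [S] through [x] to the origin); [a] is a limit direction of [T], and the sections
   of [T] through points of direction close to [a] reach the sphere of [x]. *)
Lemma direction_subset_order n (S T : set 'rV[R]_n) :
  subanalytic_germ0 S -> subanalytic_germ0 T -> direction_set S `<=` direction_set T ->
  exists del K e : R, [/\ 0 < del, 0 < K, 0 < e &
    forall x, S x -> 0 < enorm x <= del ->
      exists y, [/\ T y, enorm y = enorm x & enorm (x - y) <= K * enorm x `^ (1 + e)]].
Proof.
move=> /subanalytic_sections[dS [KS [eS [dS0 KS0 eS0 secS]]]].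
move=> /subanalytic_sections[dT [KT [eT [dT0 KT0 eT0 secT]]]] ST.
pose e := Num.min eS eT; have e0 : 0 < e by rewrite lt_min eS0.
have [eS' eT'] : e <= eS /\ e <= eT by rewrite !ge_min !lexx ?orbT.
pose del := Num.min (Num.min dS dT) 1.
have del0 : 0 < del by rewrite !lt_min dS0 dT0 ltr01.
have [leS [leT le1]] : del <= dS /\ del <= dT /\ del <= 1 by rewrite !ge_min !lexx ?orbT.
exists del, (KS + 1 + 1 + KT), e; split; rewrite ?addr_gt0// => x Sx /andP[x0 xd].
set t := enorm x in x0 xd *.
have t1 : t <= 1 by exact: le_trans xd le1.
have te0 : 0 < t `^ e by exact: powR_gt0.
have powS : KS * t `^ eS <= KS * t `^ e by rewrite ler_pM2l// ger_powR// x0.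
have powT : KT * t `^ eT <= KT * t `^ e by rewrite ler_pM2l// ger_powR// x0.
(* Radii shrinking to 0: the points that the section of [S] through [x] reaches on these spheres
   have directions accumulating at a limit direction [a]. *)
pose s (N : nat) : R := t / N.+1%:R.
have s0 N : 0 < s N by rewrite divr_gt0// ltr0n.
have st N : s N <= t by rewrite ler_pdivrMr ?ltr0n// ler_peMr ?(ltW x0)// ler1n.
have hy N : exists y, [/\ S y, enorm y = s N &
    enorm (t^-1 *: x - (s N)^-1 *: y) <= KS * t `^ e].
  have [||y [Sy ys h]] := secS x (s N) Sx.
  - by rewrite -/t x0 (le_trans xd).
  - by rewrite s0 (le_trans (st N))// (le_trans xd).
  by exists y; split=> //; apply: le_trans powS; rewrite -/t (max_idPl (st N)) in h.
have [y yP] := choice hy.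
pose u N := (s N)^-1 *: y N.
have uM N : enorm (u N) <= 1.
  have [_ yN _] := yP N.
  by rewrite enormZ yN gtr0_norm ?invr_gt0// mulVf ?gt_eqF.
have [a aP] := bolzano uM.
have Sa : direction_set S a.
  apply/direction_setP => eps eps0.
  have [N NN uN] := aP eps (Num.truncn (t / eps)) eps0.
  have [Sy yN _] := yP N; exists (y N); split=> //.
  - by rewrite -enorm_gt0 yN.
  - rewrite yN /s ltr_pdivrMr ?ltr0n// mulrC -ltr_pdivrMr//.
    by apply: (lt_le_trans (truncnS_gt _)); rewrite ler_nat.
  - by rewrite yN.
have [N _ uN] := aP _ 0%N te0.
have [_ _ xu] := yP N.
pose eps := Num.min t (t `^ e).
have eps0 : 0 < eps by rewrite lt_min x0.
have [z [Tz z0 zt za]] := (direction_setP T a).1 (ST _ Sa) eps eps0.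
have [zt' za'] : enorm z < t /\ enorm ((enorm z)^-1 *: z - a) < t `^ e.
  by move: zt za; rewrite !lt_min => /andP[-> _] /andP[_ ->].
have [||w [Tw wt zw]] := secT z t Tz.
- by rewrite enorm_gt0 z0 (le_trans (ltW zt'))// (le_trans xd).
- by rewrite x0 (le_trans xd).
exists w; split=> //.
rewrite (max_idPr (ltW zt')) in zw.
(* Four steps between directions: from [x] to [u N] along [S], to [a], to the direction of [z], and
   to that of [w] along [T]. Their costs, in multiples of t^e, are the four terms of
   [KS + 1 + 1 + KT]. *)
have E : x - w = t *: ((t^-1 *: x - u N) + (u N - a) + (a - (enorm z)^-1 *: z) +
    ((enorm z)^-1 *: z - t^-1 *: w)).
  rewrite !addrA !subrK scalerBr !scalerA mulfV ?gt_eqF//.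
  by rewrite !scale1r.
rewrite E enormZ gtr0_norm// powRD; last by rewrite (gt_eqF x0) implybT.
rewrite powRr1 ?(ltW x0)// [leRHS]mulrCA ler_pM2l// !mulrDl !mul1r.
have h1 := enormD (t^-1 *: x - u N + (u N - a) + (a - (enorm z)^-1 *: z)) ((enorm z)^-1 *: z - t^-1 *: w).
have h2 := enormD (t^-1 *: x - u N + (u N - a)) (a - (enorm z)^-1 *: z).
have h3 := enormD (t^-1 *: x - u N) (u N - a).
have h4 : enorm (a - (enorm z)^-1 *: z) < t `^ e by rewrite enormC.
by move: xu; rewrite -/(u N); lra.
Qed.

End Tangles.

Theorem theorem4p16 (R : realType) (n : nat) (A B : set 'rV[R]_n)
    (h : 'rV[R]_n -> 'rV[R]_n) (U : set 'rV[R]_n) :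
  closure A 0 -> closure B 0 ->
  bilipschitz_homeo_germ h U ->
  subanalytic_germ0 (h @` (A `&` U)) ->
  subanalytic_germ0 (h @` (B `&` U)) ->
  (direction_set (h @` (A `&` U)) `<=` direction_set (h @` (B `&` U)) <->
   exists d C : R, 1 < d /\ 0 < C /\ germ_subset A (sea_tangle d C B)).
Proof.
move=> clA clB [[h0 oU U0 ohU] [hinj [_ [[g [gh gc]] [K1 [K2 [r [K10 K12 r0 lip]]]]]]]] sA sB.
have K20 : 0 < K2 by exact: lt_le_trans K12.
have /nbhs_enorm[dU dU0 dUP] : nbhs (0 : 'rV[R]_n) U by exact: open_nbhs_nbhs.
have lip0 x : enorm x < r -> K1 * enorm x <= enorm (h x) <= K2 * enorm x.
  move=> xr; have [] := lip x 0 xr; first by rewrite enorm0.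
  by rewrite h0 !subr0 => -> ->.
(* The Lipschitz bounds hold only near 0; continuity of the inverse [g] brings a point of [U] with
   small image into that range. *)
have hback e : 0 < e -> exists2 d, 0 < d & forall x, U x -> enorm (h x) < d -> enorm x < e.
  move=> e0; have hU0 : (h @` U) 0 by exists 0.
  have : nbhs (g 0) [set y | enorm y < e].
    have -> : g 0 = 0 by have := gh 0 U0; rewrite h0.
    by apply/nbhs_enorm; exists e => // x; rewrite subr0.
  move/subspace_continuousP: gc => /(_ 0 hU0) gc0 /gc0.
  rewrite /nbhs /= => /nbhs_enorm[d d0 dP]; exists d => // x Ux hxd.
  have := dP (h x); rewrite subr0 => /(_ hxd) Q.
  have : enorm (g (h x)) < e by apply: Q; exists x.
  by rewrite gh.
have [dr dr0 drP] := hback r r0.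
have Bn : B !=set0 by have [b Bb _] := closure_enorm clB (@ltr01 R); exists b.
split=> [AB|[d [C [d1 [C0 [r1 [r10 AC]]]]]]].
  have [del [K [e [del0 K0 e0 H]]]] := direction_subset_order sA sB AB.
  (* From K1 |x - b| <= |h x - h b| <= K |h x|^(1 + e) and |h x| <= K2 |x|. *)
  exists (1 + e), (K / K1 * K2 `^ (1 + e)); split; first by rewrite ltrDl.
  split; first by rewrite mulr_gt0 ?powR_gt0// divr_gt0.
  pose rho := Num.min (Num.min r dU) (Num.min (del / K2) (dr / K2)).
  have rho0 : 0 < rho by rewrite !lt_min r0 dU0 !divr_gt0.
  exists rho; split=> // x [Ax]; rewrite /eball0 /= !lt_min => /andP[/andP[xr xU] /andP[xd xdr]].
  have Ux : U x by apply: dUP; rewrite subr0.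
  rewrite /sea_tangle /=.
  have [->|x0] := eqVneq x 0.
    rewrite edist_closure// mulr_ge0 ?powR_ge0// mulr_ge0 ?powR_ge0// divr_ge0// ltW//.
  have /andP[l1 l2] := lip0 x xr.
  have ex : 0 < enorm x by rewrite enorm_gt0.
  have hx0 : 0 < enorm (h x) by apply: lt_le_trans l1; rewrite mulr_gt0.
  rewrite ltr_pdivlMr// mulrC in xd; rewrite ltr_pdivlMr// mulrC in xdr.
  have [||y [[b [Bb Ub] <-] bx xb]] := H (h x) _ _.
  - by exists x.
  - by rewrite hx0 (le_trans l2)// ltW.
  have br : enorm b < r by apply: drP; rewrite // bx (le_lt_trans l2).
  have [l3 _] := lip x b xr br.
  apply: le_trans (edist_le _ Bb) _.
  rewrite -(ler_pM2l K10) (le_trans l3)// (le_trans xb)//.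
  have -> : K1 * (K / K1 * K2 `^ (1 + e) * enorm x `^ (1 + e)) =
    K * (K2 * enorm x) `^ (1 + e).
    by rewrite powRM ?enorm_ge0 ?(ltW K20)//; field; rewrite gt_eqF.
  rewrite ler_pM2l// ge0_ler_powR ?nnegrE ?mulr_ge0 ?enorm_ge0 ?(ltW K20)//.
  by rewrite addr_ge0// ltW.
move=> a /direction_setP Da; apply/direction_setP => e e0.
(* The constant in |h x - h b| <= L |h x|^d; the 1 in [C + 1] pays for a [b] that only nearly
   attains the distance to [B]. *)
pose L := K2 * (C + 1) * (K1^-1) `^ d.
have C1 : 0 < C + 1 by rewrite addr_gt0.
have iK1 : 0 < K1^-1 by rewrite invr_gt0.
have L0 : 0 < L by rewrite !mulr_gt0 ?powR_gt0.
have d10 : 0 < d - 1 by rewrite subr_gt0.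
(* A bound for |h x - h b| / |h x|: at most 1/2, it keeps [h b] nonzero and of norm at most 3/2 of
   that of [h x]; at most e / 4, it changes the direction by at most e / 2. *)
pose e1 := Num.min (e / 4) 2^-1.
have e10 : 0 < e1 by rewrite lt_min divr_gt0// invr_gt0 ltr0n.
have [del del0 delP] := powR_small L0 d10 e10.
have m0 : 0 < Num.min r dU by rewrite lt_min r0.
have [eta eta0 etaP] := powR_small C1 (lt_trans ltr01 d1) (divr_gt0 m0 (ltr0n R 2)).
(* One half of [Num.min r dU] is for [x], and [eta] keeps |x - b| within the other half, so that [b]
   stays where [h] is controlled. *)
pose rho := Num.min (Num.min r r1) (Num.min (Num.min r dU / 2) eta).
have rho0 : 0 < rho by rewrite !lt_min r0 r10 eta0 (divr_gt0 m0).
have [dr' dr'0 dr'P] := hback rho rho0.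
pose e2 := Num.min (Num.min dr' del) (e / 4).
have e20 : 0 < e2 by rewrite !lt_min dr'0 del0 divr_gt0.
have [_ [[x [Ax Ux] <-] hx0]] := Da e2 e20.
rewrite !lt_min => /andP[/andP[hx1 hx2] hx3] /andP[_ hx4].
have := dr'P x Ux hx1; rewrite !lt_min => /andP[/andP[xr xr1] /andP[xm xeta]].
have /andP[l1 l2] := lip0 x xr.
have ex : 0 < enorm x.
  rewrite enorm_gt0; apply: contraNneq hx0 => ->; by rewrite h0.
have ehx : 0 < enorm (h x) by rewrite enorm_gt0.
have xd0 : 0 < enorm x `^ d by exact: powR_gt0.
have [b Bb xb] := edist_adherent x Bn xd0.
have {}xb : enorm (x - b) <= (C + 1) * enorm x `^ d.
  apply: le_trans (ltW xb) _; rewrite mulrDl mul1r lerD2r.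
  by apply: AC; split.
have xb' : enorm (x - b) <= Num.min r dU / 2.
  by apply: le_trans xb _; apply: etaP; rewrite ex ltW.
have [br bU] : enorm b < r /\ enorm b < dU.
  apply/andP; rewrite -lt_min; have := enormD x (b - x); rewrite addrC subrK enormC; lra.
have Ub : U b by apply: dUP; rewrite subr0.
have [_ hxb] := lip x b xr br.
have hxb' : enorm (h x - h b) <= e1 * enorm (h x).
  apply: le_trans hxb _; apply: (@le_trans _ _ (K2 * ((C + 1) * (enorm (h x) / K1) `^ d))).
    rewrite ler_pM2l// (le_trans xb)// ler_pM2l//.
    apply: ge0_ler_powR; rewrite ?nnegrE ?divr_ge0 ?enorm_ge0 ?(ltW K10)//.
      by rewrite ltW// (lt_trans ltr01).
    by rewrite ler_pdivlMr// mulrC.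
  rewrite powRM ?enorm_ge0 ?(ltW iK1)//.
  have -> : enorm (h x) `^ d = enorm (h x) * enorm (h x) `^ (d - 1).
    by rewrite mulr_powRB1 ?enorm_ge0// (lt_trans ltr01).
  have -> : K2 * ((C + 1) * (enorm (h x) * enorm (h x) `^ (d - 1) * K1^-1 `^ d)) =
    L * enorm (h x) `^ (d - 1) * enorm (h x) by rewrite /L; ring.
  by rewrite ler_pM2r//; apply: delP; rewrite ehx ltW.
have [e1a e1b] : e1 <= e / 4 /\ e1 <= 2^-1 by rewrite !ge_min !lexx orbT.
have hb1 := le_trans (enorm_dist (h x) (h b)) hxb'.
have ehb : 0 < enorm (h b).
  have : e1 * enorm (h x) <= 2^-1 * enorm (h x) by rewrite ler_pM2r.
  by move: hb1; rewrite ler_norml; lra.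
have hb0 : h b != 0 by rewrite -enorm_gt0.
exists (h b); split=> //; first by exists b.
  have : e1 * enorm (h x) <= 2^-1 * enorm (h x) by rewrite ler_pM2r.
  by move: hb1; rewrite ler_norml; lra.
have := unit_dist hx0 hb0 => /le_lt_trans; move/(_ (e * 3 / 4)).
have E : 2 * enorm (h x - h b) / enorm (h x) < e * 3 / 4.
  rewrite ltr_pdivrMr//; apply: (@le_lt_trans _ _ (2 * (e1 * enorm (h x)))).
    by rewrite ler_pM2l.
  rewrite mulrA ltr_pM2r//; lra.
move=> /(_ E) {}E.
have -> : (enorm (h b))^-1 *: h b - a = - ((enorm (h x))^-1 *: h x - (enorm (h b))^-1 *: h b) +
   ((enorm (h x))^-1 *: h x - a) by rewrite opprB addrA subrK.
rewrite (le_lt_trans (enormD _ _))// enormN; lra.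
Qed.
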